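(* Let $(X,d)$ be a compact metric space and $(\Omega,\mathscr F,\mathbb P)$ a Bernoulli product probability space. Let $f:\Omega\times X\to X$ be a mostly contracting random map such that $$\int \mathrm{Lip}(f_\omega)^\beta\,d\mathbb P<\infty\quad\text{for some }\beta>0.$$ Let $P:C(X)\to C(X)$, $P\varphi(x)=\int\varphi(f_\omega(x))\,d\mathbb P$, be the annealed Koopman operator associated with $f$. Then there exists $\alpha_0>0$ such that $P$ is a quasi-compact operator on $C^\alpha(X)$ for any $0<\alpha\le\alpha_0$. Moreover (with $P$ acting on $C^\alpha(X)$): (a) $1$ is a simple eigenvalue of $P$ if and only if $f$ is uniquely ergodic; (b) $1$ is the unique eigenvalue of $P$ with modulus $1$ if and only if $f$ is aperiodic; (c) $P$ has a spectral gap if and only if $f$ is mingled.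
   Context: Bernoulli product space: $(\Omega,\mathscr F,\mathbb P)=(T^{\mathbb N},\mathscr A^{\mathbb N},p^{\mathbb N})$ for a probability space $(T,\mathscr A,p)$. A (Bernoulli) random map is a measurable $f:\Omega\times X\to X$ such that $f_\omega:=f(\omega,\cdot)=f_{\omega_0}$ depends only on $\omega_0$ for $\mathbb P$-a.e. $\omega$. Put $f^0_\omega=\mathrm{id}$, $f^n_\omega=f_{\omega_{n-1}}\circ\cdots\circ f_{\omega_0}$. A Borel probability measure $\mu$ on $X$ is $f$-stationary if $\mathbb P\times\mu$ is invariant under $F(\omega,x)=(\sigma\omega,f_\omega(x))$, $\sigma$ the shift. For a Lipschitz map $g$, $\mathrm{Lip}(g)$ is its Lipschitz constant and $Lg(z)=\lim_{r\to0^+}\mathrm{Lip}(g|_{B(z,r)})$. A random map $f$ with $\mathrm{Lip}(f_\omega)<\infty$ a.s. is mostly contracting if $\int\log^+\mathrm{Lip}(f_\omega)\,d\mathbb P<\infty$ and $\sup\{\lambda(\mu):\mu\ f\text{-stationary}\}<0$, where $\lambda(\mu)=\lim_n\frac1n\int\log Lf^n_\omega(x)\,d\mathbb P\,d\mu\in[-\infty,\infty)$. A closed set $Y\subset X$ is $f^k$-invariant if $f^k_\omega(Y)\subset Y$ for $\mathbb P$-a.e. $\omega$. The random map $f$ is: uniquely ergodic if it has a unique $f$-stationary probability measure; mingled if for every $k\ge1$ there do not exist two disjoint non-empty closed $f^k$-invariant sets; aperiodic if there do not exist $p\ge2$ and pairwise disjoint non-empty closed sets $F_1,\dots,F_p$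 with $f_\omega(F_i)\subset F_{i+1}$ for $1\le i<p$ and $f_\omega(F_p)\subset F_1$ for $\mathbb P$-a.e. $\omega$. $C^\alpha(X)$ is the Banach space of $\alpha$-Hölder functions with norm $\|\varphi\|_\alpha=\|\varphi\|_\infty+\sup_{x\ne y}|\varphi(x)-\varphi(y)|/d(x,y)^\alpha$. For a Banach space $\mathcal E\subset C(X)$ containing the constants, $P$ is quasi-compact on $\mathcal E$ if $P:\mathcal E\to\mathcal E$ is bounded and there are a compact linear operator $R$ on $\mathcal E$ and $n\in\mathbb N$ with $\|P^n-R\|_{\mathrm{op}}<1$. It has a spectral gap on $\mathcal E$ if it is quasi-compact on $\mathcal E$ and $P\varphi=\lambda\varphi$ with $|\lambda|=1$, $\varphi\in\mathcal E\setminus\{0\}$, forces $\lambda=1$ and $\varphi$ constant. Eigenvalues and eigenfunctions are understood on the complexification (complex-valued functions). *)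

(* Defs.v *)
From HB Require Import structures.
From mathcomp Require Import all_boot all_order all_algebra.
From mathcomp Require Import all_classical all_reals all_analysis.
From mathcomp Require Import complex.

Set Implicit Arguments.
Unset Strict Implicit.
Unset Printing Implicit Defensive.

Import Order.TTheory GRing.Theory Num.Theory.
Import numFieldNormedType.Exports.

Local Open Scope classical_set_scope.
Local Open Scope ring_scope.

(* [measurableType] requires a base point, hence so does the state space;
   in particular it is non-empty. *)
#[short(type="pmetricType")]
HB.structure Definition PointedMetric (K : numDomainType) :=
  {M of Pointed M & Metric K M}.

Notation borel X := (g_sigma_algebraType (@open X)).

Section Bernoulli.
Context {R : realType} {d : measure_display} {T : measurableType d}.

Definition coordinate_preimages : set (set (nat -> T)) :=
  \bigcup_(i in [set: nat])
    preimage_set_system setT (fun w : nat -> T => w i) measurable.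

Definition bernoulli_space := g_sigma_algebraType coordinate_preimages.

HB.instance Definition _ := Measurable.on bernoulli_space.

(* By Dynkin's theorem this determines [Pr], i.e. [Pr] is the power [p^nat]. *)
Definition bernoulli_product (p : probability T R)
    (Pr : probability bernoulli_space R) : Prop :=
  forall (n : nat) (A : nat -> set T), (forall i, measurable (A i)) ->
    Pr [set w | forall i, (i < n)%N -> A i (w i)] =
    (\prod_(i < n) p (A i))%E.

Definition shift (w : bernoulli_space) : bernoulli_space := fun i => w i.+1.

End Bernoulli.

Arguments bernoulli_space {d} T.

Section Lipschitz.
Context {R : realType} {X : metricType R}.

(* Lip(g|_A) as the least admissible constant, [+oo] if there is none. *)
Definition Lip_on (A : set X) (g : X -> X) : \bar R :=
  ereal_inf [set L%:E | L in [set L : R | 0 <= L /\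
    forall x y, A x -> A y -> mdist (g x) (g y) <= L * mdist x y]].

Definition Lip (g : X -> X) : \bar R := Lip_on setT g.

Definition local_Lip (g : X -> X) (z : X) : \bar R :=
  lim (Lip_on (ball z r) g @[r --> (0 : R)^'+]).

End Lipschitz.

Section RandomMaps.
Context {R : realType} {d : measure_display} {T : measurableType d}.
Context {X : pmetricType R}.
Variables (Pr : probability (bernoulli_space T) R).
Variable f : bernoulli_space T -> X -> X.

Definition random_map : Prop :=
  measurable_fun setT
    (fun z : bernoulli_space T * borel X => (f z.1 z.2 : borel X)) /\
  exists g : T -> X -> X, {ae Pr, forall w, f w = g (w 0%N)}.

(* f(shift^(n-1) w) o ... o f(w), which for a random map is almost surely
   f_{w_(n-1)} o ... o f_{w_0}. *)
Fixpoint fiter (n : nat) (w : bernoulli_space T) : X -> X :=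
  if n is m.+1 then f (iter m shift w) \o fiter m w else id.

Definition skew (z : bernoulli_space T * borel X) :
  bernoulli_space T * borel X := (shift z.1, f z.1 z.2).

Definition stationary (mu : probability (borel X) R) : Prop :=
  forall A : set (bernoulli_space T * borel X), measurable A ->
    (Pr \x mu)%E (skew @^-1` A) = (Pr \x mu)%E A.

Definition lyapunov (mu : probability (borel X) R) : \bar R :=
  limn (fun n : nat => ((n%:R : R)^-1)%:E *
    \int[(Pr \x mu)%E]_z lne (local_Lip (fiter n z.1) z.2))%E.

Definition mostly_contracting : Prop :=
  [/\ {ae Pr, forall w, (Lip (f w) < +oo)%E},
      (\int[Pr]_w maxe 0 (lne (Lip (f w))) < +oo)%E &
      (ereal_sup [set lyapunov mu | mu in [set mu | stationary mu]] < 0)%E].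

(* Measures are functions on all subsets, so that uniqueness has to be
   understood on the Borel sets. *)
Definition uniquely_ergodic : Prop :=
  (exists mu, stationary mu) /\
  forall mu nu, stationary mu -> stationary nu ->
    forall A : set (borel X), measurable A -> mu A = nu A.

Definition invariant_set (k : nat) (Y : set X) : Prop :=
  {ae Pr, forall w, fiter k w @` Y `<=` Y}.

Definition mingled : Prop :=
  forall k : nat, (1 <= k)%N ->
    ~ exists Y Z : set X,
      [/\ [/\ closed Y, Y !=set0 & invariant_set k Y],
          [/\ closed Z, Z !=set0 & invariant_set k Z] &
          Y `&` Z = set0].

(* [ordS] is the cyclic successor on ['I_p]. *)
Definition aperiodic : Prop :=
  ~ exists (p : nat) (F : 'I_p -> set X),
    [/\ (2 <= p)%N,
        forall i, closed (F i) /\ F i !=set0,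
        forall i j, i != j -> F i `&` F j = set0 &
        {ae Pr, forall w, forall i, f w @` F i `<=` F (ordS i)}].

Definition koopman (u : X -> R) : X -> R :=
  fun x => \int[Pr]_w u (f w x).

End RandomMaps.

Section HoelderSpace.
Context {R : realType} {X : metricType R} (alpha : R).
Implicit Types u v : X -> R.

Definition absolute_values u : set R := [set `|u x| | x in setT].

Definition hoelder_quotients u : set R :=
  [set `|u z.1 - u z.2| / mdist z.1 z.2 `^ alpha
     | z in [set z : X * X | z.1 <> z.2]].

(* On a compact space the first condition follows from the second one when
   [0 < alpha]. *)
Definition hoelder_continuous u : Prop :=
  has_ubound (absolute_values u) /\ has_ubound (hoelder_quotients u).

Definition hoelder_norm u : R :=
  sup (absolute_values u) + sup (hoelder_quotients u).

Let quotient_ge0 u r : hoelder_quotients u r -> 0 <= r.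
Proof. by move=> [z _ <-]; rewrite divr_ge0// powR_ge0. Qed.

Let supD (A B C : set R) : has_ubound B -> has_ubound C ->
  (forall r, B r -> 0 <= r) -> (forall r, C r -> 0 <= r) ->
  (forall r, A r -> exists b c, [/\ B b, C c & r <= b + c]) ->
  has_ubound A /\ sup A <= sup B + sup C.
Proof.
move=> hB hC B0 C0 hA.
have ub : ubound A (sup B + sup C).
  move=> r /hA[b [c [Bb Cc]]] /le_trans; apply.
  by apply: lerD; exact: ub_le_sup.
split; first by exists (sup B + sup C).
have [->|/set0P A0] := eqVneq A set0; last exact: ge_sup.
have sup_ge0 (D : set R) : has_ubound D -> (forall r, D r -> 0 <= r) ->
    0 <= sup D.
  move=> hD D0; have [->|/set0P[r Dr]] := eqVneq D set0; first by rewrite sup0.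
  by apply: le_trans (D0 _ Dr) _; exact: ub_le_sup.
by rewrite sup0 addr_ge0// sup_ge0.
Qed.

Let supZ (A B : set R) (a : R) : 0 <= a -> has_ubound B ->
  (forall r, A r -> exists2 b, B b & r = a * b) ->
  (forall b, B b -> A (a * b)) ->
  has_ubound A /\ sup A = a * sup B.
Proof.
move=> a0 hB hA hBA.
have ub : ubound A (a * sup B).
  by move=> r /hA[b Bb ->]; apply: ler_wpM2l => //; exact: ub_le_sup.
have hubA : has_ubound A by exists (a * sup B).
split=> //; have [B0|/set0P[b0 Bb0]] := eqVneq B set0.
  have -> : A = set0.
    by apply/seteqP; split=> // r /hA[b]; rewrite B0.
  by rewrite B0 sup0 mulr0.
have A0 : A !=set0 by exists (a * b0); exact: hBA.
apply/eqP; rewrite eq_le ge_sup//=.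
have [az|an0] := eqVneq a 0.
  have := hBA _ Bb0; rewrite az !mul0r => A00.
  exact: ub_le_sup.
have ap : 0 < a by rewrite lt_def an0.
rewrite -ler_pdivlMl//; apply: ge_sup; first by exists b0.
by move=> b Bb; rewrite ler_pdivlMl//; apply: ub_le_sup => //; exact: hBA.
Qed.

Let absD u v : has_ubound (absolute_values u) ->
  has_ubound (absolute_values v) ->
  has_ubound (absolute_values (u + v)) /\
  sup (absolute_values (u + v)) <=
    sup (absolute_values u) + sup (absolute_values v).
Proof.
move=> hu hv; apply: supD => //; [by move=> _ [x _ <-]..|].
move=> _ [x _ <-]; exists `|u x|, `|v x|; split; [by exists x..|].
exact: ler_normD.
Qed.

Let quotD u v : has_ubound (hoelder_quotients u) ->
  has_ubound (hoelder_quotients v) ->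
  has_ubound (hoelder_quotients (u + v)) /\
  sup (hoelder_quotients (u + v)) <=
    sup (hoelder_quotients u) + sup (hoelder_quotients v).
Proof.
move=> hu hv; apply: supD => //; [exact: quotient_ge0..|].
move=> _ [z zn <-].
exists (`|u z.1 - u z.2| / mdist z.1 z.2 `^ alpha).
exists (`|v z.1 - v z.2| / mdist z.1 z.2 `^ alpha).
split; [by exists z..|].
rewrite -mulrDl ler_wpM2r ?invr_ge0 ?powR_ge0//.
have -> : (u + v) z.1 - (u + v) z.2 = (u z.1 - u z.2) + (v z.1 - v z.2).
  by rewrite addrACA -opprD.
exact: ler_normD.
Qed.

Let absZ (a : R) u : has_ubound (absolute_values u) ->
  has_ubound (absolute_values (a *: u)) /\
  sup (absolute_values (a *: u)) = `|a| * sup (absolute_values u).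
Proof.
move=> hu; apply: supZ => //.
  by move=> _ [x _ <-]; exists `|u x|; [exists x|rewrite -normrM].
by move=> _ [x _ <-]; exists x => //; rewrite -normrM.
Qed.

Let quotZ (a : R) u : has_ubound (hoelder_quotients u) ->
  has_ubound (hoelder_quotients (a *: u)) /\
  sup (hoelder_quotients (a *: u)) = `|a| * sup (hoelder_quotients u).
Proof.
have E z : `|(a *: u) z.1 - (a *: u) z.2| / mdist z.1 z.2 `^ alpha =
    `|a| * (`|u z.1 - u z.2| / mdist z.1 z.2 `^ alpha).
  by rewrite mulrA -normrM mulrBr.
move=> hu; apply: supZ => //.
  move=> _ [z zn <-]; exists (`|u z.1 - u z.2| / mdist z.1 z.2 `^ alpha).
    by exists z.
  exact: E.
by move=> _ [z zn <-]; exists z.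
Qed.

Definition hoelder_pred : {pred X -> R} := fun u => `[< hoelder_continuous u >].

Let hoelder_submod : submod_closed hoelder_pred.
Proof.
split=> [|a u v /asboolP[u1 u2] /asboolP[v1 v2]].
  apply/asboolP; split.
    by exists 0 => _ [x _ <-]; rewrite normr0.
  by exists 0 => _ [z _ <-]; rewrite subrr normr0 mul0r.
apply/asboolP; split.
  exact: (absD (absZ a u1).1 v1).1.
exact: (quotD (quotZ a u2).1 v2).1.
Qed.

HB.instance Definition _ :=
  GRing.isSubmodClosed.Build R (X -> R) hoelder_pred hoelder_submod.

Record hoelder_space := HoelderSpace {
  hoelder_fun :> X -> R;
  _ : hoelder_fun \in hoelder_pred }.

HB.instance Definition _ := [isSub for hoelder_fun].
HB.instance Definition _ := [Choice of hoelder_space by <:].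
HB.instance Definition _ :=
  [SubChoice_isSubLmodule of hoelder_space by <:].

Let hoelder_spaceP (u : hoelder_space) : hoelder_continuous u.
Proof. by case: u => u /= /asboolP. Qed.

Let hoelder_normD (u v : hoelder_space) :
  hoelder_norm (u + v) <= hoelder_norm u + hoelder_norm v.
Proof.
have [u1 u2] := hoelder_spaceP u; have [v1 v2] := hoelder_spaceP v.
by rewrite addrACA lerD// ?(absD u1 v1).2 ?(quotD u2 v2).2.
Qed.

Let hoelder_normZ (a : R) (u : hoelder_space) :
  hoelder_norm (a *: u) = `|a| * hoelder_norm u.
Proof.
have [u1 u2] := hoelder_spaceP u.
by rewrite /hoelder_norm mulrDr -(absZ a u1).2 -(quotZ a u2).2.
Qed.

Let hoelder_norm0_eq0 (u : hoelder_space) : hoelder_norm u = 0 -> u = 0.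
Proof.
have [[M1 M1u] [M2 M2u]] := hoelder_spaceP u.
have q0 : 0 <= sup (hoelder_quotients u).
  have [->|/set0P[r ur]] := eqVneq (hoelder_quotients u) set0.
    by rewrite sup0.
  by apply: le_trans (quotient_ge0 ur) _; apply: ub_le_sup => //; exists M2.
move=> n0; apply/val_inj/funext => x /=; apply/eqP; rewrite -normr_le0.
apply: (@le_trans _ _ (sup (absolute_values u))).
  by apply: ub_le_sup; [exists M1|exists x].
by rewrite -n0 lerDl.
Qed.

HB.instance Definition _ := Lmodule_isNormed.Build R hoelder_space
  hoelder_normD hoelder_normZ hoelder_norm0_eq0.

End HoelderSpace.

Arguments hoelder_space {R} X alpha.

Section Operators.
Context {R : realType} {E : normedModType R}.

Definition operator_norm (A : E -> E) : \bar R :=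
  ereal_sup [set `|A u|%:E | u in [set u : E | `|u| <= 1]].

Definition compact_operator (A : {linear E -> E}) : Prop :=
  precompact (A @` [set u : E | `|u| <= 1]).

End Operators.

(* Operators on a normed space [E] of real functions on [X], [iota] being the
   inclusion; [P] is given on all functions. *)
Section FunctionSpaces.
Context {R : realType} {X : Type} {E : normedModType R}.
Variables (iota : E -> X -> R) (P : (X -> R) -> (X -> R)).

Definition quasi_compact : Prop :=
  exists Q : {linear E -> E},
    [/\ forall u, iota (Q u) = P (iota u),
        (operator_norm Q < +oo)%E &
        exists (K : {linear E -> E}) (n : nat), compact_operator K /\
          (operator_norm (fun u => (iter n Q u - K u)%R) < 1)%E].

Local Open Scope complex_scope.

Definition complexified_space : set (X -> R[i]) :=
  [set phi | exists u v : E, forall x, phi x = iota u x +i* iota v x].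

Definition complexified (phi : X -> R[i]) : X -> R[i] := fun x =>
  P (fun y => complex.Re (phi y)) x +i* P (fun y => complex.Im (phi y)) x.

Definition eigenfunction (lambda : R[i]) (phi : X -> R[i]) : Prop :=
  [/\ complexified_space phi, exists x, phi x != 0 &
      forall x, complexified phi x = lambda * phi x].

Definition eigenvalue_of (lambda : R[i]) : Prop :=
  exists phi, eigenfunction lambda phi.

(* Algebraic multiplicity one: the generalised eigenspace is a line. *)
Definition simple_eigenvalue (lambda : R[i]) : Prop :=
  exists2 phi, eigenfunction lambda phi &
    forall psi (k : nat), complexified_space psi ->
      (forall x,
        iter k (fun h y => complexified h y - lambda * h y) psi x = 0) ->
      exists c : R[i], forall x, psi x = c * phi x.

Definition spectral_gap : Prop :=
  quasi_compact /\
  forall lambda phi, `|lambda| = 1 -> eigenfunction lambda phi ->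
    lambda = 1 /\ exists c : R[i], forall x, phi x = c.

End FunctionSpaces.

(* Main.v *)
(* Negative exponents give contraction on average at small scales: for some n, r
   and q < 1, E d(f^n y, f^n z)^a <= q d(y, z)^a whenever d(y, z) < r.  Otherwise a
   stationary measure obtained from the orbits of points where the averaged
   logarithmic moduli of f^n are nonnegative would have a nonnegative exponent.
   Hence the Lasota-Yorke inequality |P^(kn) u|_a <= max (q^k |u|_a, 2 |u|_oo / r^a),
   and P is quasi-compact because a partition of unity approximates functions by
   finite rank operators in the uniform norm.  A peripheral eigenfunction phi
   satisfies phi (f_w x) = lambda phi (x) almost surely on {|phi| = max |phi|}, where
   it is locally constant by contraction; so lambda is a root of unity and the level
   sets of phi are permuted cyclically.  Conversely disjoint invariant or cyclic
   sets yield eigenfunctions, as Cesaro ultralimits of Hoelder functions that are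
   constant on these sets.  Replacing f on a null set makes all maps Lipschitz. *)

Require Import Defs.
From HB Require Import structures.
From mathcomp Require Import all_boot all_order all_algebra.
From mathcomp Require Import all_classical all_reals all_analysis.
From mathcomp Require Import complex measurable_realfun ring lra.

Set Implicit Arguments.
Unset Strict Implicit.
Unset Printing Implicit Defensive.

Import Order.TTheory GRing.Theory Num.Theory.
Import numFieldNormedType.Exports.

Local Open Scope classical_set_scope.
Local Open Scope ring_scope.

(** * Integrals and the Bernoulli shift *)

(* The integrands of [koopman], [lyapunov] and of the moment hypothesis need not
   be measurable, hence no measurability is assumed here. *)
Section integral_nomeas.
Context d (T : measurableType d) (R : realType) (mu : {measure set T -> \bar R}).
Implicit Types f g : T -> \bar R.
Local Open Scope ereal_scope.
Import HBNNSimple.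

(** The local Lipschitz constant is only semicontinuous in the point and its logarithm may be [-oo],
    so it cannot be tested directly against weak limits of measures. It is replaced by
    [log_modulus k]: a supremum over countably many pairs of points, floored at [- k] and penalised
    by [k] times the distance to the base point. For fixed [k] this is Lipschitz in the point and
    measurable in the map, hence a test function for limits of empirical averages; as [k] grows it
    decreases to the logarithm of the local constant, and integrals follow by monotone convergence.
    The price is that the chain rule holds only as the scale tends to infinity, which
    [v_subadditive] absorbs. The passage from a negative mean logarithm to contraction of a mean
    power is a second-order expansion of the exponential in the exponent [a]; the moment hypothesis
    bounds the remainder. Spectral projections are avoided: fixed functions are limits of Cesaro
    means, and these limits are Hoelder and uniform because all iterates of a Hoelder function share
    one Hoelder constant. *)

Lemma ge0_le_integral_nomeas f g : (forall x, 0 <= f x) ->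
  (forall x, f x <= g x) -> \int[mu]_x f x <= \int[mu]_x g x.
Proof.
move=> f0 fg; have g0 x : 0 <= g x by exact: le_trans (fg x).
rewrite !ge0_integralTE//; apply: ge_ereal_sup => /= _ [h hf <-].
by apply: ereal_sup_ubound; exists h => // x; exact: le_trans (fg x).
Qed.

(** The integral of [f] is a supremum over simple functions [h] below [f]. Multiplying [h] by the
    indicator of the complement of [N] keeps its integral and puts it below [g] everywhere, so only
    [h] and [N] have to be measurable. *)
Let ge0_ae_le f g (N : set T) : measurable N -> mu N = 0 ->
  (forall x, 0 <= f x) -> (forall x, 0 <= g x) ->
  (forall x, ~ N x -> f x = g x) -> \int[mu]_x f x <= \int[mu]_x g x.
Proof.
move=> mN N0 f0 g0 fg; rewrite [leLHS]ge0_integralTE//.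
apply: ge_ereal_sup => /= _ [h hf <-]; rewrite -integralT_nnsfun.
have mh : measurable_fun setT (EFin \o h) by exact/measurable_EFinP.
have mhN : measurable_fun setT (fun x => (h x)%:E * (\1_(~` N) x)%:E).
  apply: emeasurable_funM => //.
  by apply/measurable_EFinP; exact: measurable_indic (measurableC mN).
rewrite (@ae_eq_integral _ _ _ _ _ (fun x => (h x)%:E * (\1_(~` N) x)%:E))//.
- apply: ge0_le_integral_nomeas => x.
    by rewrite mule_ge0// lee_fin ?indicE//; exact: fun_ge0.
  rewrite indicE; have [Nx|Nx] := boolP (x \in ~` N).
    by rewrite mule1 (le_trans (hf x))// fg//; move: Nx; rewrite inE.
  by rewrite mule0.
- exists N; split => // x /=; apply: contra_notP => Nx _.
  by rewrite indicE mem_set// mule1.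
Qed.

Lemma ae_eq_integral_nomeas f g : {ae mu, forall x, f x = g x} ->
  \int[mu]_x f x = \int[mu]_x g x.
Proof.
move=> [N [mN N0 fgN]].
have fg x : ~ N x -> f x = g x by move=> Nx; apply: contrapT => ?; exact/Nx/fgN.
have ge0 (u v : T -> \bar R) : (forall x, 0 <= u x) -> (forall x, 0 <= v x) ->
    (forall x, ~ N x -> u x = v x) -> \int[mu]_x u x = \int[mu]_x v x.
  move=> u0 v0 uv; apply/eqP; rewrite eq_le; apply/andP; split;
    apply: (ge0_ae_le mN) => // x /uv->//.
rewrite integralE [RHS]integralE; congr (_ - _); apply: ge0 => // x Nx.
- by rewrite unlock fg.
- by rewrite unlock fg.
Qed.

End integral_nomeas.

Lemma ae_eq_Rintegral_nomeas d (T : measurableType d) (R : realType)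
    (mu : {measure set T -> \bar R}) (f g : T -> R) :
  {ae mu, forall x, f x = g x} -> \int[mu]_x f x = \int[mu]_x g x.
Proof.
move=> fg; congr fine; apply: ae_eq_integral_nomeas.
by apply: filterS fg => x ->.
Qed.

Lemma integral_probability_cst d (T : measurableType d) (R : realType)
  (P : probability T R) (c : \bar R) : (\int[P]_x c = c)%E.
Proof.
rewrite integral_cst// [X in (_ * X)%E](_ : _ = 1%E) ?mule1//.
exact: probability_setT.
Qed.

Lemma product_probability_setT d1 d2 (T1 : measurableType d1)
    (T2 : measurableType d2) (R : realType) (P : probability T1 R)
    (mu : {sigma_finite_measure set T2 -> \bar R}) (B : set T2) :
  measurable B -> (P \x mu)%E (setT `*` B) = mu B.
Proof.
move=> mB; rewrite product_measure1E// -[RHS]mul1e; congr (_ * _)%E.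
exact: probability_setT.
Qed.

Section pushforward_measure.
Local Open Scope ereal_scope.
Context d d' (T1 : measurableType d) (T2 : measurableType d') (R : realType).
Variables (m : {measure set T1 -> \bar R}) (f : T1 -> T2).
Hypothesis mf : measurable_fun [set: T1] f.

Definition pushforward_measure : {measure set T2 -> \bar R} :=
  measure_function_pushforward__canonical__measure_function_Measure m mf.

Lemma ge0_integral_pushforward_measure (g : T2 -> \bar R) :
  measurable_fun setT g -> (forall y, 0 <= g y) ->
  \int[pushforward_measure]_y g y = \int[m]_x g (f x).
Proof. by move=> mg g0; exact: ge0_integral_pushforward. Qed.

End pushforward_measure.

Section bernoulli_shift.
Context (R : realType) (d : measure_display) (T : measurableType d).
Local Notation S := (bernoulli_space T).

Lemma measurable_coord i : measurable_fun setT (fun w : S => w i).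
Proof.
move=> _ A mA; apply: sub_sigma_algebra.
by exists i => //; exists A.
Qed.

Lemma measurable_to_bernoulli d' (U : measurableType d') (g : U -> S) :
  (forall i, measurable_fun setT (fun u => g u i)) -> measurable_fun setT g.
Proof.
move=> mg; apply: (@measurability _ _ _ S setT g (@coordinate_preimages d T)) => //.
move=> _ [B [i _ [A mA <-]] <-]; rewrite !setTI.
by have := mg i measurableT A mA; rewrite setTI.
Qed.

Lemma measurable_shift : measurable_fun setT (@Defs.shift d T).
Proof. by apply: measurable_to_bernoulli => i; exact: measurable_coord. Qed.

Definition word_cons (z : T * S) : S := fun i => if i is j.+1 then z.2 j else z.1.

Lemma measurable_word_cons : measurable_fun setT word_cons.
Proof.
apply: measurable_to_bernoulli => -[|i]; first exact: measurable_fst.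
exact: (measurableT_comp (measurable_coord i) measurable_snd).
Qed.

Definition cylinders : set (set S) :=
  [set C | exists n (A : nat -> set T), (forall i, measurable (A i)) /\
    C = [set w | forall i, (i < n)%N -> A i (w i)]].

Lemma measurable_cylinder n (A : nat -> set T) : (forall i, measurable (A i)) ->
  measurable ([set w | forall i, (i < n)%N -> A i (w i)] : set S).
Proof.
move=> mA.
have -> : [set w : S | forall i, (i < n)%N -> A i (w i)] =
    \bigcap_(i in [set i | (i < n)%N]) ((fun w : S => w i) @^-1` (A i)).
  by apply/seteqP; split => [w h i /= /h//|w h i ni]; exact: h.
apply: bigcap_measurableType.
by move=> i _; rewrite -[X in measurable X]setTI; exact: measurable_coord.
Qed.

Lemma cylindersE : @measurable _ S = <<s cylinders >>.
Proof.
apply/seteqP; split.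
  apply: smallest_sub; first exact: smallest_sigma_algebra.
  move=> _ [i _ [A mA <-]]; apply: sub_sigma_algebra.
  exists i.+1, (fun j => if j == i then A else setT); split.
    by move=> j; case: ifP => _; [exact: mA|exact: measurableT].
  apply/seteqP; split => [w [_ /= Awi] j _ /=|w h].
    by case: eqP => // ->.
  by split => //=; have := h i (ltnSn i); rewrite eqxx.
apply: smallest_sub; first exact: sigma_algebra_measurable.
by move=> _ [n [A [mA ->]]]; exact: measurable_cylinder.
Qed.

Lemma cylinders_setI : setI_closed cylinders.
Proof.
move=> _ _ [n [A [mA ->]]] [m [B [mB ->]]].
exists (maxn n m), (fun i => (if (i < n)%N then A i else setT) `&`
   (if (i < m)%N then B i else setT)); split.
  by move=> i; apply: measurableI; case: ifP => _ //; exact: measurableT.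
apply/seteqP; split => [w [h1 h2] i _|w h]; split => /=.
- by case: ifPn => // /h1.
- by case: ifPn => // /h2.
- move=> i ni; have := h i; rewrite leq_max ni => /(_ isT) [].
  by [].
- move=> i ni; have := h i; rewrite leq_max ni orbT => /(_ isT) [].
  by [].
Qed.

Variables (p : probability T R) (Pr : probability S R).
Hypothesis bern : bernoulli_product p Pr.
Local Open Scope ereal_scope.

(** Prepending an independent letter reproduces the Bernoulli measure: on cylinders the product
    formula splits off its first factor, and cylinders form a generating system stable under
    intersection. *)
Lemma bernoulli_word_cons A : measurable A ->
  (p \x Pr) (word_cons @^-1` A) = Pr A.
Proof.
move=> mA; apply/esym.
pose m2 := pushforward_measure (p \x Pr) measurable_word_cons.
suff : Pr A = m2 A by [].
apply: (measure_unique cylinders (fun=> setT) cylindersE cylinders_setI) => //.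
- by move=> _; exists 0%N, (fun=> setT); split => //; apply/seteqP; split.
- by apply/seteqP; split => // x _; exists 0%N.
- move=> _ [n [B [mB ->]]]; transitivity (\prod_(i < n) p (B i)); first exact: bern.
  rewrite /m2 /= /pushforward.
  case: n => [|n].
    rewrite big_ord0 (_ : _ @^-1` _ = setT `*` setT); last first.
      by apply/seteqP; split.
    have -> := product_measure1E p Pr measurableT measurableT.
    by rewrite -[LHS]mule1; congr (_ * _); exact/esym/probability_setT.
  rewrite (_ : _ @^-1` _ =
     B 0%N `*` [set w | forall i, (i < n)%N -> B i.+1 (w i)]); last first.
    apply/seteqP; split => [[t w] h|[t w] [h1 h2] [|i]//=].
      by split => [|i ni] /=; [exact: (h 0%N)|exact: (h i.+1)].
    exact: h2.
  rewrite (product_measure1E p Pr (mB 0%N)); last exact: (measurable_cylinder _ (fun i => mB i.+1)).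
  rewrite big_ord_recl; congr (_ * _).
  exact/esym/(bern _ (fun i => mB i.+1)).
- by move=> _; apply: (@le_lt_trans _ _ 1); [exact: probability_le1|exact: ltry].
Qed.

Lemma ge0_integral_word_cons (F : S -> \bar R) : measurable_fun setT F ->
  (forall w, 0 <= F w) ->
  \int[Pr]_w F w = \int[p]_t \int[Pr]_w F (word_cons (t, w)).
Proof.
move=> mF F0; rewrite -(fubini_tonelli1 (F \o word_cons)); last 2 first.
- by apply: measurableT_comp mF _; exact: measurable_word_cons.
- by move=> z /=.
have -> : \int[Pr]_w F w =
    \int[pushforward_measure (p \x Pr) measurable_word_cons]_w F w.
  by apply: eq_measure_integral => A mA _; exact/esym/bernoulli_word_cons.
by rewrite ge0_integral_pushforward_measure.
Qed.

Lemma ge0_integral_shift (F : S -> \bar R) : measurable_fun setT F ->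
  (forall w, 0 <= F w) -> \int[Pr]_w F (Defs.shift w) = \int[Pr]_w F w.
Proof.
move=> mF F0; rewrite ge0_integral_word_cons//; last first.
  exact: measurableT_comp measurable_shift.
rewrite (eq_integral (cst (\int[Pr]_w F w))).
  exact: integral_probability_cst.
by move=> t _; apply: eq_integral.
Qed.

(** Once the first letter [t] is fixed, the rest of the word is again distributed by [Pr], while the
    map is almost surely [g t]. Both sides then equal the integral over [t] of the mean of
    [H (w, g t x)]. As [g] carries no measurability, the argument is made letter by letter. *)
Lemma markov d' (Y : measurableType d') (f : S -> Y -> Y) (g : T -> Y -> Y) :
  measurable_fun setT (fun z : S * Y => f z.1 z.2) ->
  {ae Pr, forall w, f w = g (w 0%N)} ->
  forall H : S * Y -> \bar R, measurable_fun setT H -> (forall z, 0 <= H z) ->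
  forall x, \int[Pr]_w H (Defs.shift w, f w x) =
    \int[Pr]_w \int[Pr]_w' H (w', f w x).
Proof.
move=> mf [N [mN N0 fN]] H mH H0 x.
have mfx : measurable_fun setT (f ^~ x).
  exact: (measurableT_comp mf (pair2_measurable x)).
have mG : measurable_fun setT (fun y => \int[Pr]_w' H (w', y)).
  exact: (measurable_fun_fubini_tonelli_G H).
rewrite ge0_integral_word_cons//; last first.
  apply: (measurableT_comp mH); apply: measurable_fun_pair => //.
  exact: measurable_shift.
rewrite [RHS](@ge0_integral_word_cons (fun w => \int[Pr]_w' H (w', f w x)));
  [|
  exact: measurableT_comp mG mfx|by move=> w; exact: integral_ge0].
have mN' : measurable (word_cons @^-1` N).
  by rewrite -[X in measurable X]setTI; exact: measurable_word_cons.
have := bernoulli_word_cons mN; rewrite N0 /product_measure1 /= => N'0.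
have mxs := measurable_fun_xsection Pr mN'.
(* By Fubini the exceptional words starting with [t] form a null set for almost every letter [t]. *)
have /(ae_eq_integral_abs p measurableT mxs) : 
    \int[p]_t `|Pr (xsection (word_cons @^-1` N) t)| = 0.
  by rewrite -[RHS]N'0; apply: eq_integral => t _; rewrite gee0_abs.
move=> aeN; apply: ae_eq_integral_nomeas; apply: filterS aeN => t /(_ I) Nt.
have fg : {ae Pr, forall w, f (word_cons (t, w)) = g t}.
  exists (xsection (word_cons @^-1` N) t); split => //.
    exact: measurable_xsection.
  by move=> w /= fgt; rewrite /xsection/= inE; exact: fN.
transitivity (\int[Pr]_w H (w, g t x)).
  by apply: ae_eq_integral_nomeas; apply: filterS fg => w ->.
transitivity (\int[Pr]_w \int[Pr]_w' H (w', g t x)).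
  by rewrite integral_probability_cst.
by apply: ae_eq_integral_nomeas; apply: filterS fg => w ->.
Qed.

End bernoulli_shift.

(** * Ultralimits and Lipschitz functions on a compact metric space *)

Section ultrafilter_limits.

Fact nat_ultrafilter_exists : exists G : set_system nat,
  UltraFilter G /\ \oo `<=` G.
Proof. exact: ultraFilterLemma. Qed.

(* Limits along a fixed ultrafilter depend linearly on the bounded sequence, with
   no extraction of subsequences. *)
Definition natU : set_system nat := sval (cid nat_ultrafilter_exists).

#[global] Instance natU_ultra : UltraFilter natU.
Proof. by rewrite /natU; case: cid => G /= []. Qed.

#[global] Instance natU_proper : ProperFilter natU.
Proof. exact: ultra_proper. Qed.

Lemma natU_oo : \oo `<=` natU.
Proof. by rewrite /natU; case: cid => G /= []. Qed.

Lemma natU_ge n : \forall k \near natU, (n <= k)%N.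
Proof. by apply: natU_oo; exact: nbhs_infty_ge. Qed.

Lemma cvg_natU (T : topologicalType) (u : nat -> T) (l : T) :
  u n @[n --> \oo] --> l -> u n @[n --> natU] --> l.
Proof. by move=> ul A /ul; exact: natU_oo. Qed.

Lemma natU_fmap_ultra (T : Type) (u : nat -> T) : UltraFilter (u @ natU).
Proof.
have FF : ProperFilter (u @ natU) by exact: fmap_proper_filter.
split=> // G GG sub; apply/seteqP; split => // A GA.
have [//|nA] := in_ultra_setVsetC (u @^-1` A) natU_ultra.
have /sub GnA : (u @ natU) (~` A) by [].
have := filterI GA GnA; rewrite setICr => G0.
by case: (@filter_not_empty _ G _); exact: G0.
Qed.

Lemma compact_natU (T : topologicalType) (A : set T) (u : nat -> T) :
  compact A -> (forall n, A (u n)) ->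
  exists2 l, A l & u n @[n --> natU] --> l.
Proof.
rewrite compact_ultra => cA Au.
have [|l [Al ul]] := cA (u @ natU) (natU_fmap_ultra u).
  by have : natU (u @^-1` A) by apply: filterE => n; exact: Au.
by exists l.
Qed.

Lemma bounded_natU (R : realType) (u : nat -> R) (M : R) :
  (forall n, `|u n| <= M) -> cvg (u n @[n --> natU]).
Proof.
move=> uM; have [l _ ul] := compact_natU (@segment_compact R (- M) M)
  (fun n => ltac:(by rewrite /= in_itv/= -ler_norml) : `[- M, M]%classic (u n)).
by apply/cvg_ex; exists l.
Qed.

End ultrafilter_limits.

(** * Ramps, compactness and measurability of the distance *)

Section metric.
Context {R : realType} {X : pmetricType R}.
Implicit Types (x y z : X) (u v : X -> R) (A U : set X).

Definition lipschitz_real (k : R) u :=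
  forall x y, `|u x - u y| <= k * mdist x y.

Lemma mdist_lip z : lipschitz_real 1 (mdist z).
Proof.
move=> x y; rewrite mul1r ler_norml; apply/andP; split.
  by have := metric_triangle z x y; lra.
by have := metric_triangle z y x; rewrite (metric_sym y); lra.
Qed.

Lemma mdist_cvgP {T : Type} {F : set_system T} {FF : Filter F} (f : T -> X) x :
  f @ F --> x <-> forall e : R, 0 < e -> \forall t \near F, mdist x (f t) < e.
Proof. exact: metricType_numDomainType.cvgrPdist_lt. Qed.

Lemma lipschitz_continuous k u : lipschitz_real k u -> continuous u.
Proof.
move=> uk x; apply/cvgrPdist_le => e e0.
have k1 : 0 < `|k| + 1 by rewrite ltr_wpDl.
have /mdist_cvgP : y @[y --> x] --> x by exact: cvg_id.
move=> /(_ (e / (`|k| + 1))); rewrite divr_gt0// => /(_ isT).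
apply: filterS => y xy; apply: (le_trans (uk x y)).
apply: (@le_trans _ _ ((`|k| + 1) * mdist x y)).
  by rewrite ler_wpM2r ?mdist_ge0// (le_trans (ler_norm k))// lerDl.
by rewrite mulrC -ler_pdivlMr// ltW.
Qed.

Lemma continuous_borel u : continuous u ->
  measurable_fun setT (u : borel X -> R).
Proof.
move=> cu; apply: (measurability _ (RGenInftyO.measurableE R)) => //.
move=> _ [_ [x ->] <-]; rewrite setTI; apply: sub_sigma_algebra.
by move/continuousP: cu; apply; exact: interval_open.
Qed.

Lemma lipschitz_borel k u : lipschitz_real k u ->
  measurable_fun setT (u : borel X -> R).
Proof. by move=> /lipschitz_continuous; exact: continuous_borel. Qed.

Lemma natU_mdist (a b : nat -> X) x y : a n @[n --> natU] --> x ->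
  b n @[n --> natU] --> y -> mdist (a n) (b n) @[n --> natU] --> mdist x y.
Proof.
move=> /mdist_cvgP ax /mdist_cvgP bxy; apply/cvgrPdist_le => e e0.
have e2 : 0 < e / 2 by rewrite divr_gt0.
near=> n.
have h1 := mdist_lip x y (b n); have h2 := mdist_lip (b n) x (a n).
have -> : mdist x y - mdist (a n) (b n) =
    (mdist x y - mdist x (b n)) + (mdist (b n) x - mdist (b n) (a n)).
  by rewrite (metric_sym (b n) x) (metric_sym (b n) (a n)); lra.
rewrite (le_trans (ler_normD _ _))// [leRHS]splitr lerD//.
  by rewrite (le_trans h1)// mul1r ltW//; near: n; exact: bxy.
by rewrite (le_trans h2)// mul1r ltW//; near: n; exact: ax.
Unshelve. all: by end_near. Qed.

(** The distance to the complement of [U], capped at 1. Adjoining 1 keeps the infimum over a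
    nonempty set when [U] is the whole space. *)
Definition capdist U x : R := inf ([set 1] `|` [set mdist x y | y in ~` U]).

Let capdist_has_inf U x :
  has_inf ([set 1] `|` [set mdist x y | y in ~` U] : set R).
Proof.
split; first by exists 1; left.
by exists 0 => _ [->//|[y _ <-]]; exact: mdist_ge0.
Qed.

Lemma capdist_ge0 U x : 0 <= capdist U x.
Proof.
apply: lb_le_inf; first exact: (capdist_has_inf U x).1.
by move=> _ [->//|[y _ <-]]; exact: mdist_ge0.
Qed.

Lemma capdist_le1 U x : capdist U x <= 1.
Proof. by apply: ge_inf; [exact: (capdist_has_inf U x).2|left]. Qed.

Lemma capdist_le U x y : ~ U y -> capdist U x <= mdist x y.
Proof.
by move=> Uy; apply: ge_inf; [exact: (capdist_has_inf U x).2|right; exists y].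
Qed.

Lemma capdist_notin U x : ~ U x -> capdist U x = 0.
Proof.
move=> Ux; apply/eqP; rewrite eq_le capdist_ge0 andbT.
by rewrite -(mdistxx x) capdist_le.
Qed.

Lemma capdist_gt0 U x : open U -> U x -> 0 < capdist U x.
Proof.
move=> oU Ux; have /(_ U) : nbhs x `<=` nbhs x by [].
have := open_nbhs_nbhs (conj oU Ux).
rewrite -metricType_numDomainType.nbhs_nbhs_mdist => -[e /= e0 eU] _.
apply: (@lt_le_trans _ _ (Num.min e 1)); first by rewrite lt_min e0 ltr01.
apply: lb_le_inf; first exact: (capdist_has_inf U x).1.
move=> _ [->|[y Uy <-]]; first by rewrite ge_min lexx orbT.
by rewrite ge_min leNgt; apply/orP; left; apply/negP => /eU.
Qed.

Lemma capdist_lip U : lipschitz_real 1 (capdist U).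
Proof.
have h x y : capdist U x <= capdist U y + mdist x y.
  rewrite -lerBlDr; apply: lb_le_inf; first exact: (capdist_has_inf U y).1.
  move=> _ [->|[z Uz <-]].
    by rewrite lerBlDr (le_trans (capdist_le1 _ _))// lerDl mdist_ge0.
  rewrite lerBlDr (le_trans (capdist_le x Uz))// addrC.
  exact: metric_triangle.
move=> x y; rewrite mul1r ler_norml; apply/andP; split.
  by rewrite lerBrDr addrC lerBlDr metric_sym.
by rewrite lerBlDr addrC.
Qed.

(* A ramp supported on [U] that increases to the indicator function of [U]
   with [n] when [U] is open. *)
Definition ramp U (n : nat) x : R := Num.min 1 (n%:R * capdist U x).

Lemma ramp_ge0 U n x : 0 <= ramp U n x.
Proof. by rewrite /ramp le_min ler01 mulr_ge0// capdist_ge0. Qed.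

Lemma ramp_le1 U n x : ramp U n x <= 1.
Proof. by rewrite /ramp ge_min lexx. Qed.

Lemma ramp_notin U n x : ~ U x -> ramp U n x = 0.
Proof.
by move=> Ux; rewrite /ramp capdist_notin// mulr0; apply/min_idPr.
Qed.

Lemma ramp_homo U x : {homo (ramp U)^~ x : m n / (m <= n)%N >-> m <= n}.
Proof.
move=> m n mn; rewrite /ramp le_min ge_min lexx/= ge_min; apply/orP; right.
by rewrite ler_wpM2r ?capdist_ge0// ler_nat.
Qed.

Lemma ramp_eq1 U x : open U -> U x ->
  exists N, forall n, (N <= n)%N -> ramp U n x = 1.
Proof.
move=> oU Ux; have c0 := capdist_gt0 oU Ux.
exists (Num.truncn (capdist U x)^-1).+1 => n Nn.
rewrite /ramp; apply/min_idPl; rewrite -ler_pdivrMr// mul1r ltW//.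
by rewrite (lt_le_trans (truncnS_gt _))// ler_nat.
Qed.

Lemma min1_lip k u : lipschitz_real k u -> lipschitz_real k (fun x => Num.min 1 (u x)).
Proof.
move=> uk x y; apply: le_trans (uk x y).
move: (u x) (u y) => a b.
have := ler_norm (a - b); have := ler_norm (b - a); rewrite distrC => h1 h2.
by rewrite /Num.min; case: (ltP 1 a) => ?; case: (ltP 1 b) => ?;
  rewrite ?subrr ?normr0// ler_norml; apply/andP; split; lra.
Qed.

Lemma ramp_lip U n : lipschitz_real n%:R (ramp U n).
Proof.
apply: min1_lip => x y; rewrite -mulrBr normrM normr_nat ler_wpM2l//.
by rewrite -[leRHS]mul1r; exact: capdist_lip.
Qed.

Hypothesis cX : compact [set: X].

(** One point of [A] is chosen in each member of a countable base that meets [A]. The sequence has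
    to lie in [A] itself for statements known only at the points of [A], as in
    [maximum_modulus_ae]. *)
Lemma compact_dense_seq A : A !=set0 ->
  exists D : nat -> X, (forall i, A (D i)) /\
    forall x, A x -> forall e : R, 0 < e -> exists i, mdist x (D i) < e.
Proof.
move=> [a0 Aa0].
have [B /countable_injP[g gI] [oB Bx]] := compact_second_countable cX.
pose D n := xget a0 [set x | A x /\ exists2 b, B b & g b = n /\ b x].
exists D; split.
  by move=> i; rewrite /D; case: xgetP => // x _ [].
move=> x Ax e e0.
have /Bx[b /= [Bb bx] be] : nbhs x (ball x e) by exact: nbhsx_ballx.
exists (g b); rewrite /D; case: xgetP => [y _ [Ay [b' Bb' [gb' b'y]]]|].
  have bb' : b' = b by apply: gI; rewrite ?inE.
  have /be : b y by rewrite -bb'.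
  by rewrite ballEmdist.
by move=> /(_ x) []; split => //; exists b.
Qed.

Lemma compact_mdist_bounded : exists2 M : R, 0 < M & forall x y, mdist x y <= M.
Proof.
apply: contrapT => h.
have /choice[a aP] : forall n : nat, exists z : X * X, n%:R < mdist z.1 z.2.
  move=> n; apply: contrapT => /forallNP hn; apply: h; exists (n%:R + 1) => //.
  move=> x y; rewrite leNgt; apply/negP => xy; apply: (hn (x, y)) => /=.
  by rewrite (le_lt_trans _ xy)// lerDl.
have [x _ ax] := compact_natU cX (fun n => I : [set: X] (a n).1).
have [y _ ay] := compact_natU cX (fun n => I : [set: X] (a n).2).
have /cvgrPdist_le/(_ 1 ltr01) c := natU_mdist ax ay.
have [] : False; near natU => n.
have : `|mdist x y - mdist (a n).1 (a n).2| <= 1 by near: n; exact: c.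
rewrite ler_norml => /andP[].
rewrite lerBrDr => + _.
have := aP n.
have : (Num.truncn (mdist x y + 1)).+1%:R <= n%:R :> R.
  by rewrite ler_nat; near: n; exact: natU_ge.
have := truncnS_gt (mdist x y + 1); lra.
Unshelve. all: by end_near. Qed.

(** A countable infimum of sums of functions of one variable: in this form the distance between two
    measurable maps is visibly measurable. *)
Lemma mdist_infs (D : nat -> X) x y :
  (forall e : R, 0 < e -> exists i, mdist x (D i) < e) ->
  mdist x y = infs (fun i => mdist (D i) x + mdist (D i) y) 0%N.
Proof.
move=> dD; apply/eqP; rewrite eq_le; apply/andP; split.
  apply: lb_le_inf; first by exists (mdist (D 0%N) x + mdist (D 0%N) y), 0%N.
  move=> _ [i _ <-]; rewrite (metric_sym (D i)); exact: metric_triangle.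
apply/ler_addgt0Pr => /= e e0.
have [i ie] := dD (e / 2) (divr_gt0 e0 (ltr0n _ 2)).
apply: (@le_trans _ _ (mdist (D i) x + mdist (D i) y)).
  apply: ge_inf; last by exists i.
  by exists 0 => _ [j _ <-]; rewrite addr_ge0// mdist_ge0.
have := metric_triangle (D i) x y.
by move: ie; rewrite (metric_sym x (D i)); lra.
Qed.

Lemma measurable_mdist d (T : measurableType d) (g h : T -> borel X) :
  measurable_fun setT g -> measurable_fun setT h ->
  measurable_fun setT (fun t => mdist (g t : X) (h t) : R).
Proof.
move=> mg mh; have [D [_ dD]] := @compact_dense_seq setT (ex_intro _ point I).
have -> : (fun t => mdist (g t : X) (h t)) = (fun t =>
    infs (fun i => mdist (D i) (g t : X) + mdist (D i) (h t : X)) 0%N).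
  by apply/funext => t; apply: mdist_infs => x; exact: dD.
apply: (@measurable_fun_infs _ _ _ setT
  (fun i t => mdist (D i) (g t : X) + mdist (D i) (h t : X)) 0%N).
  by move=> t _; exists 0 => _ [i _ <-]; rewrite addr_ge0// mdist_ge0.
move=> i.
apply: measurable_funD.
  exact: (measurableT_comp (lipschitz_borel (mdist_lip (D i)))).
exact: (measurableT_comp (lipschitz_borel (mdist_lip (D i)))).
Qed.

End metric.

Section probability_integrals.
Context d (T : measurableType d) (R : realType) (P : probability T R).
Implicit Types u v : T -> R.

Lemma bounded_integrable u (M : R) : measurable_fun setT u ->
  (forall x, `|u x| <= M) -> P.-integrable setT (EFin \o u).
Proof.
move=> mu uM; apply: measurable_bounded_integrable => //.
  by apply: (@le_lt_trans _ _ 1%E); [exact: probability_le1|exact: ltry].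
exists M; split; first exact: num_real.
move=> N MN x _ /=; rewrite (le_trans (uM x))//.
exact: ltW.
Qed.

Lemma Rintegral_sum (mu : {measure set T -> \bar R}) (I : Type) (s : seq I)
    (F : I -> T -> R) : (forall i, mu.-integrable setT (EFin \o F i)) ->
  \int[mu]_x (\sum_(i <- s) F i x) = \sum_(i <- s) \int[mu]_x F i x.
Proof.
move=> iF; elim: s => [|i s ih].
  by rewrite big_nil; under eq_Rintegral do rewrite big_nil; rewrite /Rintegral integral0.
rewrite big_cons -ih -RintegralD//.
  by apply: eq_Rintegral => x _; rewrite big_cons.
rewrite (_ : _ \o _ = (fun x => \sum_(k <- s) (F k x)%:E)%E).
  by apply: integrable_sum => // k _; exact: iF.
by apply/funext => x; rewrite /= sumEFin.
Qed.

Lemma Rintegral_probability_cst (c : R) : \int[P]_x c = c.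
Proof. by rewrite /Rintegral integral_probability_cst. Qed.

Lemma EFin_Rintegral u : P.-integrable setT (EFin \o u) ->
  (\int[P]_x (u x)%:E)%E = (\int[P]_x u x)%:E.
Proof. by move=> iu; rewrite fineK//; exact: integrable_fin_num. Qed.

Lemma Rintegral_le_cst u (c : R) : P.-integrable setT (EFin \o u) ->
  (forall x, u x <= c) -> \int[P]_x u x <= c.
Proof.
move=> iu uc; rewrite -[leRHS]Rintegral_probability_cst; apply: le_Rintegral => //.
exact: finite_measure_integrable_cst.
Qed.

Lemma Rintegral_ge_cst u (c : R) : P.-integrable setT (EFin \o u) ->
  (forall x, c <= u x) -> c <= \int[P]_x u x.
Proof.
move=> iu uc; rewrite -[leLHS]Rintegral_probability_cst; apply: le_Rintegral => //.
exact: finite_measure_integrable_cst.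
Qed.

End probability_integrals.

Section borel_unique.
Context {R : realType} {X : pmetricType R}.

Lemma cvg_integral_ramp (mu : {measure set (borel X) -> \bar R}) (U : set X) :
  open U ->
  (\int[mu]_x (ramp U n x)%:E)%E @[n --> \oo] --> mu U.
Proof.
move=> oU; have mU : measurable (U : set (borel X)) by exact: sub_sigma_algebra.
have -> : mu U = (\int[mu]_x limn (fun n => (ramp U n x)%:E))%E.
  have -> : mu U = (\int[mu]_x (\1_U x)%:E)%E by rewrite integral_indic// setIT.
  apply: eq_integral => x _.
  apply/esym/cvg_lim => //; rewrite indicE.
  have [xU|xU] := boolP (x \in (U : set X)).
    have [N NP] := ramp_eq1 oU (set_mem xU).
    apply: cvg_near_cst; near=> n; congr (_%:E); apply: NP; near: n.
    exact: nbhs_infty_ge.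
  apply: cvg_near_cst; near=> n; congr (_%:E); apply: ramp_notin.
  by move/mem_set; apply/negP.
apply: cvg_monotone_convergence => //.
- move=> n; apply/measurable_EFinP; exact: (lipschitz_borel (ramp_lip U n)).
- by move=> n x _; rewrite lee_fin ramp_ge0.
- by move=> x _ m n mn; rewrite lee_fin; exact: ramp_homo.
Unshelve. all: by end_near. Qed.

(** The ramps of an open set increase to its indicator, so integrals of Lipschitz functions
    determine the measure of open sets, which form a generating system stable under intersection. *)
Lemma borel_measure_unique (mu nu : {measure set (borel X) -> \bar R}) :
  (mu setT < +oo)%E ->
  (forall (u : X -> R) k, lipschitz_real k u -> (forall x, 0 <= u x <= 1) ->
    (\int[mu]_x (u x)%:E = \int[nu]_x (u x)%:E)%E) ->
  forall A : set (borel X), measurable A -> mu A = nu A.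
Proof.
move=> muT munu.
apply: (@measure_unique _ R (borel X) (@open X) (fun=> setT)) => //.
- by move=> A B; exact: openI.
- by move=> _; exact: openT.
- by apply/seteqP; split => // x _; exists 0%N.
move=> U oU; have h1 := cvg_integral_ramp (mu := mu) oU.
have h2 := cvg_integral_ramp (mu := nu) oU.
rewrite (_ : (fun n => _) = (fun n => (\int[nu]_x (ramp U n x)%:E)%E)) in h1.
  exact: (cvg_unique (@ereal_hausdorff R) h1 h2).
apply/funext => n; apply: munu; first exact: ramp_lip.
by move=> x; rewrite ramp_ge0 ramp_le1.
Qed.

End borel_unique.

(** * Riesz representation and Hoelder functions *)

(* [L] is only a space of continuous functions that is stable under truncation,
   so that the theorem applies to Hoelder functions without a density argument. *)
Section riesz.
Context {R : realType} {X : pmetricType R}.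
Hypothesis cX : compact [set: X].
Variables (L : set (X -> R)) (Lam : (X -> R) -> R).
Hypothesis L_lip : forall k u, lipschitz_real k u -> L u.
Hypothesis L_add : forall u v, L u -> L v -> L (fun x => u x + v x).
Hypothesis L_scale : forall c u, L u -> L (fun x => c * u x).
Hypothesis L_min : forall c u, L u -> L (fun x => Num.min c (u x)).
Hypothesis L_continuous : forall u, L u -> continuous u.
Hypothesis L_bounded : forall u, L u -> exists M : R, forall x, `|u x| <= M.
Hypothesis Lam_add : forall u v, L u -> L v ->
  Lam (fun x => u x + v x) = Lam u + Lam v.
Hypothesis Lam_scale : forall c u, L u -> Lam (fun x => c * u x) = c * Lam u.
Hypothesis Lam_le : forall u v, L u -> L v -> (forall x, u x <= v x) ->
  Lam u <= Lam v.
Hypothesis Lam1 : Lam (fun=> 1) = 1.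

Let L_cst c : L (fun=> c).
Proof. by apply: (@L_lip 0) => x y; rewrite subrr normr0 mul0r. Qed.

Let Lam_cst c : Lam (fun=> c) = c.
Proof.
rewrite -[RHS]mulr1 -Lam1 -Lam_scale; last exact: L_cst.
by congr Lam; apply/funext => x; rewrite mulr1.
Qed.

Let L_sub u v : L u -> L v -> L (fun x => u x - v x).
Proof.
move=> Lu Lv; rewrite (_ : (fun _ => _) = (fun x => u x + -1 * v x)); last first.
  by apply/funext => x; rewrite mulN1r.
by apply: L_add => //; exact: L_scale.
Qed.

Let Lam_sub u v : L u -> L v -> Lam (fun x => u x - v x) = Lam u - Lam v.
Proof.
move=> Lu Lv; rewrite (_ : (fun _ => _) = (fun x => u x + -1 * v x)); last first.
  by apply/funext => x; rewrite mulN1r.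
by rewrite Lam_add// ?Lam_scale ?mulN1r//; exact: L_scale.
Qed.

Let L_sum (F : nat -> X -> R) n : (forall i, L (F i)) ->
  L (fun x => \sum_(i < n) F i x).
Proof.
move=> LF; elim: n => [|n ih].
  by under eq_fun do rewrite big_ord0; exact: L_cst.
by under eq_fun do rewrite big_ord_recr/=; exact: L_add.
Qed.

Let Lam_sum (F : nat -> X -> R) n : (forall i, L (F i)) ->
  Lam (fun x => \sum_(i < n) F i x) = \sum_(i < n) Lam (F i).
Proof.
move=> LF; elim: n => [|n ih].
  by rewrite big_ord0; under eq_fun do rewrite big_ord0; exact: Lam_cst.
under eq_fun do rewrite big_ord_recr/=.
by rewrite Lam_add// ?ih ?big_ord_recr//; exact: L_sum.
Qed.

(** Vanishing off [U] replaces the usual condition that the support be contained in [U]; the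
    truncation [u - min e u] later provides the room between the set where a function is positive
    and the boundary of [U]. *)
Definition subordinate (U : set X) : set (X -> R) :=
  [set u | [/\ L u, forall x, 0 <= u x <= 1 & forall x, ~ U x -> u x = 0]].

Definition inner_content (U : set X) : R := sup [set Lam u | u in subordinate U].

Let subordinate0 U : subordinate U (fun=> 0).
Proof. by split; [exact: L_cst|move=> x; rewrite lexx ler01|]. Qed.

Let content_has_sup U : has_sup [set Lam u | u in subordinate U].
Proof.
split; first by exists (Lam (fun=> 0)), (fun=> 0).
exists 1 => _ [u [Lu u01 _] <-]; rewrite -[leRHS](Lam_cst 1).
apply: Lam_le => //.
by move=> x; have /andP[] := u01 x.
Qed.

Let le_content U u : subordinate U u -> Lam u <= inner_content U.
Proof. by move=> Uu; apply: ub_le_sup; [exact: (content_has_sup U).2|exists u]. Qed.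

Let content_le U c : (forall u, subordinate U u -> Lam u <= c) ->
  inner_content U <= c.
Proof.
move=> h; apply: ge_sup; first exact: (content_has_sup U).1.
by move=> _ [u Uu <-]; exact: h.
Qed.

Let content_ge0 U : 0 <= inner_content U.
Proof. by rewrite -(Lam_cst 0); apply: le_content. Qed.

Let content_homo U V : U `<=` V -> inner_content U <= inner_content V.
Proof.
move=> UV; apply: content_le => u [Lu u01 uU]; apply: le_content.
by split => // x Vx; apply: uU => /UV.
Qed.

Let contentT : inner_content setT = 1.
Proof.
apply/eqP; rewrite eq_le; apply/andP; split.
  apply: content_le => u [Lu u01 _]; rewrite -[leRHS](Lam_cst 1).
  apply: Lam_le => //.
  by move=> x; have /andP[] := u01 x.
rewrite -[leLHS]Lam1; apply: le_content; split; [exact: L_cst| |by move=> x []].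
by move=> x; rewrite lexx ler01.
Qed.

Let ramp_subordinate U n : subordinate U (ramp U n).
Proof.
split; first exact: L_lip (ramp_lip U n).
  by move=> x; rewrite ramp_ge0 ramp_le1.
by move=> x; exact: ramp_notin.
Qed.

(* Compactness: finitely many ramps already dominate [u] up to [e]. *)
Let ramp_cover (U : nat -> set X) u e : (forall i, open (U i)) ->
  subordinate (\bigcup_i U i) u -> 0 < e ->
  exists n, forall x, u x - e <= \sum_(i < n) ramp (U i) n x.
Proof.
move=> oU [Lu u01 uU] e0; apply: contrapT => /forallNP h.
have /choice[a aP] : forall n, exists x, \sum_(i < n) ramp (U i) n x < u x - e.
  by move=> n; have /existsNP[x /negP] := h n; rewrite -ltNge => ?; exists x.
have [x _ ax] := compact_natU cX (fun n => I : [set: X] (a n)).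
have uax : u (a n) @[n --> natU] --> u x.
  by apply: continuous_cvg => //; exact: L_continuous.
have ux : e <= u x.
  apply: (@cvgr_to_ge _ _ _ _ _ _ _ uax); near=> n.
  have := aP n; suff : 0 <= \sum_(i < n) ramp (U i) n (a n) by lra.
  by apply: sumr_ge0 => i _; exact: ramp_ge0.
have [i _ Uix] : (\bigcup_i U i) x.
  by apply: contrapT => /uU u0; move: ux; rewrite u0; lra.
have c0 := capdist_gt0 (oU i) Uix.
have cax : capdist (U i) (a n) @[n --> natU] --> capdist (U i) x.
  by apply: continuous_cvg => //; exact: lipschitz_continuous (capdist_lip (U i)) x.
have c2 : capdist (U i) x / 2 < capdist (U i) x by lra.
have [] : False; near natU => n.
have cn : capdist (U i) x / 2 < capdist (U i) (a n).
  by near: n; exact: cvgr_gt cax _ c2.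
have ni : (i < n)%N by near: n; exact: natU_ge.
have nc : (capdist (U i) x / 2)^-1 <= n%:R.
  rewrite (le_trans (ltW (truncnS_gt _)))// ler_nat; near: n; exact: natU_ge.
have := aP n; rewrite (bigD1 (Ordinal ni))//=.
have -> : ramp (U i) n (a n) = 1.
  apply/min_idPl; rewrite -[leLHS](@mulVf _ (capdist (U i) x / 2)); last first.
    by rewrite gt_eqF// divr_gt0.
  by rewrite ler_pM// ?invr_ge0 ?ltW// divr_gt0.
have := u01 (a n) => /andP[_].
suff : 0 <= \sum_(j < n | j != Ordinal ni) ramp (U j) n (a n) by lra.
by apply: sumr_ge0 => j _; exact: ramp_ge0.
Unshelve. all: by end_near. Qed.

Let content_subadditive (U : nat -> set X) : (forall i, open (U i)) ->
  ((inner_content (\bigcup_i U i))%:E <=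
   \sum_(i <oo) (inner_content (U i))%:E)%E.
Proof.
move=> oU; apply/lee_addgt0Pr => e e0.
have [n nP] : exists n, inner_content (\bigcup_i U i) <=
    \sum_(i < n) inner_content (U i) + e.
  have e2 : 0 < e / 2 by rewrite divr_gt0.
  have [_ [u Uu <-] ue] := sup_adherent e2 (content_has_sup (\bigcup_i U i)).
  have [n nP] := ramp_cover oU Uu e2; exists n.
  have Lu : L u by case: Uu.
  have : Lam u - e / 2 <= \sum_(i < n) inner_content (U i).
    rewrite -[X in _ - X](Lam_cst (e / 2)) -Lam_sub//.
    apply: (@le_trans _ _ (Lam (fun x => \sum_(i < n) ramp (U i) n x))).
      apply: Lam_le => //; first exact: L_sub.
      by apply: (@L_sum (fun i => ramp (U i) n)) => i; have [] := ramp_subordinate (U i) n.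
    rewrite (@Lam_sum (fun i => ramp (U i) n)); last first.
      by move=> i; have [] := ramp_subordinate (U i) n.
    by apply: ler_sum => i _; exact: le_content.
  move: ue; rewrite -/(inner_content _); lra.
apply: (@le_trans _ _ (\sum_(i < n) inner_content (U i) + e)%:E).
  by rewrite lee_fin.
rewrite EFinD leeD2r// -sumEFin -(big_mkord xpredT (fun i => (inner_content (U i))%:E)).
by apply: nneseries_lim_ge => i _ _; rewrite lee_fin.
Qed.

Definition riesz_outer (A : set X) : \bar R :=
  (inf [set inner_content U | U in [set U | open U /\ A `<=` U]])%:E.

Let outer_has_inf A :
  has_inf [set inner_content U | U in [set U | open U /\ A `<=` U]].
Proof.
split; first by exists (inner_content setT), setT => //; split => //; exact: openT.
by exists 0 => _ [U _ <-].
Qed.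

Let outer_le A U : open U -> A `<=` U -> (riesz_outer A <= (inner_content U)%:E)%E.
Proof.
by move=> oU AU; rewrite lee_fin; apply: ge_inf; [exact: (outer_has_inf A).2|exists U].
Qed.

Let outer_open U : open U -> riesz_outer U = (inner_content U)%:E.
Proof.
move=> oU; apply/eqP; rewrite eq_le outer_le//= lee_fin.
apply: lb_le_inf; first exact: (outer_has_inf U).1.
by move=> _ [V [oV UV] <-]; exact: content_homo.
Qed.

Let outer0 : riesz_outer set0 = 0%E.
Proof.
rewrite outer_open; last exact: open0.
congr (_%:E); apply/eqP; rewrite eq_le content_ge0 andbT.
apply: content_le => u [Lu _ u0]; rewrite -(Lam_cst 0); apply: Lam_le => //.
by move=> x; rewrite u0.
Qed.

Let outer_ge0 A : (0 <= riesz_outer A)%E.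
Proof.
rewrite lee_fin; apply: lb_le_inf; first exact: (outer_has_inf A).1.
by move=> _ [U _ <-].
Qed.

Let outer_homo : {homo riesz_outer : A B / A `<=` B >-> (A <= B)%E}.
Proof.
move=> A B AB; rewrite lee_fin; apply: lb_le_inf; first exact: (outer_has_inf B).1.
move=> _ [U [oU BU] <-]; rewrite -lee_fin; apply: outer_le => //.
exact: subset_trans BU.
Qed.

Let outer_subadditive : sigma_subadditive riesz_outer.
Proof.
move=> F; apply/lee_addgt0Pr => e e0.
have /choice[U UP] : forall i, exists U, [/\ open U, F i `<=` U &
    ((inner_content U)%:E <= riesz_outer (F i) + (e / (2 ^ i.+1)%:R)%:E)%E].
  move=> i; have ei : 0 < e / (2 ^ i.+1)%:R by rewrite divr_gt0// ltr0n expn_gt0.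
  have [_ [U [oU FU] <-] Ue] := inf_adherent ei (outer_has_inf (F i)).
  by exists U; split => //; rewrite -EFinD lee_fin ltW.
have := @epsilon_trick R (fun i => riesz_outer (F i)) e xpredT
  (fun i => outer_ge0 (F i)) (ltW e0).
apply: le_trans.
apply: (@le_trans _ _ (\sum_(i <oo) (inner_content (U i))%:E)%E); last first.
  apply: lee_nneseries => i _; first by rewrite lee_fin.
  by have [] := UP i.
apply: le_trans (content_subadditive (fun i => let: And3 o _ _ := UP i in o)).
apply: outer_le; first by apply: bigcup_open => i _; have [] := UP i.
by apply: subset_bigcup => i _; have [] := UP i.
Qed.

HB.instance Definition _ := isOuterMeasure.Build R X riesz_outer
  outer0 outer_ge0 outer_homo outer_subadditive.

(** Let [u] be subordinate to the intersection of [V] and [U]. The excess [u - min e u] lives where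
    [u >= e], whereas [W], an open neighbourhood of the part of [A] outside [U], lies where [u < e].
    Hence the excess plus any [v] subordinate to [W] is still subordinate to [V], and the truncation
    costs at most [e]. *)
Let open_caratheodory U : open U -> riesz_outer.-caratheodory U.
Proof.
move=> oU; apply: le_caratheodory_measurable => A.
rewrite -[leLHS]/(riesz_outer (A `&` U) + riesz_outer (A `&` ~` U))%E.
rewrite -[leRHS]/(riesz_outer A) /riesz_outer -EFinD lee_fin.
set a := inf _; set b := inf _.
apply: lb_le_inf; first exact: (outer_has_inf A).1.
move=> _ [V [oV AV] <-].
have av : a <= inner_content (V `&` U).
  rewrite -lee_fin; apply: outer_le; first exact: openI.
  exact: setSI.
rewrite -lerBrDr; apply: le_trans av _; apply: content_le => u [Lu u01 uVU].
apply/ler_addgt0Pr => e e0.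
pose W := V `&` [set x | u x < e].
have oW : open W.
  apply: openI => //; have /continuousP := L_continuous Lu.
  by move=> /(_ _ (@open_lt R e)).
have bW : b <= inner_content W.
  rewrite -lee_fin; apply: outer_le => // x [Ax nUx]; split; first exact: AV.
  by rewrite /= uVU// => -[].
suff : inner_content W <= inner_content V - Lam u + e by lra.
apply: content_le => v [Lv v01 vW].
have Lw : L (fun x => u x - Num.min e (u x)) by apply: L_sub => //; exact: L_min.
have : Lam (fun x => (u x - Num.min e (u x)) + v x) <= inner_content V.
  apply: le_content; split; first exact: L_add.
    move=> x; have := u01 x; have := v01 x.
    have [ue|] := boolP (u x < e); first by rewrite (min_idPr (ltW ue)) subrr add0r.
    rewrite -leNgt => ue.
    rewrite (min_idPl ue) vW ?addr0; first by move=> _ /andP[? ?]; apply/andP; split; lra.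
    by move=> [_ /=]; rewrite ltNge ue.
  move=> x Vx; rewrite uVU; last by move=> [].
  by rewrite vW ?(min_idPr (ltW e0)) ?subrr ?addr0// => -[].
rewrite Lam_add// Lam_sub//; last exact: L_min.
have : Lam (fun x => Num.min e (u x)) <= e.
  rewrite -[leRHS](Lam_cst e); apply: Lam_le; [exact: L_min|exact: L_cst|].
  by move=> x; rewrite ge_min lexx.
lra.
Qed.

Let borel_caratheodory (A : set (borel X)) : measurable A ->
  riesz_outer.-caratheodory A.
Proof.
have : <<s @open X >> `<=` riesz_outer.-caratheodory; last by apply.
apply: smallest_sub; last by move=> U; exact: open_caratheodory.
split.
- exact: caratheodory_measurable_set0.
- by move=> B cB; rewrite setTD; exact: caratheodory_measurable_setC.
- exact: caratheodory_measurable_bigcup.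
Qed.

Definition riesz_measure (A : set (borel X)) : \bar R := riesz_outer A.

Let riesz_measure0 : riesz_measure set0 = 0%E. Proof. exact: outer0. Qed.

Let riesz_measure_ge0 A : (0 <= riesz_measure A)%E. Proof. exact: outer_ge0. Qed.

Let riesz_sigma_additive : semi_sigma_additive riesz_measure.
Proof.
move=> F mF tF mUF; apply: (@caratheodory_measure_sigma_additive _ X riesz_outer) => //.
  by move=> i; exact: borel_caratheodory.
exact: borel_caratheodory.
Qed.

HB.instance Definition _ := isMeasure.Build _ _ _ riesz_measure
  riesz_measure0 riesz_measure_ge0 riesz_sigma_additive.

Let riesz_setT : riesz_measure setT = 1%E.
Proof. by rewrite /riesz_measure outer_open ?contentT//; exact: openT. Qed.

HB.instance Definition _ := Measure_isProbability.Build _ _ _ riesz_measure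
  riesz_setT.

Let mu : probability (borel X) R := riesz_measure.

Let L_integrable u : L u -> mu.-integrable setT (EFin \o u).
Proof.
move=> Lu; have [M uM] := L_bounded Lu; apply: (@bounded_integrable _ (borel X) _ mu u M) => //.
exact: continuous_borel (L_continuous Lu).
Qed.

(** Layer cake: [u] is cut into [n] horizontal slices of height [1 / n]. The slice above level
    [k / n], multiplied by [n], is subordinate to [U k], so [Lam] of the slice is at most the
    measure of [U k] divided by [n]. Summing loses at most [1 / n], which is at most [e]. *)
Let Lam_le_integral u : L u -> (forall x, 0 <= u x <= 1) -> Lam u <= \int[mu]_x u x.
Proof.
move=> Lu u01; apply/ler_addgt0Pr => e e0.
pose n := (Num.truncn e^-1).+1.
have n0 : 0 < n%:R :> R by rewrite ltr0n.
have ne : n%:R^-1 <= e.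
  by rewrite -[leRHS]invrK lef_pV2 ?posrE ?invr_gt0// ltW// truncnS_gt.
pose h (k : nat) x := Num.min (k%:R / n%:R) (u x).
have Lh k : L (h k) by exact: L_min.
pose U (k : nat) := [set x | k%:R / n%:R < u x].
have oU k : open (U k).
  have /continuousP := L_continuous Lu.
  by move=> /(_ _ (@open_gt R (k%:R / n%:R))).
have mU k : measurable (U k : set (borel X)) by exact: sub_sigma_algebra.
have hS k : Lam (h k.+1) - Lam (h k) <= n%:R^-1 * \int[mu]_x \1_(U k) x.
  have -> : \int[mu]_x \1_(U k) x = inner_content (U k).
    rewrite /Rintegral integral_indic// setIT.
    exact: (congr1 fine (outer_open (oU k))).
  rewrite ler_pdivlMl// -Lam_sub// -Lam_scale; last exact: L_sub.
  apply: le_content; split; first by apply: L_scale; exact: L_sub.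
    move=> x; rewrite /h; have /andP[u0 u1] := u01 x.
    have kk : k.+1%:R / n%:R = k%:R / n%:R + n%:R^-1 :> R.
      by rewrite -natr1 mulrDl mul1r.
    have n1 : 0 < n%:R^-1 :> R by rewrite invr_gt0.
    rewrite -(ler_pdivlMl _ _ n0) -(ler_pdivrMl _ _ n0) mulr0 mulr1 kk.
    move: n1; set b := n%:R^-1; set a := _ / _; move: a b => a b b0.
    rewrite /Num.min; case: ltP => ?; case: ltP => ?; apply/andP; split; lra.
  move=> x; rewrite /U /h /= => /negP; rewrite -leNgt => ux.
  rewrite (min_idPr ux) (min_idPr _) ?subrr ?mulr0//.
  by rewrite (le_trans ux)// ler_wpM2r ?ler_nat// invr_ge0 ltW.
have iU k : mu.-integrable setT (EFin \o (\1_(U k) : X -> R)).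
  apply: (@bounded_integrable _ _ _ _ _ 1); first exact: measurable_indic.
  by move=> x; rewrite indicE; case: (_ \in _); rewrite ?normr1 ?normr0.
have -> : Lam u = \sum_(0 <= k < n) (Lam (h k.+1) - Lam (h k)).
  rewrite telescope_sumr//.
  have -> : h 0%N = (fun=> 0).
    apply/funext => x; rewrite /h mul0r; apply/min_idPl.
    by have /andP[] := u01 x.
  rewrite Lam_cst subr0; congr Lam; apply/funext => x; rewrite /h divff ?gt_eqF//.
  by apply/esym/min_idPr; have /andP[] := u01 x.
(* At most [n * u x + 1] of the levels [k / n] lie strictly below [u x]; the extra 1 accounts for
   level 0. *)
have sumU N x : \sum_(0 <= k < N) (\1_(U k) x : R) <= n%:R * u x + 1.
  elim: N => [|N ih].
    rewrite big_nil addr_ge0// mulr_ge0//.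
    by have /andP[] := u01 x.
  rewrite big_nat_recr//= indicE; have [xU|xU] := boolP (x \in U N); last first.
    by rewrite addr0.
  rewrite lerD2r; apply: (@le_trans _ _ N%:R); last first.
    by rewrite -ler_pdivrMl// mulrC ltW//; move: xU; rewrite inE.
  apply: (@le_trans _ _ (\sum_(0 <= i < N) (1 : R))); last first.
    by rewrite sumr_const_nat subn0.
  by apply: ler_sum => k _; rewrite indicE; case: (_ \in _).
apply: (@le_trans _ _ (\sum_(0 <= k < n) n%:R^-1 * \int[mu]_x \1_(U k) x)).
  by apply: ler_sum => k _; exact: hS.
rewrite -mulr_sumr -(@Rintegral_sum _ _ _ mu _ _ (fun k => \1_(U k) : X -> R))//.
rewrite ler_pdivrMl//.
have iSU : mu.-integrable setT (EFin \o (fun x => \sum_(0 <= k < n) (\1_(U k) x : R))).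
  rewrite (_ : _ \o _ = (fun x => \sum_(0 <= k < n) (\1_(U k) x)%:E)%E).
    by apply: integrable_sum => // k _; exact: iU.
  by apply/funext => x; rewrite /= sumEFin.
have ie : n%:R * (n%:R^-1 : R) <= n%:R * e by rewrite ler_wpM2l// ltW.
rewrite divff ?gt_eqF// in ie.
apply: (@le_trans _ _ (\int[mu]_x (n%:R * u x + 1))).
  apply: le_Rintegral => //.
  by apply: L_integrable; apply: L_add; [exact: L_scale|exact: L_cst].
rewrite RintegralD//; last 2 first.
- by apply: L_integrable; exact: L_scale.
- by apply: L_integrable; exact: L_cst.
rewrite RintegralZl//; last exact: L_integrable.
by rewrite Rintegral_probability_cst mulrDr lerD2l.
Qed.

(** [Lam_le_integral] applied to [1 - v] gives the reverse inequality for functions with values in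
    the unit interval; any other function is brought there by an affine rescaling. *)
Lemma riesz_representation : exists m : probability (borel X) R,
  forall u, L u -> \int[m]_x u x = Lam u.
Proof.
exists mu => u Lu.
have le1 v : L v -> (forall x, 0 <= v x <= 1) -> \int[mu]_x v x = Lam v.
  move=> Lv v01; apply/eqP; rewrite eq_le Lam_le_integral// andbT.
  have : Lam (fun x => 1 - v x) <= \int[mu]_x (1 - v x).
    apply: Lam_le_integral; first by apply: L_sub => //; exact: L_cst.
    by move=> x; have /andP[? ?] := v01 x; apply/andP; split; lra.
  rewrite Lam_sub//.
  rewrite RintegralB//; [|exact/L_integrable/L_cst|exact: L_integrable].
  rewrite Rintegral_probability_cst Lam_cst; lra.
have [M uM] := L_bounded Lu.
have M0 : 0 < `|M| + 1 by rewrite ltr_wpDl.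
pose k := 2 * (`|M| + 1).
pose v x := k^-1 * (u x + (`|M| + 1)).
have k0 : 0 < k by rewrite mulr_gt0.
have Lu1 : L (fun x => u x + (`|M| + 1)) by apply: L_add => //; exact: L_cst.
have Lv : L v by exact: L_scale.
have uv : u = (fun x => k * v x + - (`|M| + 1)).
  by apply/funext => x; rewrite /v mulrA divff ?gt_eqF// mul1r addrK.
have Lkv : L (fun x => k * v x) by exact: L_scale.
have v1 : \int[mu]_x v x = Lam v.
  apply: le1 => // x; rewrite /v ler_pdivlMl// ler_pdivrMl// mulr0 mulr1 /k.
  have := uM x; rewrite ler_norml => /andP[? ?]; have := ler_norm M.
  by move=> ?; apply/andP; split; lra.
rewrite uv RintegralD//; [|exact: L_integrable|exact/L_integrable/L_cst].
rewrite Rintegral_probability_cst RintegralZl//; last exact: L_integrable.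
by rewrite Lam_add// Lam_scale// Lam_cst v1.
Qed.

End riesz.

Section real_integrable.
Context d (T : measurableType d) (R : realType) (mu : {measure set T -> \bar R}).
Implicit Types u v : T -> R.

Lemma integrable_addr u v : mu.-integrable setT (EFin \o u) ->
  mu.-integrable setT (EFin \o v) ->
  mu.-integrable setT (EFin \o (fun x => u x + v x)).
Proof. by move=> iu iv; exact: (integrableD measurableT iu iv). Qed.

Lemma integrable_subr u v : mu.-integrable setT (EFin \o u) ->
  mu.-integrable setT (EFin \o v) ->
  mu.-integrable setT (EFin \o (fun x => u x - v x)).
Proof. by move=> iu iv; exact: (integrableB measurableT iu iv). Qed.

Lemma integrable_mulrl c u : mu.-integrable setT (EFin \o u) ->
  mu.-integrable setT (EFin \o (fun x => c * u x)).
Proof. by move=> iu; exact: (integrableZl measurableT c iu). Qed.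

Lemma integrable_normr u : mu.-integrable setT (EFin \o u) ->
  mu.-integrable setT (EFin \o (fun x => `|u x|)).
Proof. by move=> iu; exact: (integrable_norm iu). Qed.

End real_integrable.

Lemma probability_integrable_cst d (T : measurableType d) (R : realType)
  (P : probability T R) (c : R) : P.-integrable setT (EFin \o (fun=> c)).
Proof. exact: (finite_measure_integrable_cst P c measurableT). Qed.

(** * Calculus of Hoelder functions *)

Section holder.
Context {R : realType} {X : pmetricType R}.
Implicit Types (u v : X -> R) (a C : R).

Definition holder a C u := forall x y, `|u x - u y| <= C * mdist x y `^ a.

Definition holder_class a : set (X -> R) := [set u | exists2 C, 0 <= C & holder a C u].

Lemma holderD a C D u v : holder a C u -> holder a D v ->
  holder a (C + D) (fun x => u x + v x).
Proof.
move=> hu hv x y; rewrite mulrDl (le_trans _ (lerD (hu x y) (hv x y)))//.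
by rewrite (le_trans _ (ler_normD _ _))// opprD addrACA.
Qed.

Lemma holderZ a C c u : holder a C u -> holder a (`|c| * C) (fun x => c * u x).
Proof. by move=> hu x y; rewrite -mulrBr normrM -mulrA ler_wpM2l. Qed.

Lemma holder_min a C c u : holder a C u ->
  holder a C (fun x => Num.min c (u x)).
Proof.
move=> hu x y; apply: le_trans (hu x y); move: (u x) (u y) => s t.
have := ler_norm (s - t); have := ler_norm (t - s); rewrite distrC => h1 h2.
by rewrite /Num.min; case: (ltP c s) => ?; case: (ltP c t) => ?;
  rewrite ?subrr ?normr0// ler_norml; apply/andP; split; lra.
Qed.

Lemma holder_cst a c : holder a 0 (fun=> c).
Proof. by move=> x y; rewrite subrr normr0 mul0r. Qed.

Lemma holder_le a C D u : C <= D -> holder a C u -> holder a D u.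
Proof. by move=> CD hu x y; rewrite (le_trans (hu x y))// ler_wpM2r// powR_ge0. Qed.

Lemma holder_classD a u v : holder_class a u -> holder_class a v ->
  holder_class a (fun x => u x + v x).
Proof.
move=> [C C0 hu] [D D0 hv]; exists (C + D); first exact: addr_ge0.
exact: holderD.
Qed.

Lemma holder_classZ a c u : holder_class a u -> holder_class a (fun x => c * u x).
Proof.
move=> [C C0 hu]; exists (`|c| * C); first by rewrite mulr_ge0.
exact: holderZ.
Qed.

Lemma holder_class_min a c u : holder_class a u ->
  holder_class a (fun x => Num.min c (u x)).
Proof. by move=> [C C0 hu]; exists C => //; exact: holder_min. Qed.

Lemma holder_class_cst a c : holder_class a (fun=> c).
Proof. by exists 0 => //; exact: holder_cst. Qed.

Lemma holder_continuous a C u : 0 < a -> holder a C u -> continuous u.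
Proof.
move=> a0 hu x; apply/cvgrPdist_le => e e0.
have k1 : 0 < `|C| + 1 by rewrite ltr_wpDl.
have ek : 0 < e / (`|C| + 1) by rewrite divr_gt0.
have /mdist_cvgP : y @[y --> x] --> x by exact: cvg_id.
move=> /(_ ((e / (`|C| + 1)) `^ a^-1)); rewrite powR_gt0// => /(_ isT).
apply: filterS => y xy; apply: (le_trans (hu x y)).
apply: (@le_trans _ _ ((`|C| + 1) * mdist x y `^ a)).
  by rewrite ler_wpM2r ?powR_ge0// (le_trans (ler_norm C))// lerDl.
rewrite mulrC -ler_pdivlMr//.
have -> : e / (`|C| + 1) = ((e / (`|C| + 1)) `^ a^-1) `^ a.
  by rewrite -powRrM mulVf ?gt_eqF// powRr1// ltW.
apply: ge0_ler_powR; rewrite ?nnegrE ?powR_ge0 ?mdist_ge0//; exact: ltW.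
Qed.

Lemma holder_class_continuous a u : 0 < a -> holder_class a u -> continuous u.
Proof. by move=> a0 [C _ hu]; exact: holder_continuous hu. Qed.

Lemma holder_class_borel a u : 0 < a -> holder_class a u ->
  measurable_fun setT (u : borel X -> R).
Proof. by move=> a0 hu; exact: continuous_borel (holder_class_continuous a0 hu). Qed.

Hypothesis cX : compact [set: X].

Lemma holder_bounded a C u : 0 < a -> 0 <= C -> holder a C u ->
  exists M : R, forall x, `|u x| <= M.
Proof.
move=> a0 C0 hu; have [D D0 dD] := compact_mdist_bounded cX.
exists (`|u point| + C * D `^ a) => x.
have -> : u x = u point + (u x - u point) by rewrite addrC subrK.
rewrite (le_trans (ler_normD _ _))// lerD2l (le_trans (hu _ _))//.
by rewrite ler_wpM2l//; apply: ge0_ler_powR;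
  rewrite ?nnegrE ?mdist_ge0 ?(ltW a0) ?(ltW D0).
Qed.

Lemma holder_class_bounded a u : 0 < a -> holder_class a u ->
  exists M : R, forall x, `|u x| <= M.
Proof. by move=> a0 [C C0 hu]; exact: holder_bounded hu. Qed.

Lemma lipschitz_holder a k u : 0 < a <= 1 -> lipschitz_real k u ->
  holder_class a u.
Proof.
move=> /andP[a0 a1] uk; have [D D0 dD] := compact_mdist_bounded cX.
exists (`|k| * D `^ (1 - a)); first by rewrite mulr_ge0// powR_ge0.
move=> x y; apply: (le_trans (uk x y)).
apply: (@le_trans _ _ (`|k| * mdist x y)).
  by rewrite ler_wpM2r ?mdist_ge0// ler_norm.
rewrite -mulrA ler_wpM2l//.
have [->|xy] := eqVneq x y.
  by rewrite mdistxx mulr_ge0// powR_ge0.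
have d0 : 0 < mdist x y by rewrite mdist_gt0.
rewrite -{1}[mdist x y]powRr1 ?mdist_ge0// -{1}(subrK a 1) powRD; last first.
  by apply/implyP => _; rewrite gt_eqF.
by rewrite ler_wpM2r ?powR_ge0//; apply: ge0_ler_powR;
  rewrite ?nnegrE ?mdist_ge0 ?subr_ge0 ?(ltW D0).
Qed.

End holder.

Lemma holder_class_sum {R : realType} {X : pmetricType R} (a : R) (I : Type)
    (s : seq I) (F : I -> X -> R) : (forall i, holder_class a (F i)) ->
  holder_class a (fun x => \sum_(i <- s) F i x).
Proof.
move=> hF; elim: s => [|i s ih].
  by rewrite (_ : (fun _ => _) = fun=> 0);
    [exact: holder_class_cst|apply/funext => x; rewrite big_nil].
rewrite (_ : (fun _ => _) = (fun x => F i x + \sum_(j <- s) F j x));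
  first exact: holder_classD.
by apply/funext => x; rewrite big_cons.
Qed.

(** * Logarithmic moduli of a Lipschitz map *)

Section log_modulus.
Context {R : realType} {X : pmetricType R}.
Hypothesis cX : compact [set: X].
Implicit Types (g h : X -> X) (x y z : X) (L : R).

Definition lipschitz_map L g := forall y z, mdist (g y) (g z) <= L * mdist y z.

Lemma lipschitz_map_comp L M g h : 0 <= L -> lipschitz_map L g ->
  lipschitz_map M h -> lipschitz_map (L * M) (g \o h).
Proof.
by move=> L0 gL hM y z; rewrite (le_trans (gL _ _))// -mulrA ler_wpM2l.
Qed.

Definition dense_seq : nat -> X :=
  sval (cid (@compact_dense_seq R X cX setT (ex_intro _ point I))).

Lemma dense_seqP x (e : R) : 0 < e -> exists i, mdist x (dense_seq i) < e.
Proof. by rewrite /dense_seq; case: cid => D /= [_ h]; exact: h. Qed.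

(** Numbers that code no pair repeat the pair of indices [(0, 0)], which changes no supremum. *)
Definition dense_pair (n : nat) : X * X :=
  let ij := odflt (0%N, 0%N) (unpickle n) in (dense_seq ij.1, dense_seq ij.2).

Lemma dense_pairP i j : exists n, dense_pair n = (dense_seq i, dense_seq j).
Proof. by exists (pickle (i, j)); rewrite /dense_pair pickleK. Qed.

(** On the diagonal the quotient is 0, by the convention on division by 0. *)
Definition dilation g (p : X * X) : R := mdist (g p.1) (g p.2) / mdist p.1 p.2.

Lemma dilation_le L g y z : 0 <= L ->
  mdist (g y) (g z) <= L * mdist y z -> dilation g (y, z) <= L.
Proof.
move=> L0 gyz; rewrite /dilation/=; have [yz|yz] := eqVneq y z.
  by rewrite yz !mdistxx mul0r.
by rewrite ler_pdivrMr// mdist_gt0.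
Qed.

(** The floor [expR (- k)] keeps the logarithm finite where [g] collapses distances; the penalty
    makes pairs far from [x] irrelevant once [k] is large. *)
Definition log_dilation k g x p : R :=
  ln (Num.max (dilation g p) (expR (- k%:R))) -
  k%:R * (mdist x p.1 + mdist x p.2).

(* A [2 k]-Lipschitz function of [x], which decreases to the logarithm of the
   local Lipschitz constant of [g] at [x] as [k] grows. *)
Definition log_modulus (k : nat) g x : R :=
  sups (fun n => log_dilation k g x (dense_pair n)) 0%N.

Let maxe_gt0 k g p : 0 < Num.max (dilation g p) (expR (- k%:R)).
Proof. by rewrite lt_max expR_gt0 orbT. Qed.

Let penalty_ge0 k x y z : 0 <= k%:R * (mdist x y + mdist x z) :> R.
Proof. by rewrite mulr_ge0// addr_ge0// mdist_ge0. Qed.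

Let log_dilation_le k g x p c : dilation g p <= expR c -> - k%:R <= c ->
  log_dilation k g x p <= c - k%:R * (mdist x p.1 + mdist x p.2).
Proof.
move=> gc kc; rewrite /log_dilation lerD2r -ler_expR lnK ?posrE//.
by rewrite ge_max gc/= ler_expR.
Qed.

Let ub_log_dilation k g x L : 1 <= L -> lipschitz_map L g ->
  ubound (range (fun n => log_dilation k g x (dense_pair n))) (ln L).
Proof.
move=> L1 gL _ [n _ <-]; have L0 : 0 < L by exact: lt_le_trans L1.
have := @log_dilation_le k g x (dense_pair n) (ln L).
move=> h; apply: (le_trans (h _ _)).
- rewrite lnK ?posrE//; case: dense_pair => y z.
  by apply: dilation_le; [exact: ltW|exact: gL].
- by rewrite (le_trans _ (ln_ge0 L1))// oppr_le0.
- by rewrite gerBl.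
Qed.

Let supsE k g x : log_modulus k g x =
  sup (range (fun n => log_dilation k g x (dense_pair n))).
Proof.
rewrite /log_modulus /sups/= /sdrop; congr sup.
by apply/seteqP; split => [_ [n _ <-]|_ [n _ <-]]; exists n.
Qed.

Let log_modulus_ub k g x L n : 1 <= L -> lipschitz_map L g ->
  log_dilation k g x (dense_pair n) <= log_modulus k g x.
Proof.
move=> L1 gL; rewrite supsE; apply: ub_le_sup; last by exists n.
by exists (ln L); exact: ub_log_dilation.
Qed.

Let log_modulus_lub k g x c :
  (forall n, log_dilation k g x (dense_pair n) <= c) -> log_modulus k g x <= c.
Proof.
move=> h; rewrite supsE; apply: ge_sup.
  by exists (log_dilation k g x (dense_pair 0)), 0%N.
by move=> _ [n _ <-].
Qed.

Lemma log_modulus_le_ln k g x L : 1 <= L -> lipschitz_map L g ->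
  log_modulus k g x <= ln L.
Proof.
move=> L1 gL; apply: log_modulus_lub => n.
by apply: ub_log_dilation gL _ _ => //; exists n.
Qed.

(** Diagonal pairs have dilation 0 and thus contribute the floor [- k], up to a penalty that is
    small for a dense point close to [x]. *)
Lemma log_modulus_ge k g x L : 1 <= L -> lipschitz_map L g ->
  - k%:R <= log_modulus k g x.
Proof.
move=> L1 gL; apply/ler_addgt0Pr => /= e e0.
have k1 : 0 < 2 * (k%:R + 1) :> R by rewrite mulr_gt0// ltr_wpDl.
have [i xi] := dense_seqP x (divr_gt0 e0 k1).
have [n nE] := dense_pairP i i.
have := log_modulus_ub k x n L1 gL; rewrite nE /log_dilation /dilation/= !mdistxx mul0r.
rewrite (max_idPr (expR_ge0 _)) expRK.
suff : k%:R * (mdist x (dense_seq i) + mdist x (dense_seq i)) <= e by lra.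
have k0 : 0 <= k%:R :> R by [].
have d0 : 0 <= mdist x (dense_seq i) by exact: mdist_ge0.
apply: (@le_trans _ _ (2 * (k%:R + 1) * mdist x (dense_seq i))); first by nra.
by rewrite mulrC -ler_pdivlMr// ltW.
Qed.

Lemma log_modulus_lip k g L : 1 <= L -> lipschitz_map L g ->
  lipschitz_real (2 * k%:R) (log_modulus k g).
Proof.
move=> L1 gL.
have h x y : log_modulus k g x <= log_modulus k g y + 2 * k%:R * mdist x y.
  apply: log_modulus_lub => n; have := log_modulus_ub k y n L1 gL.
  rewrite /log_dilation; set l := ln _; case: (dense_pair n) => /= u v.
  have := metric_triangle y x u; have := metric_triangle y x v.
  rewrite (metric_sym y x); have k0 : 0 <= k%:R :> R by [].
  have := mdist_ge0 x y.
  move: (mdist x y) (mdist y u) (mdist y v) (mdist x u) (mdist x v) => a b c e m.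
  move: (log_modulus _ _ _) l => V l *; nra.
move=> x y; rewrite ler_norml; apply/andP; split.
  by have := h y x; rewrite (metric_sym y); lra.
by have := h x y; lra.
Qed.

Lemma log_modulus_noninc k l g x L : 1 <= L -> lipschitz_map L g -> (k <= l)%N ->
  log_modulus l g x <= log_modulus k g x.
Proof.
move=> L1 gL kl; apply: log_modulus_lub => n.
apply: le_trans (log_modulus_ub k x n L1 gL).
apply: lerB; last by rewrite ler_wpM2r ?ler_nat// addr_ge0// mdist_ge0.
rewrite ler_ln ?posrE// ge_max le_max lexx/= le_max ler_expR lerN2 ler_nat kl.
by rewrite orbT.
Qed.

(** For dense points this unfolds the supremum; the general case follows by continuity. The base
    point [x] is free: [x = y] serves for contraction at small distances, [k = 0] for a global
    Lipschitz bound. *)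
Lemma log_modulusP k g x L y z : 1 <= L -> lipschitz_map L g ->
  mdist (g y) (g z) <=
  mdist y z * expR (log_modulus k g x + k%:R * (mdist x y + mdist x z)).
Proof.
move=> L1 gL; set V := log_modulus k g x.
have /choice[i iP] : forall n : nat, exists i, mdist y (dense_seq i) < n.+1%:R^-1.
  by move=> n; apply: dense_seqP; rewrite invr_gt0.
have /choice[j jP] : forall n : nat, exists j, mdist z (dense_seq j) < n.+1%:R^-1.
  by move=> n; apply: dense_seqP; rewrite invr_gt0.
have cv (u : X) (s : nat -> nat) :
    (forall n : nat, mdist u (dense_seq (s n)) < n.+1%:R^-1) ->
    dense_seq (s n) @[n --> natU] --> u.
  move=> us; apply/mdist_cvgP => e e0; near=> n.
  rewrite (lt_le_trans (us n))// -[leRHS]invrK lef_pV2 ?posrE ?invr_gt0//.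
  rewrite (le_trans (ltW (truncnS_gt _)))// ler_nat ltnW// ltnS.
  by near: n; exact: natU_ge.
have ci := cv y i iP; have cj := cv z j jP.
have cg (u : X) (s : nat -> X) : s n @[n --> natU] --> u ->
    g (s n) @[n --> natU] --> g u.
  have L0 : 0 < L by exact: lt_le_trans L1.
  move=> /mdist_cvgP su; apply/mdist_cvgP => e e0.
  have /su : 0 < e / L by rewrite divr_gt0.
  apply: filterS => n; rewrite ltr_pdivlMr// mulrC; exact: le_lt_trans.
apply: (ler_cvg_to (natU_mdist (cg _ _ ci) (cg _ _ cj)) (g := fun n =>
    mdist (dense_seq (i n)) (dense_seq (j n)) *
    expR (V + k%:R * (mdist x (dense_seq (i n)) + mdist x (dense_seq (j n)))))).
  apply: cvgM; first exact: natU_mdist.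
  apply: continuous_cvg; first exact: continuous_expR.
  apply: cvgD; first exact: cvg_cst.
  apply: cvgMr; apply: cvgD; apply: natU_mdist => //; exact: cvg_cst.
apply: filterE => n; have [m mE] := dense_pairP (i n) (j n).
have := log_modulus_ub k x m L1 gL; rewrite mE -/V.
move: (dense_seq (i n)) (dense_seq (j n)) => u v; rewrite /log_dilation/= lerBlDr.
rewrite -ler_expR lnK ?posrE// ge_max => /andP[+ _].
rewrite /dilation/=; have [->|uv] := eqVneq u v; first by rewrite !mdistxx mul0r.
by rewrite ler_pdivrMr ?mdist_gt0// mulrC.
Unshelve. all: by end_near. Qed.

(** Pairs in the ball of radius [r] are controlled by [c]. Any other pair has a penalty of at least
    [k * r], which outweighs [ln L - c] for large [k]. *)
Lemma log_modulus_eventually_le g x L c (r : R) : 1 <= L -> lipschitz_map L g ->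
  0 < r -> (forall y z, mdist x y < r -> mdist x z < r ->
    mdist (g y) (g z) <= mdist y z * expR c) ->
  \forall k \near \oo, log_modulus k g x <= c.
Proof.
move=> L1 gL r0 gc; near=> k.
have kc : - c <= k%:R.
  rewrite (le_trans (ltW (truncnS_gt _)))// ler_nat; near: k; exact: nbhs_infty_ge.
have kL : (ln L - c) / r <= k%:R.
  rewrite (le_trans (ltW (truncnS_gt _)))// ler_nat; near: k; exact: nbhs_infty_ge.
have L0 : 0 < L by exact: lt_le_trans L1.
apply: log_modulus_lub => n; case: (dense_pair n) => y z.
have pen := penalty_ge0 k x y z.
have [/andP[xy xz]|far] := boolP ((mdist x y < r) && (mdist x z < r)).
  apply: (le_trans (@log_dilation_le k g x (y, z) c _ _)) => /=; [|lra|lra].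
  by apply: dilation_le; [exact: expR_ge0|rewrite mulrC; exact: gc].
apply: (le_trans (@log_dilation_le k g x (y, z) (ln L) _ _)) => /=.
- by rewrite lnK ?posrE//; apply: dilation_le; [exact: ltW|exact: gL].
- by rewrite (le_trans _ (ln_ge0 L1))// oppr_le0.
have rd : r <= mdist x y + mdist x z.
  move: far; rewrite negb_and -!leNgt => /orP[]; have := mdist_ge0 x y;
  have := mdist_ge0 x z; lra.
have : ln L - c <= k%:R * r by rewrite -ler_pdivrMr.
have : k%:R * r <= k%:R * (mdist x y + mdist x z) by rewrite ler_wpM2l.
lra.
Unshelve. all: by end_near. Qed.

(** The chain rule, composed from two instances of [log_modulusP] in a ball around [x] so small that
    both penalties together stay below [e]. *)
Lemma log_modulus_comp g h x L M j k (e : R) : 1 <= L -> lipschitz_map L g ->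
  1 <= M -> lipschitz_map M h -> 0 < e ->
  \forall i \near \oo, log_modulus i (g \o h) x <=
    log_modulus j h x + log_modulus k g (h x) + e.
Proof.
move=> L1 gL M1 hM e0.
have M0 : 0 < M by exact: lt_le_trans M1.
have L0 : 0 < L by exact: lt_le_trans L1.
(* In the ball of radius [e / K] the penalty for [h] has slope [j] and that for [g] has slope
   [k * M]; the factor 2 counts the two points, and the summand 1 makes [K] positive. *)
pose K := 2 * (j%:R + k%:R * M + 1).
have K0 : 0 < K by rewrite mulr_gt0// ltr_wpDl// addr_ge0// mulr_ge0// ltW.
apply: (@log_modulus_eventually_le _ _ (L * M) _ (e / K)) => //.
- by rewrite -[leLHS]mulr1 ler_pM.
- by apply: lipschitz_map_comp => //; exact: ltW.
- by rewrite divr_gt0.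
move=> y z xy xz /=.
have h1 := log_modulusP j x y z M1 hM.
have h2 := log_modulusP k (h x) (h y) (h z) L1 gL.
apply: (le_trans h2).
apply: (le_trans (ler_wpM2r (expR_ge0 _) h1)).
rewrite -mulrA ler_wpM2l ?mdist_ge0// -expRD ler_expR.
have hxy := hM x y; have hxz := hM x z.
have xyK : K * mdist x y <= e by rewrite mulrC -ler_pdivlMr// ltW.
have xzK : K * mdist x z <= e by rewrite mulrC -ler_pdivlMr// ltW.
have j0 : 0 <= j%:R :> R by []. have k0 : 0 <= k%:R :> R by [].
have a0 := mdist_ge0 x y; have b0 := mdist_ge0 x z.
have : k%:R * (mdist (h x) (h y) + mdist (h x) (h z)) <=
    k%:R * (M * mdist x y + M * mdist x z) by rewrite ler_wpM2l// lerD.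
move: xyK xzK a0 b0; rewrite /K.
move: (mdist x y) (mdist x z) (mdist (h x) (h y)) (mdist (h x) (h z)) => a b s t.
move=> A B a0 b0 Q.
have kM : 0 <= k%:R * M by rewrite mulr_ge0// ltW.
have E : k%:R * (M * a + M * b) = (k%:R * M) * a + (k%:R * M) * b by ring.
rewrite E in Q; move: A B Q kM; move: (k%:R * M) => c A B Q c0.
have : j%:R * (a + b) + (c * a + c * b) <= e by lra.
lra.
Qed.

Lemma le_Lip_on (A B : set X) g : A `<=` B -> (Lip_on A g <= Lip_on B g)%E.
Proof.
move=> AB; apply: le_ereal_inf => _ [L [L0 hL] <-]; exists L => //.
by split => // y z /AB By /AB Bz; exact: hL.
Qed.

Lemma Lip_on_ge0 (A : set X) g : (0 <= Lip_on A g)%E.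
Proof. by apply: le_ereal_inf_tmp => _ [L [L0 _] <-]; rewrite lee_fin. Qed.

Lemma local_LipE g x :
  local_Lip g x = ereal_inf [set Lip_on (ball x r) g | r in `]0, +oo[%classic].
Proof.
apply/cvg_lim => //; apply: (@nondecreasing_at_right_cvge _ _ _ +oo%O) => //.
move=> r s _ _ rs; apply: le_Lip_on; exact: le_ball.
Qed.

Lemma local_Lip_ge0 g x : (0 <= local_Lip g x)%E.
Proof.
by rewrite local_LipE; apply: le_ereal_inf_tmp => _ [r _ <-]; exact: Lip_on_ge0.
Qed.

Let lne_expR (c : R) : lne (expR c)%:E = c%:E.
Proof. by rewrite lne_EFin ?expR_gt0// expRK. Qed.

Lemma lne_local_Lip_le k g x L : 1 <= L -> lipschitz_map L g ->
  (lne (local_Lip g x) <= (log_modulus k g x)%:E)%E.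
Proof.
move=> L1 gL; apply/lee_addgt0Pr => e e0; rewrite -EFinD -lne_expR.
rewrite lee_lne ?in_itv/= ?leey ?andbT ?local_Lip_ge0 ?lee_fin ?expR_ge0//.
have k1 : 0 < 2 * (k%:R + 1) :> R by rewrite mulr_gt0// ltr_wpDl.
have r0 : 0 < e / (2 * (k%:R + 1)) by rewrite divr_gt0.
rewrite local_LipE; apply: (@le_trans _ _ (Lip_on (ball x (e / (2 * (k%:R + 1)))) g)).
  apply: ereal_inf_lbound; exists (e / (2 * (k%:R + 1))) => //=.
  by rewrite in_itv/= andbT.
apply: ereal_inf_lbound; exists (expR (log_modulus k g x + e)) => //.
split; first exact: expR_ge0.
move=> y z; rewrite ballEmdist/= => xy xz; rewrite mulrC.
apply: (le_trans (log_modulusP k x y z L1 gL)).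
rewrite ler_wpM2l ?mdist_ge0// ler_expR lerD2l.
move: xy xz; rewrite !ltr_pdivlMr// => xy xz.
have k0 : 0 <= k%:R :> R by [].
have a0 := mdist_ge0 x y; have b0 := mdist_ge0 x z.
move: (mdist x y) (mdist x z) xy xz a0 b0 => a b *.
lra.
Qed.

(** Any bound on the Lipschitz constant of [g] in some ball around [x] is eventually a bound on the
    moduli, which always dominate the limit. The value [-oo] occurs when the local constant is 0. *)
Lemma cvg_log_modulus g x L : 1 <= L -> lipschitz_map L g ->
  (log_modulus k g x)%:E @[k --> \oo] --> lne (local_Lip g x).
Proof.
move=> L1 gL.
have ev c : (lne (local_Lip g x) < c%:E)%E ->
    \forall k \near \oo, log_modulus k g x <= c.
  rewrite -lne_expR lte_lne ?in_itv/= ?leey ?andbT ?local_Lip_ge0 ?lee_fin ?expR_ge0//.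
  rewrite local_LipE => /ereal_inf_lt[_ [r /= + <-]].
  rewrite in_itv/= andbT => r0 /ereal_inf_lt[_ [M [M0 hM] <-]].
  rewrite lte_fin => Mc; apply: (log_modulus_eventually_le L1 gL r0) => y z xy xz.
  apply: (@le_trans _ _ (M * mdist y z)); first by apply: hM; rewrite ballEmdist.
  by rewrite mulrC ler_wpM2l ?mdist_ge0// ltW.
have := lne_local_Lip_le _ x L1 gL.
case: (lne _) ev => [r| |] ev lb.
- apply: cvg_EFin; first exact: nearW.
  apply/cvgrPdist_le => e e0; have : (r%:E < (r + e)%:E)%E by rewrite lte_fin ltrDl.
  move/ev; apply: filterS => k kr /=.
  have := lb k; rewrite lee_fin => rk; rewrite ler_norml; apply/andP; split; lra.
- by have := lb 0%N; rewrite leye_eq.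
- by apply/cvgeNyPle => A; apply: filterS (ev A (ltNyr _)) => k; rewrite lee_fin.
Qed.

(** This is why the modulus is a supremum over a countable family of pairs. *)
Lemma measurable_log_modulus d (S : measurableType d) k (G : S -> X -> X)
    (xi : S -> borel X) :
  (forall y, measurable_fun setT (fun s => (G s y : borel X))) ->
  measurable_fun setT xi ->
  (forall s, exists2 L : R, 1 <= L & lipschitz_map L (G s)) ->
  measurable_fun setT (fun s => log_modulus k (G s) (xi s)).
Proof.
move=> mG mxi GL.
apply: (@measurable_fun_sups _ _ _ setT
  (fun n s => log_dilation k (G s) (xi s) (dense_pair n)) 0%N).
  move=> s _; have [L L1 sL] := GL s; exists (ln L).
  have ub := @ub_log_dilation k (G s) (xi s : X) L L1 sL.
  by move=> _ [n _ <-]; apply: ub; exists n.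
move=> n; apply: measurable_funB.
  apply: (measurableT_comp (@measurable_ln R)).
  apply: measurable_maxr => //; apply: measurable_funM => //.
  exact: measurable_mdist.
apply: measurable_funM => //.
by apply: measurable_funD; apply: measurable_mdist.
Qed.

End log_modulus.

(** * Operators on the Hoelder space *)

Section linear_maps.
Context {R : realType} {E F : lmodType R}.

(** A copy of [g] indexed by a proof of linearity, to which the structure of linear map can be
    attached. *)
Definition linear_map_of (g : E -> F) of linear g := g.

HB.instance Definition _ (g : E -> F) (h : linear g) :=
  GRing.isLinear.Build R E F *:%R (linear_map_of h) h.

End linear_maps.

(** By induction, such combinations lie in the continuous image of the product of a segment and a
    compact set. This yields compactness of finite rank operators with bounded coefficients. *)
Lemma precompact_bounded_combinations (R : realType) (E : normedModType R)
    (s : seq E) (M : R) :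
  precompact [set v : E | exists2 c : nat -> R, (forall i, `|c i| <= M) &
    v = \sum_(i < size s) c i *: s`_i].
Proof.
elim: s => [|e s ih].
  apply: (@precompact_subset _ _ [set 0]).
    by move=> v [c _ ->] /=; rewrite big_ord0.
  by apply: compact_precompact; [exact: norm_hausdorff|exact: compact_set1].
pose A := [set v : E | exists2 c : nat -> R, (forall i, `|c i| <= M) &
    v = \sum_(i < size s) c i *: s`_i].
pose h (z : R * E) : E := z.1 *: e + z.2.
have ch : continuous h.
  move=> z; apply: cvgD; last exact: cvg_snd.
  by apply: cvgZr_tmp; exact: cvg_fst.
have cK : compact (h @` (`[- M, M]%classic `*` closure A)).
  apply: continuous_compact.
    exact: continuous_subspaceT.
  apply: compact_setX; first exact: segment_compact.
  by rewrite -precompactE.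
apply: precompact_subset (compact_precompact (@norm_hausdorff _ _) cK).
move=> v [c cM ->]; exists (c 0%N, \sum_(i < size s) c i.+1 *: s`_i).
  split; first by rewrite /= in_itv/= -ler_norml.
  by apply: subset_closure; exists (fun i => c i.+1).
by rewrite /h big_ord_recl.
Qed.

Section hoelder_space_theory.
Context {R : realType} {X : pmetricType R}.
Hypothesis cX : compact [set: X].
Variable a : R.
Hypothesis a_gt0 : 0 < a.
Implicit Types u v : X -> R.

Lemma hoelder_continuousP u : hoelder_continuous a u <-> holder_class a u.
Proof.
split=> [[_ [C hC]]|hu].
  exists (Num.max C 0); first by rewrite le_max lexx orbT.
  move=> x y; have [->|xy] := eqVneq x y.
    by rewrite subrr normr0 mulr_ge0 ?powR_ge0// le_max lexx orbT.
  have d0 : 0 < mdist x y by rewrite mdist_gt0.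
  rewrite -ler_pdivrMr ?powR_gt0//; apply: (@le_trans _ _ C).
    by apply: hC; exists (x, y) => //=; exact/eqP.
  by rewrite le_max lexx.
have [M uM] := holder_class_bounded cX a_gt0 hu.
split; first by exists M => _ [x _ <-].
have [C C0 hC] := hu; exists C => _ [[x y] /= /eqP xy <-].
by rewrite ler_pdivrMr ?powR_gt0// mdist_gt0.
Qed.

Lemma hoelder_space_class (u : hoelder_space X a) : holder_class a u.
Proof. by case: u => u /= /asboolP/hoelder_continuousP. Qed.

Definition hoelder_of u (hu : holder_class a u) : hoelder_space X a :=
  HoelderSpace (introT (asboolP _) ((hoelder_continuousP u).2 hu)).

Lemma hoelder_norm_le C M u : 0 <= C -> holder a C u ->
  (forall x, `|u x| <= M) -> hoelder_norm a u <= M + C.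
Proof.
move=> C0 hu uM; apply: lerD.
  by apply: ge_sup; [exists `|u point|, point|move=> _ [x _ <-]].
have [->|/set0P Q0] := eqVneq (hoelder_quotients a u) set0; first by rewrite sup0.
apply: ge_sup => // _ [[x y] /= /eqP xy <-].
by rewrite ler_pdivrMr ?powR_gt0// mdist_gt0.
Qed.

Lemma hoelder_norm_bounds u : holder_class a u ->
  [/\ 0 <= hoelder_norm a u, forall x, `|u x| <= hoelder_norm a u &
      holder a (hoelder_norm a u) u].
Proof.
move=> /hoelder_continuousP[h1 h2].
have s1 x : `|u x| <= sup (absolute_values u) by apply: ub_le_sup => //; exists x.
have s2 r : hoelder_quotients a u r -> r <= sup (hoelder_quotients a u).
  by move=> ur; exact: ub_le_sup.
have p1 : 0 <= sup (absolute_values u) by apply: le_trans (s1 point).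
have p2 : 0 <= sup (hoelder_quotients a u).
  have [->|/set0P[r ur]] := eqVneq (hoelder_quotients a u) set0; first by rewrite sup0.
  apply: le_trans (s2 _ ur); case: ur => z _ <-.
  by rewrite divr_ge0// powR_ge0.
split; first by rewrite addr_ge0.
  by move=> x; rewrite (le_trans (s1 x))// lerDl.
move=> x y; have [->|xy] := eqVneq x y.
  by rewrite subrr normr0 mulr_ge0 ?powR_ge0// addr_ge0.
have d0 : 0 < mdist x y by rewrite mdist_gt0.
rewrite -ler_pdivrMr ?powR_gt0// (le_trans (s2 _ _))//; last by rewrite lerDr.
by exists (x, y) => //=; exact/eqP.
Qed.

Lemma compact_net (e : R) : 0 < e ->
  exists (m : nat) (D : nat -> X), forall x, exists2 i, (i < m)%N & mdist x (D i) < e.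
Proof.
move=> e0; have [D [_ dD]] := @compact_dense_seq _ _ cX setT (ex_intro _ point I).
apply: contrapT => no.
have /choice[xs xsP] : forall m, exists x, forall i, (i < m)%N -> e <= mdist x (D i).
  move=> m; apply: contrapT => h; apply: no; exists m, D => x.
  apply: contrapT => hx; apply: h; exists x => i im.
  by rewrite leNgt; apply/negP => xi; apply: hx; exists i.
have [x _ xsx] := compact_natU cX (fun N => I : [set: X] (xs N)).
have e2 : 0 < e / 2 by rewrite divr_gt0.
have [i xi] := dD x I _ e2.
have : \forall N \near natU, False.
  near=> N.
  have h1 : mdist x (xs N) < e / 2.
    by near: N; move/mdist_cvgP : xsx; apply.
  have h2 : e <= mdist (xs N) (D i).
    by apply: xsP; near: N; exact: natU_ge.
  have := metric_triangle (xs N) x (D i); rewrite (metric_sym (xs N) x); lra.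
by case/filter_ex.
Unshelve. all: by end_near. Qed.

Hypothesis a_le1 : a <= 1.

(* [chi i = h i.+1 - h i], where [h i] is the sum of the first [i] bumps
   truncated at 1: telescoping avoids dividing by the sum of the bumps. *)
Lemma holder_partition (e : R) : 0 < e ->
  exists (m : nat) (D : nat -> X) (chi : nat -> X -> R),
  [/\ forall i, holder_class a (chi i), forall i x, 0 <= chi i x,
      forall x, \sum_(i < m) chi i x = 1 &
      forall i x, chi i x != 0 -> mdist x (D i) <= e].
Proof.
move=> e0; have e2 : 0 < e / 2 by rewrite divr_gt0.
have [m [D Dnet]] := compact_net e2; exists m, D.
pose g i x : R := e - Num.min e (mdist (D i) x).
have g_class i : holder_class a (g i).
  have -> : g i = (fun x => e + -1 * Num.min e (mdist (D i) x)).
    by apply/funext => x; rewrite mulN1r.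
  apply: holder_classD; first exact: holder_class_cst.
  apply: holder_classZ; apply: holder_class_min.
  by apply: (lipschitz_holder cX _ (@mdist_lip _ _ (D i))); rewrite a_gt0.
have g_ge0 i x : 0 <= g i x by rewrite subr_ge0 ge_min lexx.
(* Every point is within [e / 2] of some [D i], where the bump [g i] is at least [e / 2]; the factor
   [2 / e] makes the full sum reach the truncation level 1. *)
pose h i x : R := Num.min 1 (2 / e * \sum_(j < i) g j x).
exists (fun i x => h i.+1 x - h i x); split.
- move=> i; have h_class j : holder_class a (h j).
    by apply: holder_class_min; apply: holder_classZ; exact: holder_class_sum.
  rewrite (_ : (fun x => _) = (fun x => h i.+1 x + -1 * h i x)).
    by apply: holder_classD => //; exact: holder_classZ.
  by apply/funext => x; rewrite mulN1r.
- move=> i x; rewrite subr_ge0 /h le_min !ge_min lexx/=; apply/orP; right.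
  by rewrite ler_wpM2l ?divr_ge0 ?(ltW e0)// big_ord_recr/= lerDl.
- move=> x; rewrite -(big_mkord xpredT (fun i => h i.+1 x - h i x)).
  rewrite (telescope_sumr (h ^~ x))// /h big_ord0 mulr0.
  have [i im xi] := Dnet x.
  have -> : Num.min 1 0 = 0 :> R by apply/min_idPr.
  rewrite subr0; apply/min_idPl.
  apply: (@le_trans _ _ (2 / e * g i x)).
    rewrite -ler_pdivrMl ?divr_gt0// mulr1 invf_div /g metric_sym.
    by rewrite lerBrDl -lerBrDr ge_min; apply/orP; right; rewrite (le_trans (ltW xi))//; lra.
  rewrite ler_wpM2l ?divr_ge0 ?(ltW e0)// (bigD1 (Ordinal im))//= lerDl.
  by rewrite sumr_ge0.
- move=> i x; apply: contraR; rewrite -ltNge => xe.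
  have g0 : g i x = 0.
    by rewrite /g metric_sym (min_idPl (ltW xe)) subrr.
  by rewrite /h big_ord_recr/= g0 addr0 subrr.
Qed.

End hoelder_space_theory.

(** * Powers of complex numbers, maxima and Urysohn functions *)

Lemma geometric_le (R : realType) (c q D : R) : 0 <= c -> 0 <= q < 1 -> 0 < D ->
  exists k, q ^+ k * c <= D.
Proof.
move=> c0 /andP[q0 q1] D0; have := @cvg_geometric R c q.
rewrite ger0_norm// => /(_ q1)/cvgrPdist_le/(_ _ D0)[k _ /(_ k (leqnn k))] /=.
rewrite sub0r normrN ger0_norm; last by rewrite mulr_ge0// exprn_ge0.
by rewrite mulrC; exists k.
Qed.

Lemma max_geometric_step (R : realType) (q C D : R) k : 0 <= q <= 1 -> 0 <= D ->
  Num.max (q * Num.max (q ^+ k * C) D) D <= Num.max (q ^+ k.+1 * C) D.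
Proof.
move=> /andP[q0 q1] D0; rewrite ge_max [X in _ && X]le_max lexx orbT andbT.
rewrite maxr_pMr// ge_max mulrA -exprS !le_max lexx/=.
by apply/orP; right; rewrite ler_piMl.
Qed.

Lemma compact_maximum (R : realType) (X : pmetricType R) (u : X -> R) :
  compact [set: X] -> continuous u -> exists x, forall y, u y <= u x.
Proof.
move=> cX cu.
have hs : has_sup (range u).
  apply: compact_has_sup; first by exists (u point), point.
  exact: continuous_compact (continuous_subspaceT cu) cX.
have /choice[xs xsP] : forall n : nat, exists x, sup (range u) - n.+1%:R^-1 < u x.
  move=> n; have n0 : 0 < n.+1%:R^-1 :> R by rewrite invr_gt0.
  by have [_ [x _ <-] h] := sup_adherent n0 hs; exists x.
have [x _ xsx] := compact_natU cX (fun N => I : [set: X] (xs N)).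
exists x => y.
have ux : u (xs n) @[n --> natU] --> u x by apply: continuous_cvg => //; exact: cu.
have s0 : sup (range u) - (n.+1%:R^-1 : R) @[n --> natU] --> sup (range u).
  rewrite -[X in _ --> X]subr0; apply: cvgB; first exact: cvg_cst.
  by apply: cvg_natU; exact: cvg_harmonic.
apply: (@le_trans _ _ (sup (range u))); first by apply: ub_le_sup; [exact: hs.2|exists y].
by apply: (ler_cvg_to s0 ux); apply: nearW => n; exact/ltW.
Qed.

Section complex_modulus.
Context {R : realType}.
Local Open Scope complex_scope.
Import ComplexField.Normc.
Implicit Types z w : R[i].

Lemma normc_ge0 z : 0 <= normc z.
Proof. by case: z => x y; exact: sqrtr_ge0. Qed.

Lemma normc_sqr z : normc z ^+ 2 = complex.Re z ^+ 2 + complex.Im z ^+ 2.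
Proof. by case: z => x y /=; rewrite sqr_sqrtr// addr_ge0// sqr_ge0. Qed.

Lemma normc_le_ReIm z : normc z <= `|complex.Re z| + `|complex.Im z|.
Proof.
rewrite -(@ler_pXn2r _ 2)// ?nnegrE ?normc_ge0 ?addr_ge0//.
rewrite normc_sqr sqrrD !real_normK ?num_real// -addrA lerD2l addrC lerDl.
by rewrite mulrn_wge0// mulr_ge0.
Qed.

Lemma norm_eq1_normc z : `|z| = 1 -> normc z = 1.
Proof. by move=> z1; apply: complexI; rewrite -[RHS]z1. Qed.

Lemma normcX z n : normc (z ^+ n) = normc z ^+ n.
Proof. by elim: n => [|n ih]; [exact: normc1|rewrite !exprS normcM ih]. Qed.

(** If [w = z ^+ k] stays within [1 / 2] of 1, then [w + 1] has modulus at least [3 / 2]. As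
    [w ^+ 2 - 1 = (w - 1) * (w + 1)], repeated squaring multiplies the distance to 1 by at least
    [3 / 2], which stays bounded only when it vanishes. *)
Lemma powers_close_to1 z : (forall k, normc (z ^+ k - 1) <= 2^-1) -> z = 1.
Proof.
move=> zk; apply: contrapT => /eqP z1.
pose t := normc (z - 1).
have t0 : 0 < t.
  rewrite lt_def normc_ge0 andbT; apply: contra_neq z1 => /eq0_normc/eqP.
  by rewrite subr_eq0 => /eqP.
have grow j : (3 / 2) ^+ j * t <= normc (z ^+ (2 ^ j) - 1).
  elim: j => [|j ih]; first by rewrite expn0 mul1r.
  have -> : z ^+ (2 ^ j.+1) - 1 = (z ^+ (2 ^ j) - 1) * (z ^+ (2 ^ j) + 1).
    by rewrite expnSr exprM; ring.
  rewrite normcM exprSr mulrAC ler_pM ?mulr_ge0 ?exprn_ge0 ?divr_ge0 ?(ltW t0)//.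
  have : normc (2 : R[i]) <= normc (z ^+ (2 ^ j) + 1) + normc (- (z ^+ (2 ^ j) - 1)).
    have -> : (2 : R[i]) = (z ^+ (2 ^ j) + 1) + - (z ^+ (2 ^ j) - 1) by ring.
    exact: le_normcD.
  have -> : normc (2 : R[i]) = 2.
    by rewrite -[X in normc X]/(1 *+ 2) normcMn normc1.
  by rewrite normcN; have := zk (2 ^ j)%N; lra.
have [k] := @geometric_le R 1 (2 / 3) t ler01 ltac:(apply/andP; split; lra) t0.
rewrite mulr1 => kt.
have := le_trans (grow k) (zk _).
have p0 : 0 < (3 / 2 : R) ^+ k by rewrite exprn_gt0.
have : (3 / 2) ^+ k * (2 / 3) ^+ k <= (3 / 2) ^+ k * t by rewrite ler_wpM2l// ltW.
rewrite -exprMn (_ : 3 / 2 * (2 / 3) = 1 :> R); last by field.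
by rewrite expr1n; lra.
Qed.

End complex_modulus.

Section holder_complements.
Context {R : realType} {X : pmetricType R}.
Hypothesis cX : compact [set: X].
Variable a : R.
Hypothesis a_gt0 : 0 < a.

Lemma holder_class_comp (L : R) (g : X -> X) (u : X -> R) : 0 <= L ->
  lipschitz_map L g -> holder_class a u -> holder_class a (u \o g).
Proof.
move=> L0 gL [C C0 hu]; exists (C * L `^ a); first by rewrite mulr_ge0// powR_ge0.
move=> x y; apply: (le_trans (hu _ _)); rewrite -mulrA ler_wpM2l//.
rewrite -powRM ?mdist_ge0//.
by rewrite ge0_ler_powR ?nnegrE ?mdist_ge0 ?(ltW a_gt0)// mulr_ge0// mdist_ge0.
Qed.

Lemma holder_class_dense0 (D : nat -> X) (u : X -> R) x : holder_class a u ->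
  (forall i, u (D i) = 0) ->
  (forall e : R, 0 < e -> exists i, mdist x (D i) < e) -> u x = 0.
Proof.
move=> hu uD dD.
have /choice[s sP] : forall n : nat, exists i, mdist x (D i) < n.+1%:R^-1.
  by move=> n; apply: dD; rewrite invr_gt0.
have sx : D (s n) @[n --> \oo] --> x.
  apply/mdist_cvgP => e e0; near=> n; apply: (lt_trans (sP n)).
  near: n; exact: (near_infty_natSinv_lt (PosNum e0)).
have ux : u (D (s n)) @[n --> \oo] --> u x.
  by apply: continuous_cvg => //; exact: (holder_class_continuous a_gt0 hu).
have /cvg_lim <- // := ux.
by under [X in lim (X @ _)]funext do rewrite uD; rewrite lim_cst.
Unshelve. all: by end_near. Qed.

Lemma holder_classM (u v : X -> R) : holder_class a u -> holder_class a v ->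
  holder_class a (fun x => u x * v x).
Proof.
move=> hu hv; have [M uM] := holder_class_bounded cX a_gt0 hu.
have [N vN] := holder_class_bounded cX a_gt0 hv.
case: hu hv => C C0 hu [D D0 hv].
have M0 : 0 <= M := le_trans (normr_ge0 _) (uM point).
have N0 : 0 <= N := le_trans (normr_ge0 _) (vN point).
exists (M * D + C * N); first by rewrite addr_ge0// mulr_ge0.
move=> x y.
have -> : u x * v x - u y * v y = u x * (v x - v y) + (u x - u y) * v y by ring.
rewrite [leRHS]mulrDl; apply: (le_trans (ler_normD _ _)); rewrite !normrM lerD//.
  by rewrite -mulrA ler_pM.
by rewrite mulrAC ler_pM.
Qed.

End holder_complements.

Lemma probability_ae_ex d (T : measurableType d) (R : realType)
    (P : probability T R) (Q : T -> Prop) :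
  {ae P, forall t, Q t} -> exists t, Q t.
Proof.
move=> [N [mN N0 sN]]; apply: contrapT => no.
have NT : N = setT by apply/seteqP; split => // t _; apply: sN => Qt; apply: no; exists t.
have := @probability_setT _ _ _ P; rewrite -NT N0.
by case=> /esym/eqP; rewrite oner_eq0.
Qed.

(** By compactness the distance to [Z] is bounded below on [Y], so a sufficiently steep ramp of the
    complement of [Z] has reached 1 on all of [Y]. *)
Lemma lipschitz_urysohn (R : realType) (X : pmetricType R) (Y Z : set X) :
  compact [set: X] -> closed Y -> closed Z -> Y `&` Z = set0 ->
  exists k (u : X -> R), [/\ lipschitz_real k u,
    forall x, Y x -> u x = 1 & forall x, Z x -> u x = 0].
Proof.
move=> cX clY clZ YZ0; pose U := ~` Z.
have oU : open U by rewrite openC.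
have [N NP] : exists N : nat, forall x, Y x -> 1 <= N%:R * capdist U x.
  apply: contrapT => no.
  have /choice[xs xsP] : forall n : nat, exists x, Y x /\ n%:R * capdist U x < 1.
    move=> n; apply: contrapT => h; apply: no; exists n => x Yx.
    by rewrite leNgt; apply/negP => ?; apply: h; exists x.
  have cY : compact Y by exact: (subclosed_compact clY cX).
  have [x Yx xsx] := compact_natU cY (fun n => (xsP n).1).
  have Ux : U x by move=> Zx; have : (Y `&` Z) x by []; rewrite YZ0.
  have c0 := capdist_gt0 oU Ux.
  have cx : capdist U (xs n) @[n --> natU] --> capdist U x.
    apply: continuous_cvg => //; exact: (lipschitz_continuous (@capdist_lip _ _ U)).
  have c02 : 0 < capdist U x / 2 by rewrite divr_gt0.
  have : \forall n \near natU, False.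
    near=> n.
    have h1 : `|capdist U x - capdist U (xs n)| < capdist U x / 2.
      by near: n; move/cvgrPdist_lt : cx; apply.
    have h2 : (Num.truncn (capdist U x / 2)^-1).+1%:R <= n%:R :> R.
      by rewrite ler_nat; near: n; exact: natU_ge.
    have h3 : (capdist U x / 2)^-1 < (Num.truncn (capdist U x / 2)^-1).+1%:R.
      exact: truncnS_gt.
    have h4 : (capdist U x / 2)^-1 <= n%:R by lra.
    have h5 : capdist U x / 2 <= capdist U (xs n).
      by have := ler_norm (capdist U x - capdist U (xs n)); lra.
    have : (capdist U x / 2)^-1 * (capdist U x / 2) <= n%:R * capdist U (xs n).
      by rewrite ler_pM ?invr_ge0 ?(ltW c02).
    by rewrite mulVf ?gt_eqF// leNgt (xsP n).2.
  by case/filter_ex.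
exists N%:R, (ramp U N); split; first exact: ramp_lip.
- by move=> x Yx; rewrite /ramp; apply/min_idPl; exact: NP.
- by move=> x Zx; apply: ramp_notin => /(_ Zx).
Unshelve. all: by end_near. Qed.

(** * Random maps with Lipschitz constants of finite moment *)

Section lipschitz_random_map.
Context {R : realType} {X : pmetricType R} {d : measure_display}
  {T : measurableType d}.
Local Notation S := (bernoulli_space T).
Variables (Pr : probability S R) (f : S -> X -> X).
Local Notation P := (koopman Pr f).

Lemma fiterSr n w : fiter f n.+1 w = fiter f n (Defs.shift w) \o f w.
Proof.
elim: n w => [|n ih] w; first by [].
have -> : fiter f n.+2 w = f (iter n.+1 Defs.shift w) \o fiter f n.+1 w by [].
by rewrite ih iterSr.
Qed.

Lemma measurable_iter_shift n : measurable_fun setT (iter n (@Defs.shift d T)).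
Proof.
elim: n => [|n ih]; first exact: measurable_id.
exact: (measurableT_comp (@measurable_shift d T) ih).
Qed.

Hypothesis cX : compact [set: X].
Hypothesis mf : measurable_fun setT (fun z : S * borel X => (f z.1 z.2 : borel X)).
(** Independence and invariance under the shift enter this section only through this property. *)
Hypothesis fmarkov : forall H : S * borel X -> \bar R, measurable_fun setT H ->
  (forall z, 0 <= H z)%E -> forall x,
  (\int[Pr]_w H (Defs.shift w, f w x) = \int[Pr]_w \int[Pr]_w' H (w', f w x))%E.

Lemma measurable_fiter n :
  measurable_fun setT (fun z : S * borel X => (fiter f n z.1 z.2 : borel X)).
Proof.
elim: n => [|n ih]; first exact: measurable_snd.
have h : measurable_fun setT
    (fun z : S * borel X => (iter n Defs.shift z.1, fiter f n z.1 z.2 : borel X)).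
  apply: measurable_fun_pair => //.
  exact: (measurableT_comp (@measurable_iter_shift n) measurable_fst).
exact: (measurableT_comp mf h).
Qed.

Lemma measurable_fiter_shift n : measurable_fun setT
  (fun z : S * borel X => (iter n Defs.shift z.1, fiter f n z.1 z.2 : borel X)).
Proof.
apply: measurable_fun_pair; last exact: measurable_fiter.
exact: (measurableT_comp (@measurable_iter_shift n) measurable_fst).
Qed.

Lemma measurable_fiter1 n x :
  measurable_fun setT (fun w : S => (fiter f n w x : borel X)).
Proof. exact: (measurableT_comp (@measurable_fiter n) (pair2_measurable (x : borel X))). Qed.

(** The Markov property after [n] steps. The induction peels off the first map, so the one-step
    property is used twice: to separate the first step and to reassemble the iterate. *)
Lemma ge0_integral_fiter n (H : S * borel X -> \bar R) : measurable_fun setT H ->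
  (forall z, 0 <= H z)%E -> forall x,
  (\int[Pr]_w H (iter n Defs.shift w, fiter f n w x) =
   \int[Pr]_w \int[Pr]_w' H (w', fiter f n w x))%E.
Proof.
move=> mH H0; elim: n => [|n ih] x.
  by rewrite /= integral_probability_cst.
transitivity (\int[Pr]_w H (iter n Defs.shift (Defs.shift w),
    fiter f n (Defs.shift w) (f w x)))%E.
  by apply: eq_integral => w _; rewrite fiterSr -iterSr.
rewrite (fmarkov (H := fun z => H (iter n Defs.shift z.1, fiter f n z.1 z.2)))//; last first.
  by apply: (measurableT_comp mH); exact: measurable_fiter_shift.
transitivity (\int[Pr]_w \int[Pr]_w' \int[Pr]_w'' H (w'', fiter f n w' (f w x)))%E.
  by apply: eq_integral => w _; rewrite ih.
transitivity (\int[Pr]_w \int[Pr]_w'' H (w'', fiter f n (Defs.shift w) (f w x)))%E.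
  rewrite (fmarkov (H := fun z => \int[Pr]_w'' H (w'', fiter f n z.1 z.2))%E)//.
    apply: (measurableT_comp (f := fun y => \int[Pr]_w'' H (w'', y))%E).
      exact: (measurable_fun_fubini_tonelli_G H).
    exact: measurable_fiter.
  by move=> z; exact: integral_ge0.
by apply: eq_integral => w _; rewrite fiterSr.
Qed.

Lemma Rintegral_fiter n (H : S * borel X -> R) (M : R) : measurable_fun setT H ->
  (forall z, `|H z| <= M) -> forall x,
  \int[Pr]_w H (iter n Defs.shift w, fiter f n w x) =
  \int[Pr]_w \int[Pr]_w' H (w', fiter f n w x).
Proof.
move=> mH HM x.
(* Adding the bound [M] reduces to the nonnegative case, where Tonelli also provides the
   measurability of the inner integral. *)
pose H' z := (H z + M)%:E.
have H'0 z : (0 <= H' z)%E.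
  by rewrite lee_fin; have := HM z; rewrite ler_norml => /andP[]; lra.
have mH' : measurable_fun setT H'.
  by apply/measurable_EFinP; exact: measurable_funD.
have icM (g : S -> R) : Pr.-integrable setT (EFin \o g) ->
    (\int[Pr]_w (g w + M)%:E)%E = (\int[Pr]_w g w + M)%:E.
  move=> ig; rewrite EFin_Rintegral; last first.
    by apply: integrable_addr => //; exact: probability_integrable_cst.
  rewrite RintegralD//; last exact: probability_integrable_cst.
  by rewrite Rintegral_probability_cst.
have ib g : measurable_fun setT g -> Pr.-integrable setT (EFin \o (fun w : S => H (g w))).
  by move=> mg; apply: (@bounded_integrable _ _ _ _ _ M) => //; exact: measurableT_comp.
have := ge0_integral_fiter n mH' H'0 x.
rewrite {1}/H' icM; last first.
  apply: (ib (fun w => (iter n Defs.shift w, fiter f n w x))).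
  exact: (measurableT_comp (@measurable_fiter_shift n) (pair2_measurable (x : borel X))).
under eq_integral => w _.
  rewrite /H' icM; last by apply: (ib (fun w' => (w', fiter f n w x))); exact: pair2_measurable.
  over.
rewrite icM; first by move=> [] /addIr.
apply: (@bounded_integrable _ _ _ _ _ M); last first.
  move=> w; rewrite (le_trans (le_normr_Rintegral _ _))//.
    by apply: (ib (fun w' => (w', fiter f n w x))); exact: pair2_measurable.
  apply: Rintegral_le_cst => //.
  apply: integrable_normr; apply: (ib (fun w' => (w', fiter f n w x))).
  exact: pair2_measurable.
have -> : (fun w => \int[Pr]_w' H (w', fiter f n w x)) =
   (fun w => fine (\int[Pr]_w' H' (w', fiter f n w x)) - M).
  apply/funext => w; rewrite /H' icM ?addrK//.
  by apply: (ib (fun w' => (w', fiter f n w x))); exact: pair2_measurable.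
apply: measurable_funB => //; apply: measurableT_comp => //.
apply: (measurableT_comp (f := fun y => \int[Pr]_w'' H' (w'', y))%E).
  exact: (measurable_fun_fubini_tonelli_G H').
exact: measurable_fiter1.
Qed.

Variables (Lw : S -> R) (beta : R).
Hypothesis mLw : measurable_fun setT Lw.
Hypothesis Lw_ge1 : forall w, 1 <= Lw w.
Hypothesis Lw_lip : forall w x y, mdist (f w x) (f w y) <= Lw w * mdist x y.
Hypothesis beta_gt0 : 0 < beta.
Hypothesis Lw_beta : (\int[Pr]_w (Lw w `^ beta)%:E < +oo)%E.

(** * The Koopman operator on Hoelder functions and stationary measures *)

Section holder_exponent.
Variable a : R.
Hypothesis a_gt0 : 0 < a.
Hypothesis a_beta : a <= beta.

Definition lip_moment : R := \int[Pr]_w (Lw w `^ a).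

Lemma Lw_powR_integrable : Pr.-integrable setT (EFin \o (fun w => Lw w `^ a)).
Proof.
have mp b : measurable_fun setT (fun w => Lw w `^ b).
  exact: (measurableT_comp (measurable_powR b) mLw).
apply: (@le_integrable _ _ _ _ _ _ _ (EFin \o (fun w => Lw w `^ beta))) => //.
- exact/measurable_EFinP.
- move=> w _; rewrite lee_fin !ger0_norm ?powR_ge0//.
  by apply: ler_powR.
apply/integrableP; split; first exact/measurable_EFinP.
rewrite (le_lt_trans _ Lw_beta)//; apply: ge0_le_integral_nomeas => w //=.
by rewrite lee_fin ger0_norm// powR_ge0.
Qed.

Lemma lip_moment_ge1 : 1 <= lip_moment.
Proof.
apply: Rintegral_ge_cst; first exact: Lw_powR_integrable.
by move=> w; rewrite -[leLHS](powRr0 (Lw w)) ler_powR// ltW.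
Qed.

Lemma koopman_integrable n u x : holder_class a u ->
  Pr.-integrable setT (EFin \o (fun w => u (fiter f n w x))).
Proof.
move=> hu; have [M uM] := holder_class_bounded cX a_gt0 hu.
apply: (@bounded_integrable _ _ _ _ _ M) => //.
exact: (measurableT_comp (holder_class_borel a_gt0 hu) (measurable_fiter1 n x)).
Qed.

Lemma koopman_integrable1 u x : holder_class a u ->
  Pr.-integrable setT (EFin \o (fun w => u (f w x))).
Proof. exact: (koopman_integrable 1). Qed.

Lemma holder_koopman C u : 0 <= C -> holder a C u -> holder a (C * lip_moment) (P u).
Proof.
move=> C0 hu x y; have Hu : holder_class a u by exists C.
rewrite /koopman -RintegralB//; [|exact: koopman_integrable1|exact: koopman_integrable1].
have iB : Pr.-integrable setT (EFin \o (fun w => u (f w x) - u (f w y))).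
  by apply: integrable_subr; exact: koopman_integrable1.
rewrite (le_trans (le_normr_Rintegral _ iB))//.
have iL := Lw_powR_integrable.
rewrite (_ : C * _ * _ = \int[Pr]_w ((C * mdist x y `^ a) * (Lw w `^ a))); last first.
  by rewrite RintegralZl// mulrAC.
apply: le_Rintegral => //.
- exact: integrable_normr.
- exact: integrable_mulrl.
move=> w _; rewrite (le_trans (hu _ _))// -mulrA ler_wpM2l// mulrC -powRM ?mdist_ge0//.
  by apply: ge0_ler_powR; rewrite ?nnegrE ?(ltW a_gt0) ?mdist_ge0 ?mulr_ge0
    ?mdist_ge0 ?(le_trans ler01 (Lw_ge1 w)).
by rewrite (le_trans ler01).
Qed.

Lemma holder_class_koopman u : holder_class a u -> holder_class a (P u).
Proof.
move=> [C C0 hu]; exists (C * lip_moment); last exact: holder_koopman.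
by rewrite mulr_ge0// (le_trans ler01)// lip_moment_ge1.
Qed.

Lemma holder_class_iter_koopman n u : holder_class a u -> holder_class a (iter n P u).
Proof. by move=> hu; elim: n => // n ih; exact: holder_class_koopman. Qed.

Lemma koopmanD u v : holder_class a u -> holder_class a v ->
  P (fun x => u x + v x) = (fun x => P u x + P v x).
Proof.
by move=> hu hv; apply/funext => x; rewrite /koopman RintegralD//;
  exact: koopman_integrable1.
Qed.

Lemma koopmanZ c u : holder_class a u -> P (fun x => c * u x) = (fun x => c * P u x).
Proof.
by move=> hu; apply/funext => x; rewrite /koopman RintegralZl//;
  exact: koopman_integrable1.
Qed.

Lemma koopman_cst c : P (fun=> c) = (fun=> c).
Proof. by apply/funext => x; rewrite /koopman Rintegral_probability_cst. Qed.

Lemma koopman_le u v : holder_class a u -> holder_class a v ->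
  (forall x, u x <= v x) -> forall x, P u x <= P v x.
Proof.
by move=> hu hv uv x; apply: le_Rintegral => //; exact: koopman_integrable1.
Qed.

Lemma iter_koopmanD n u v : holder_class a u -> holder_class a v ->
  iter n P (fun x => u x + v x) = (fun x => iter n P u x + iter n P v x).
Proof.
move=> hu hv; elim: n => // n ih.
by rewrite iterS ih koopmanD//; exact: holder_class_iter_koopman.
Qed.

Lemma iter_koopmanZ n c u : holder_class a u ->
  iter n P (fun x => c * u x) = (fun x => c * iter n P u x).
Proof.
move=> hu; elim: n => // n ih.
by rewrite iterS ih koopmanZ//; exact: holder_class_iter_koopman.
Qed.

Lemma iter_koopman_cst n c : iter n P (fun=> c) = (fun=> c).
Proof. by elim: n => // n ih; rewrite iterS ih koopman_cst. Qed.

Lemma iter_koopman_sum n (I : Type) (s : seq I) (F : I -> X -> R) :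
  (forall i, holder_class a (F i)) ->
  iter n P (fun x => \sum_(i <- s) F i x) = (fun x => \sum_(i <- s) iter n P (F i) x).
Proof.
move=> hF; elim: s => [|i s ih].
  transitivity (fun _ : X => 0 : R); last by apply/funext => x; rewrite big_nil.
  rewrite -(iter_koopman_cst n 0); congr (iter n P _).
  by apply/funext => x; rewrite big_nil.
transitivity (iter n P (fun x => F i x + \sum_(j <- s) F j x)).
  by congr (iter n P _); apply/funext => x; rewrite big_cons.
rewrite iter_koopmanD//; last exact: holder_class_sum.
by rewrite ih; apply/funext => x; rewrite big_cons.
Qed.

Lemma iter_koopman_le n u v : holder_class a u -> holder_class a v ->
  (forall x, u x <= v x) -> forall x, iter n P u x <= iter n P v x.
Proof.
move=> hu hv uv; elim: n => // n ih x.
by rewrite !iterS; apply: koopman_le => //; exact: holder_class_iter_koopman.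
Qed.

Lemma iter_koopman_bound n u (M : R) : holder_class a u ->
  (forall x, `|u x| <= M) -> forall x, `|iter n P u x| <= M.
Proof.
move=> hu uM x; rewrite ler_norml; apply/andP; split.
  have := @iter_koopman_le n (fun=> - M) u (holder_class_cst a (- M)) hu _ x.
  rewrite iter_koopman_cst; apply => y.
  by have := uM y; rewrite ler_norml => /andP[].
have := @iter_koopman_le n u (fun=> M) hu (holder_class_cst a M) _ x.
rewrite iter_koopman_cst; apply => y.
by have := uM y; rewrite ler_norml => /andP[].
Qed.

Lemma iter_koopmanE n u x : holder_class a u ->
  iter n P u x = \int[Pr]_w u (fiter f n w x).
Proof.
move=> hu; have [M uM] := holder_class_bounded cX a_gt0 hu.
have mu := holder_class_borel a_gt0 hu.
elim: n x => [|n ih] x; first by rewrite /= Rintegral_probability_cst.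
transitivity (\int[Pr]_w \int[Pr]_w' u (fiter f n w' (f w x))).
  by rewrite iterS /koopman; apply: eq_Rintegral => w _; rewrite ih.
rewrite -(@Rintegral_fiter 1 (fun z => u (fiter f n z.1 z.2)) M)//; last first.
  exact: (measurableT_comp mu (@measurable_fiter n)).
by apply: eq_Rintegral => w _; rewrite [in RHS]fiterSr.
Qed.

(** The law of [f w x] for independent [w] and [x]: one step of the Markov chain, dual to the
    Koopman operator. *)
Let mu_step (mu : probability (borel X) R) : {measure set (borel X) -> \bar R} :=
  pushforward_measure (Pr \x mu)%E mf.

Let measurable_skew : measurable_fun setT (Defs.skew f).
Proof.
apply: (measurable_fun_pair (f := fun z : S * borel X => Defs.shift z.1)) => //.
exact: (measurableT_comp (@measurable_shift d T) measurable_fst).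
Qed.

Lemma stationary_of_invariant (mu : probability (borel X) R) :
  (forall B : set (borel X), measurable B -> mu_step mu B = mu B) ->
  stationary Pr f mu.
Proof.
move=> inv A mA.
have mA' : measurable (Defs.skew f @^-1` A).
  by rewrite -[X in measurable X]setTI; exact: measurable_skew.
pose H z : \bar R := (\1_A z)%:E.
have mH : measurable_fun setT H.
  by apply/measurable_EFinP; exact: measurable_indic.
have H0 z : (0 <= H z)%E by rewrite lee_fin indicE.
have mG : measurable_fun setT (fun y => \int[Pr]_w' H (w', y))%E.
  exact: (measurable_fun_fubini_tonelli_G H).
have -> : (Pr \x mu)%E A = (\int[mu]_x \int[Pr]_w H (w, x))%E.
  rewrite -(fubini_tonelli2 H)//.
  by rewrite integral_indic// setIT.
have -> : (Pr \x mu)%E (Defs.skew f @^-1` A) =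
    (\int[mu]_x \int[Pr]_w H (Defs.shift w, f w x))%E.
  rewrite -(fubini_tonelli2 (fun z => H (Defs.skew f z)))//; last first.
    exact: (measurableT_comp mH measurable_skew).
  have -> : (fun z => H (Defs.skew f z)) = (fun z => (\1_(Defs.skew f @^-1` A) z)%:E).
    by apply/funext => z; rewrite /H !indicE.
  by rewrite integral_indic// setIT.
under eq_integral do rewrite fmarkov//.
rewrite -(fubini_tonelli2 (fun z : S * borel X => \int[Pr]_w' H (w', f z.1 z.2))%E); last 2 first.
- exact: (measurableT_comp mG mf).
- by move=> z; exact: integral_ge0.
rewrite -(ge0_integral_pushforward_measure (Pr \x mu)%E mf
    (g := fun y => \int[Pr]_w' H (w', y))%E)//; last first.
  by move=> y; exact: integral_ge0.
by apply: eq_measure_integral => B mB _; exact: inv.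
Qed.

Lemma invariant_of_stationary (mu : probability (borel X) R) :
  stationary Pr f mu ->
  forall B : set (borel X), measurable B -> mu_step mu B = mu B.
Proof.
move=> st B mB.
rewrite -(product_probability_setT Pr mu mB).
rewrite -(st (setT `*` B) (measurableX measurableT mB)); congr ((Pr \x mu)%E _).
by apply/seteqP; split => [z Bz|z []].
Qed.

Let integral_mu_step (mu : probability (borel X) R) u : holder_class a u ->
  (forall x, 0 <= u x) ->
  (\int[mu_step mu]_x (u x)%:E = \int[mu]_x (P u x)%:E)%E.
Proof.
move=> hu u0.
have mEu : measurable_fun setT (EFin \o (u : borel X -> R)).
  by apply/measurable_EFinP; exact: holder_class_borel hu.
rewrite /mu_step (ge0_integral_pushforward_measure _ _
  (g := fun y : borel X => (u y)%:E))//.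
rewrite (fubini_tonelli2 (fun z : S * borel X => (u (f z.1 z.2))%:E)); last 2 first.
- exact: (measurableT_comp mEu mf).
- by move=> z; rewrite lee_fin.
apply: eq_integral => x _; rewrite -EFin_Rintegral//.
exact: koopman_integrable1.
Qed.

Lemma holder_integrable (mu : probability (borel X) R) u : holder_class a u ->
  mu.-integrable setT (EFin \o u).
Proof.
move=> hu; have [M uM] := holder_class_bounded cX a_gt0 hu.
apply: (@bounded_integrable _ (borel X) _ mu u M) => //.
exact: holder_class_borel hu.
Qed.

Hypothesis a_le1 : a <= 1.

(** Stationarity becomes duality with the Koopman operator on a class containing the Lipschitz
    functions, which determine a Borel measure. Adding a bound [M] makes the functions nonnegative,
    as Tonelli requires. *)
Lemma stationaryP (mu : probability (borel X) R) : stationary Pr f mu <->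
  forall u, holder_class a u -> \int[mu]_x P u x = \int[mu]_x u x.
Proof.
split=> [/invariant_of_stationary inv u hu|inv].
  have [M uM] := holder_class_bounded cX a_gt0 hu.
  have huM : holder_class a (fun x => u x + M).
    by apply: holder_classD => //; exact: holder_class_cst.
  have h : (\int[mu]_x (P (fun x => u x + M) x)%:E = \int[mu]_x (u x + M)%:E)%E.
    rewrite -(integral_mu_step mu huM).
      by apply: eq_measure_integral => B mB _; exact: inv.
    by move=> x; have := uM x; rewrite ler_norml => /andP[]; lra.
  have := congr1 fine h; rewrite -/(Rintegral _ _ _) -/(Rintegral _ _ _).
  have iD v : holder_class a v -> \int[mu]_x (v x + M) = \int[mu]_x v x + M.
    move=> hv; rewrite RintegralD//.
    - by rewrite Rintegral_probability_cst.
    - exact: holder_integrable.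
    - exact: probability_integrable_cst.
  rewrite koopmanD//; last exact: holder_class_cst.
  rewrite koopman_cst (iD _ hu) (iD _ (holder_class_koopman hu)).
  by move=> /addIr.
apply: stationary_of_invariant.
apply: borel_measure_unique.
  rewrite /mu_step /pushforward_measure/= /pushforward preimage_setT -setXTT.
  rewrite (product_probability_setT Pr mu measurableT).
  apply: (@le_lt_trans _ _ 1%E); last exact: ltry.
  exact: probability_le1.
move=> u k uk u01; have hu : holder_class a u.
  by apply: (lipschitz_holder cX _ uk); rewrite a_gt0.
rewrite (integral_mu_step mu hu); last by move=> x; have /andP[] := u01 x.
rewrite !EFin_Rintegral ?inv//; first exact: holder_integrable.
exact/holder_integrable/holder_class_koopman.
Qed.

(** The starting point may depend on the length [N] of the average; in [average_contraction] it is
    adapted to [N]. *)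
Definition birkhoff (xs : nat -> X) u N : R :=
  N%:R^-1 * \sum_(j < N) iter j P u (xs N).

Let birkhoff_bound xs u M : 0 <= M -> holder_class a u ->
  (forall x, `|u x| <= M) -> forall N, `|birkhoff xs u N| <= M.
Proof.
move=> M0 hu uM N; rewrite /birkhoff normrM ger0_norm ?invr_ge0//.
have [->|N0] := posnP N; first by rewrite invr0 mul0r.
rewrite ler_pdivrMl ?ltr0n// (le_trans (ler_norm_sum _ _ _))//.
apply: (@le_trans _ _ (\sum_(i < N) M)).
  by apply: ler_sum => i _; exact: iter_koopman_bound.
by rewrite sumr_const card_ord mulr_natl.
Qed.

Let birkhoff_cvg xs u : holder_class a u -> cvg (birkhoff xs u N @[N --> natU]).
Proof.
move=> hu; have [M uM] := holder_class_bounded cX a_gt0 hu.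
have M0 : 0 <= M by rewrite (le_trans _ (uM point)).
exact: bounded_natU (birkhoff_bound xs M0 hu uM).
Qed.

Let birkhoff_limit xs u := lim (birkhoff xs u N @[N --> natU]).

Let birkhoff_limitP xs u : holder_class a u ->
  birkhoff xs u N @[N --> natU] --> birkhoff_limit xs u.
Proof. exact: birkhoff_cvg. Qed.

Let birkhoff_riesz xs : exists mu : probability (borel X) R,
  forall u, holder_class a u -> \int[mu]_x u x = birkhoff_limit xs u.
Proof.
have a01 : 0 < a <= 1 by rewrite a_gt0.
have LamP u (hu : holder_class a u) := @birkhoff_limitP xs u hu.
apply: (riesz_representation cX).
- by move=> k u; exact: lipschitz_holder.
- exact: holder_classD.
- exact: holder_classZ.
- exact: holder_class_min.
- by move=> u; exact: holder_class_continuous.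
- by move=> u; exact: holder_class_bounded.
- move=> u v hu hv; apply/cvg_lim => //.
  rewrite (_ : birkhoff xs _ = (fun N => birkhoff xs u N + birkhoff xs v N)).
    by apply: cvgD; exact: LamP.
  apply/funext => N; rewrite /birkhoff -mulrDr -big_split/=; congr (_ * _).
  by apply: eq_bigr => j _; rewrite iter_koopmanD.
- move=> c u hu; apply/cvg_lim => //.
  rewrite (_ : birkhoff xs _ = (fun N => c * birkhoff xs u N)).
    by apply: cvgMr; exact: LamP.
  apply/funext => N; rewrite /birkhoff mulrCA; congr (_ * _); rewrite mulr_sumr.
  by apply: eq_bigr => j _; rewrite iter_koopmanZ.
- move=> u v hu hv uv; apply: ler_cvg_to (LamP _ hu) (LamP _ hv) _.
  apply: filterE => N; rewrite /birkhoff ler_wpM2l ?invr_ge0//.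
  by apply: ler_sum => j _; exact: iter_koopman_le.
- apply/cvg_lim => //; apply: cvg_near_cst; near=> N.
  have N0 : (0 < N)%N by near: N; exact: natU_ge.
  rewrite /birkhoff (eq_bigr (fun=> 1)); last by move=> j _; rewrite iter_koopman_cst.
  by rewrite sumr_const card_ord mulVf// pnatr_eq0 -lt0n.
Unshelve. all: by end_near. Qed.

(** The limit along the ultrafilter is a positive normalised functional, hence a measure. Averages
    of [P u] and of [u] differ by the boundary term [(iter N P u - u) / N], which vanishes in the
    limit. *)
Lemma krylov_bogoliubov (xs : nat -> X) : exists mu : probability (borel X) R,
  stationary Pr f mu /\ forall u, holder_class a u ->
    birkhoff xs u N @[N --> natU] --> \int[mu]_x u x.
Proof.
have [mu muP] := birkhoff_riesz xs; have LamP u (hu : holder_class a u) := @birkhoff_limitP xs u hu.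
exists mu; split; last by move=> u hu; rewrite muP//; exact: LamP.
apply/stationaryP => u hu; have hPu := holder_class_koopman hu.
rewrite !muP//; apply/cvg_lim => //.
have [M uM] := holder_class_bounded cX a_gt0 hu.
have M0 : 0 <= M by rewrite (le_trans _ (uM point)).
rewrite (_ : birkhoff xs (P u) = (fun N => birkhoff xs u N +
    N%:R^-1 * (iter N P u (xs N) - u (xs N)))); last first.
  apply/funext => N; rewrite /birkhoff -mulrDr; congr (_ * _).
  under eq_bigr do rewrite -iterSr.
  rewrite addrA.
  have <- : \sum_(j < N.+1) iter j P u (xs N) =
      \sum_(j < N) iter j P u (xs N) + iter N P u (xs N) by rewrite big_ord_recr.
  by rewrite big_ord_recl/= addrAC subrr add0r.
rewrite -[X in _ --> X]addr0; apply: cvgD; first exact: LamP.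
apply/cvgrPdist_le => e e0; near=> N.
rewrite sub0r normrN normrM ger0_norm ?invr_ge0//.
have N0 : 0 < N%:R :> R by rewrite ltr0n; near: N; exact: natU_ge.
rewrite ler_pdivrMl//; apply: (@le_trans _ _ (M + M)).
  by rewrite (le_trans (ler_normB _ _))// lerD//; exact: iter_koopman_bound.
rewrite -ler_pdivrMr// ltW// (lt_le_trans (truncnS_gt _))// ler_nat.
near: N; exact: natU_ge.
Unshelve. all: by end_near. Qed.

End holder_exponent.

(** * Negative exponents give contraction on average *)

Section negative_exponents.
Definition lip_prod n (w : S) : R := \prod_(i < n) Lw (iter i Defs.shift w).

Lemma lip_prod_ge1 n w : 1 <= lip_prod n w.
Proof.
rewrite /lip_prod; elim/big_rec: _ => // i x _ x1.
by rewrite -[leLHS]mulr1 ler_pM.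
Qed.

Let lip_prod_gt0 n w : 0 < lip_prod n w.
Proof. exact: lt_le_trans (lip_prod_ge1 n w). Qed.

Lemma fiter_lip n w : lipschitz_map (lip_prod n w) (fiter f n w).
Proof.
elim: n => [|n ih]; first by move=> x y; rewrite /lip_prod big_ord0 mul1r.
rewrite /lip_prod big_ord_recr/= mulrC; apply: lipschitz_map_comp => //.
by rewrite (le_trans ler01).
Qed.

Let fiter_lip_ex n w : exists2 L : R, 1 <= L & lipschitz_map L (fiter f n w).
Proof. by exists (lip_prod n w); [exact: lip_prod_ge1|exact: fiter_lip]. Qed.

Let V n k w x : R := log_modulus cX k (fiter f n w) x.

Let measurable_V n k : measurable_fun setT (fun z : S * borel X => V n k z.1 z.2).
Proof.
apply: (measurable_log_modulus cX k (G := fun z : S * borel X => fiter f n z.1)).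
- move=> y; exact: (measurableT_comp (@measurable_fiter1 n y) measurable_fst).
- exact: measurable_snd.
- by move=> z; exact: fiter_lip_ex.
Qed.

Let measurable_V1 n k x : measurable_fun setT (fun w : S => V n k w x).
Proof. exact: (measurableT_comp (@measurable_V n k) (pair2_measurable (x : borel X))). Qed.

Let V_le n k w x : V n k w x <= ln (lip_prod n w).
Proof. exact: log_modulus_le_ln (lip_prod_ge1 n w) (@fiter_lip n w). Qed.

Let V_ge n k w x : - k%:R <= V n k w x.
Proof. exact: log_modulus_ge (lip_prod_ge1 n w) (@fiter_lip n w). Qed.

Let ln_Lw_ge0 w : 0 <= ln (Lw w).
Proof. exact: ln_ge0. Qed.

Let ln_lip_prod n w : ln (lip_prod n w) = \sum_(i < n) ln (Lw (iter i Defs.shift w)).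
Proof.
elim: n => [|n ih]; first by rewrite /lip_prod !big_ord0 ln1.
rewrite big_ord_recr/= -ih /lip_prod big_ord_recr/= lnM//.
  exact: lip_prod_gt0.
exact: lt_le_trans ltr01 _.
Qed.

Lemma integral_iter_shift n (g : S -> R) : measurable_fun setT g ->
  (forall w, 0 <= g w) -> Pr.-integrable setT (EFin \o g) ->
  Pr.-integrable setT (EFin \o (fun w => g (iter n Defs.shift w))) /\
  \int[Pr]_w g (iter n Defs.shift w) = \int[Pr]_w g w.
Proof.
move=> mg g0 ig.
have E : (\int[Pr]_w (g (iter n Defs.shift w))%:E = \int[Pr]_w (g w)%:E)%E.
  rewrite (@ge0_integral_fiter n (fun z => (g z.1)%:E) _ _ point).
  - by rewrite /= integral_probability_cst.
  - by apply/measurable_EFinP; exact: (measurableT_comp mg measurable_fst).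
  - by move=> z; rewrite lee_fin.
split; last by rewrite /Rintegral E.
apply/integrableP; split.
  by apply/measurable_EFinP; exact: (measurableT_comp mg (@measurable_iter_shift n)).
under eq_integral do rewrite gee0_abs ?lee_fin//.
rewrite E; case/integrableP : ig => _; apply: le_lt_trans.
apply: ge0_le_integral_nomeas => w /=; first by rewrite lee_fin.
by rewrite lee_fin ger0_norm.
Qed.

Let Lw_beta_integrable : Pr.-integrable setT (EFin \o (fun w => Lw w `^ beta)).
Proof. exact: Lw_powR_integrable. Qed.

Let measurable_ln_Lw : measurable_fun setT (fun w => ln (Lw w)).
Proof. exact: (measurableT_comp (@measurable_ln R) mLw). Qed.

Let ln_Lw_integrable : Pr.-integrable setT (EFin \o (fun w => ln (Lw w))).
Proof.
(* The dominating function comes from [ln t < t], applied to the power of [Lw w] with exponent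
   [beta]. *)
apply: (@le_integrable _ _ _ _ _ _ _ (EFin \o (fun w => beta^-1 * Lw w `^ beta))) => //.
- exact/measurable_EFinP.
- move=> w _; rewrite lee_fin !ger0_norm ?mulr_ge0 ?invr_ge0 ?powR_ge0 ?(ltW beta_gt0)//.
  rewrite ler_pdivlMl// -ln_powR ltW// ln_sublinear//.
  by rewrite powR_gt0// (lt_le_trans ltr01).
- exact: integrable_mulrl.
Qed.

Let C : R := \int[Pr]_w ln (Lw w).

Let ln_lip_prod_integrable n : Pr.-integrable setT (EFin \o (fun w => ln (lip_prod n w))) /\
  \int[Pr]_w ln (lip_prod n w) = n%:R * C.
Proof.
have h i := integral_iter_shift i measurable_ln_Lw ln_Lw_ge0 ln_Lw_integrable.
have -> : (fun w => ln (lip_prod n w)) =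
    (fun w => \sum_(i < n) ln (Lw (iter i Defs.shift w))).
  by apply/funext => w; exact: ln_lip_prod.
split.
  rewrite (_ : _ \o _ = (fun w => \sum_(i < n) (ln (Lw (iter i Defs.shift w)))%:E)%E).
    by apply: integrable_sum => // i _; exact: (h i).1.
  by apply/funext => w; rewrite /= sumEFin.
rewrite (@Rintegral_sum _ _ _ Pr _ _ (fun i w => ln (Lw (iter (i : 'I_n) Defs.shift w)))).
  under eq_bigr do rewrite (h _).2.
  by rewrite sumr_const card_ord mulr_natl.
by move=> i; exact: (h i).1.
Qed.

Let C_ge0 : 0 <= C.
Proof. exact: Rintegral_ge0. Qed.

Let V_abs n k w x : `|V n k w x| <= k%:R + ln (lip_prod n w).
Proof.
have := V_le n k w x; have := V_ge n k w x; have := ln_ge0 (lip_prod_ge1 n w).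
have : 0 <= k%:R :> R by [].
by rewrite ler_norml => ? ? ? ?; apply/andP; split; lra.
Qed.

Let V_integrable n k x : Pr.-integrable setT (EFin \o (fun w => V n k w x)).
Proof.
apply: (@le_integrable _ _ _ _ _ _ _ (EFin \o (fun w => k%:R + ln (lip_prod n w)))) => //.
- by apply/measurable_EFinP; exact: measurable_V1.
- by move=> w _; rewrite lee_fin (le_trans (V_abs n k w x))// ler_norm.
- apply: integrable_addr; first exact: probability_integrable_cst.
  exact: (ln_lip_prod_integrable n).1.
Qed.

(** The average over words depends on the point alone and is Lipschitz, so it can be tested against
    the limits given by [krylov_bogoliubov]. *)
Let v n k x : R := \int[Pr]_w V n k w x.

Let v_le n k x : v n k x <= n%:R * C.
Proof.
rewrite -(ln_lip_prod_integrable n).2; apply: le_Rintegral => //.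
exact: (ln_lip_prod_integrable n).1.
Qed.

Let v_lip n k : lipschitz_real (2 * k%:R) (v n k).
Proof.
move=> x y; rewrite /v -RintegralB//.
have iB : Pr.-integrable setT (EFin \o (fun w => V n k w x - V n k w y)).
  exact: integrable_subr.
rewrite (le_trans (le_normr_Rintegral _ iB))//; apply: Rintegral_le_cst.
  exact: integrable_normr.
by move=> w; exact: (log_modulus_lip cX k (lip_prod_ge1 n w) (@fiter_lip n w)).
Qed.

Let v_noninc n k l x : (k <= l)%N -> v n l x <= v n k x.
Proof.
move=> kl; apply: le_Rintegral => // w _.
exact: log_modulus_noninc (lip_prod_ge1 n w) (@fiter_lip n w) kl.
Qed.

(** At most [beta], so that [P] acts on this Hoelder class, and at most 1, so that the class
    contains the Lipschitz functions [v n k]. *)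
Let a1 : R := Num.min beta 1.

Let a1_gt0 : 0 < a1. Proof. by rewrite lt_min beta_gt0 ltr01. Qed.

Let a1_beta : a1 <= beta. Proof. by rewrite ge_min lexx. Qed.

Let a1_le1 : a1 <= 1. Proof. by rewrite ge_min lexx orbT. Qed.

Let v_holder n k : holder_class a1 (v n k).
Proof. by apply: (lipschitz_holder cX _ (v_lip n k)); rewrite a1_gt0. Qed.

Let fiterD n m w x :
  fiter f (n + m) w x = fiter f m (iter n Defs.shift w) (fiter f n w x).
Proof.
elim: m => [|m ih]; first by rewrite addn0.
by rewrite addnS /= ih -iterD addnC.
Qed.

Let V_shift_integral n m k x :
  Pr.-integrable setT (EFin \o (fun w => V m k (iter n Defs.shift w) (fiter f n w x))) /\
  \int[Pr]_w V m k (iter n Defs.shift w) (fiter f n w x) = iter n P (v m k) x.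
Proof.
pose H (z : S * borel X) : \bar R := (V m k z.1 z.2 + k%:R)%:E.
have mH : measurable_fun setT H.
  by apply/measurable_EFinP; apply: measurable_funD.
have H0 z : (0 <= H z)%E.
  by rewrite lee_fin; have := V_ge m k z.1 z.2; lra.
pose g w : R := V m k (iter n Defs.shift w) (fiter f n w x).
have mg : measurable_fun setT g.
  have h := measurableT_comp (@measurable_fiter_shift n) (pair2_measurable (x : borel X)).
  exact: (measurableT_comp (@measurable_V m k) h).
have hv := koopman_integrable a1_gt0 n x (v_holder m k).
have E : (\int[Pr]_w (g w + k%:R)%:E = (iter n P (v m k) x + k%:R)%:E)%E.
  transitivity (\int[Pr]_w H (iter n Defs.shift w, fiter f n w x))%E => //.
  rewrite ge0_integral_fiter//.
  transitivity (\int[Pr]_w (v m k (fiter f n w x) + k%:R)%:E)%E.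
    apply: eq_integral => w _; rewrite /H/=.
    rewrite EFin_Rintegral; last first.
      by apply: integrable_addr => //; exact: probability_integrable_cst.
    rewrite RintegralD//; last exact: probability_integrable_cst.
    by rewrite Rintegral_probability_cst.
  rewrite EFin_Rintegral; last first.
    by apply: integrable_addr => //; exact: probability_integrable_cst.
  rewrite RintegralD//; last exact: probability_integrable_cst.
  by rewrite Rintegral_probability_cst -(iter_koopmanE a1_gt0).
have ig1 : Pr.-integrable setT (EFin \o (fun w => g w + k%:R)).
  apply/integrableP; split.
    by apply/measurable_EFinP; exact: measurable_funD.
  rewrite (_ : (fun _ => _) = (fun w => (g w + k%:R)%:E)); last first.
    apply/funext => w /=; rewrite ger0_norm// /g.
    by have := V_ge m k (iter n Defs.shift w) (fiter f n w x); lra.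
  by rewrite E ltry.
have ig : Pr.-integrable setT (EFin \o g).
  rewrite (_ : g = (fun w => (g w + k%:R) + - k%:R)).
    by apply: integrable_addr => //; exact: probability_integrable_cst.
  by apply/funext => w; rewrite addrK.
split => //.
have := congr1 fine E; rewrite -/(Rintegral _ _ _) RintegralD//; last first.
  exact: probability_integrable_cst.
by rewrite Rintegral_probability_cst => /addIr.
Qed.

(* Subadditivity of the averaged local exponents: the moduli of [f^(n + m)]
   decrease to at most the sum of those of [f^n] and of [f^m] along the orbit. *)
Let v_subadditive n m j k x (c : R) : (forall i, c <= v (n + m) i x) ->
  c <= v n j x + iter n P (v m k) x.
Proof.
move=> hc; have [igk <-] := V_shift_integral n m k x.
rewrite -RintegralD//.
pose H w := V n j w x + V m k (iter n Defs.shift w) (fiter f n w x).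
have iH : Pr.-integrable setT (EFin \o H) by exact: integrable_addr.
have mH : measurable_fun setT H by case/integrableP : iH => /measurable_EFinP.
(* The moduli of the iterate are eventually at most [H w + e] but may tend to something smaller.
   Their maximum with [H w] converges to [H w] itself, so dominated convergence applies. *)
pose Z i w := Num.max (V (n + m) i w x) (H w).
have mZ i : measurable_fun setT (Z i) by exact: measurable_maxr.
pose G w := `|V (n + m) 0 w x| + `|H w|.
have iG : Pr.-integrable setT (EFin \o G).
  by apply: integrable_addr; exact: integrable_normr.
have ZG i w : `|Z i w| <= G w.
  have h : V (n + m) i w x <= V (n + m) 0 w x.
    exact: log_modulus_noninc (lip_prod_ge1 _ w) (@fiter_lip _ w) (leq0n i).
  rewrite /Z /G; have := ler_norm (V (n + m) 0 w x); have := ler_norm (H w).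
  have := normr_ge0 (V (n + m) 0 w x); have := ler_norm (- H w); rewrite normrN.
  rewrite /Num.max; case: ltP => ? ? ? ? ?; rewrite ler_norml; apply/andP; split; lra.
have iZ i : Pr.-integrable setT (EFin \o Z i).
  apply: (@le_integrable _ _ _ _ _ _ _ (EFin \o G)) => //.
  - exact/measurable_EFinP.
  - by move=> w _; rewrite lee_fin (le_trans (ZG i w))// ler_norm.
have ZH w : Z i w @[i --> \oo] --> H w.
  apply/cvgrPdist_le => e e0.
  have := log_modulus_comp cX x j k (lip_prod_ge1 m (iter n Defs.shift w))
    (@fiter_lip m (iter n Defs.shift w)) (lip_prod_ge1 n w) (@fiter_lip n w) e0.
  apply: filterS => i; rewrite /Z /H /V.
  have -> : fiter f m (iter n Defs.shift w) \o fiter f n w = fiter f (n + m) w.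
    by apply/funext => y; rewrite fiterD.
  set p := log_modulus _ i _ _; set q := log_modulus _ j _ _.
  set r := log_modulus _ k _ _ => pqr.
  rewrite /Num.max; case: ltP => ?; rewrite ler_norml; apply/andP; split; lra.
have cZ : (\int[Pr]_w (Z i w)%:E)%E @[i --> \oo] --> (\int[Pr]_w (H w)%:E)%E.
  apply: (dominated_cvg measurableT (g := EFin \o G)) => //.
  - by move=> i; exact/measurable_EFinP.
  - move=> w _; apply: cvg_comp (ZH w) _; exact: cvg_id.
  - by move=> i w _; rewrite lee_fin.
have {}cZ : \int[Pr]_w Z i w @[i --> \oo] --> \int[Pr]_w H w.
  by move: cZ; rewrite EFin_Rintegral// => /fine_cvg.
apply: (cvgr_to_ge cZ); near=> i.
rewrite (le_trans (hc i))//; apply: le_Rintegral => // w _.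
by rewrite le_max lexx.
Unshelve. all: by end_near. Qed.

Hypothesis f_lyapunov : forall mu : probability (borel X) R,
  stationary Pr f mu -> (lyapunov Pr f mu < 0)%E.

Let product_V (mu : probability (borel X) R) m k :
  (Pr \x mu)%E.-integrable setT (EFin \o (fun z => V m k z.1 z.2)) /\
  (\int[(Pr \x mu)%E]_z (V m k z.1 z.2)%:E = (\int[mu]_x v m k x)%:E)%E.
Proof.
pose Q : probability (S * borel X)%type R := (Pr \x mu)%E.
pose W (z : S * borel X) : R := V m k z.1 z.2 + k%:R.
have mW : measurable_fun setT W by exact: measurable_funD.
have W0 z : 0 <= W z by rewrite /W; have := V_ge m k z.1 z.2; lra.
have iv : mu.-integrable setT (EFin \o v m k) by exact: (holder_integrable a1_gt0).
have E : (\int[Q]_z (W z)%:E = (\int[mu]_x v m k x + k%:R)%:E)%E.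
  rewrite (fubini_tonelli2 (fun z => (W z)%:E)); [|exact/measurable_EFinP|
    by move=> z; rewrite lee_fin].
  transitivity (\int[mu]_x (v m k x + k%:R)%:E)%E.
    apply: eq_integral => x _; rewrite /W/fubini_G/=.
    rewrite EFin_Rintegral; last first.
      by apply: integrable_addr => //; exact: probability_integrable_cst.
    rewrite RintegralD//; last exact: probability_integrable_cst.
    by rewrite Rintegral_probability_cst.
  rewrite EFin_Rintegral; last first.
    by apply: integrable_addr => //; exact: probability_integrable_cst.
  rewrite RintegralD//; last exact: probability_integrable_cst.
  by rewrite Rintegral_probability_cst.
have iW : Q.-integrable setT (EFin \o W).
  apply/integrableP; split; first exact/measurable_EFinP.
  rewrite (_ : (fun _ => _) = (fun z => (W z)%:E)); first by rewrite E ltry.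
  by apply/funext => z /=; rewrite ger0_norm.
have iV : Q.-integrable setT (EFin \o (fun z => V m k z.1 z.2)).
  rewrite (_ : (fun z => V m k z.1 z.2) = (fun z => W z + - k%:R)).
    by apply: integrable_addr => //; exact: probability_integrable_cst.
  by apply/funext => z; rewrite /W addrK.
split => //.
etransitivity; first exact: (EFin_Rintegral iV).
congr (_%:E).
have := congr1 fine E; rewrite -/(Rintegral _ _ _) RintegralD//; last first.
  exact: probability_integrable_cst.
by rewrite Rintegral_probability_cst => /addIr.
Qed.

(** The differences [W 0 - W k] increase to [G = W 0 - F], and their integrals are at most that of
    [W 0] because each [W k] has nonnegative integral. Hence [G] is integrable, and the integral of
    [F = W 0 - G] is nonnegative. Working with [G] avoids negative infinite values under the
    monotone limit. *)
Let integral_local_Lip_ge0 (mu : probability (borel X) R) m :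
  (forall k, 0 <= \int[mu]_x v m k x) ->
  (0 <= \int[(Pr \x mu)%E]_z lne (local_Lip (fiter f m z.1) z.2))%E.
Proof.
move=> v0.
pose Q : probability (S * borel X)%type R := (Pr \x mu)%E.
pose F (z : S * borel X) : \bar R := lne (local_Lip (fiter f m z.1) z.2).
pose W k (z : S * borel X) : R := V m k z.1 z.2.
have iW k : Q.-integrable setT (EFin \o W k) by exact: (product_V mu m k).1.
have mW k : measurable_fun setT (W k) by exact: measurable_V.
have WF z : (W k z)%:E @[k --> \oo] --> F z.
  exact: (cvg_log_modulus cX (x := z.2) (lip_prod_ge1 m z.1) (@fiter_lip m z.1)).
have FW z : (F z <= (W 0%N z)%:E)%E.
  exact: (lne_local_Lip_le cX 0 z.2 (lip_prod_ge1 m z.1) (@fiter_lip m z.1)).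
pose g k (z : S * borel X) : \bar R := (W 0%N z - W k z)%:E.
have mg k : measurable_fun setT (g k).
  by apply/measurable_EFinP; exact: measurable_funB.
have Wni z k l : (k <= l)%N -> W l z <= W k z.
  exact: (log_modulus_noninc cX z.2 (lip_prod_ge1 m z.1) (@fiter_lip m z.1)).
pose G z : \bar R := ((W 0%N z)%:E - F z)%E.
have gG z : g k z @[k --> \oo] --> G z.
  rewrite (_ : (fun k => g k z) = (fun k => (W 0%N z)%:E - (W k z)%:E)%E)//.
  by apply: cvgeB; [exact: fin_num_adde_defr|exact: cvg_cst|exact: WF].
have G0 z : (0 <= G z)%E by rewrite subre_ge0 ?FW.
have mG : measurable_fun setT G.
  by apply: (emeasurable_fun_cvg g) => // z _; exact: gG.
have intG : (\int[Q]_z G z <= \int[Q]_z (W 0%N z)%:E)%E.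
  rewrite (_ : G = (fun z => limn (g ^~ z))); last first.
    by apply/funext => z; apply/esym/cvg_lim => //; exact: gG.
  rewrite monotone_convergence//; last 2 first.
  - by move=> k z _; rewrite lee_fin subr_ge0 Wni.
  - by move=> z _ k l kl; rewrite lee_fin lerD2l lerN2 Wni.
  apply: lime_le.
    apply: ereal_nondecreasing_is_cvgn => k l kl; apply: ge0_le_integral => //.
    - by move=> z _; rewrite lee_fin subr_ge0 Wni.
    - by move=> z _; rewrite lee_fin lerD2l lerN2 Wni.
  apply: nearW => k; rewrite /g.
  rewrite (_ : (fun z => _) = (fun z => (W 0%N z)%:E - (W k z)%:E)%E)//.
  rewrite integralB//; try exact: iW.
  rewrite (product_V mu m k).2 (product_V mu m 0).2 -EFinB lee_fin.
  by rewrite gerBl.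
have iG : Q.-integrable setT G.
  apply/integrableP; split => //.
  under eq_integral do rewrite gee0_abs//.
  by rewrite (le_lt_trans intG)// (product_V mu m 0).2 ltry.
rewrite (_ : (fun _ => _) = (fun z => (W 0%N z)%:E - G z)%E); last first.
  apply/funext => z; rewrite -/(F z) /G; case: (F z) (FW z) => [r _| |//].
  - by rewrite -!EFinB subKr.
  - by rewrite leye_eq.
rewrite integralB//; last exact: iW.
by rewrite subre_ge0 ?intG// (product_V mu m 0).2.
Qed.

Let sum_shift_sub (a : nat -> R) m M :
  \sum_(n < M) (a (n + m)%N - a n) = \sum_(i < m) a (M + i)%N - \sum_(i < m) a i.
Proof.
elim: M => [|M ih]; first by rewrite big_ord0 subrr.
rewrite big_ord_recr/= ih.
have e1 : \sum_(i < m.+1) a (M + i)%N = \sum_(i < m) a (M + i)%N + a (M + m)%N.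
  by rewrite big_ord_recr.
have e2 : \sum_(i < m.+1) a (M + i)%N = a M + \sum_(i < m) a (M.+1 + i)%N.
  rewrite big_ord_recl addn0; congr (_ + _).
  by apply: eq_bigr => i _; rewrite /= /bump add1n addnS addSn.
by rewrite e1 in e2; move: e2; lra.
Qed.

Let iter_v_le n m k x : iter n P (v m k) x <= m%:R * C.
Proof.
have := iter_koopman_le a1_gt0 a1_beta n (v_holder m k)
  (holder_class_cst a1 (m%:R * C)) (fun y => v_le m k y) x.
by rewrite iter_koopman_cst.
Qed.

(** With [a n] the infimum of [v n j x] over the scales, subadditivity gives
    [a (n + m) - a n <= iter n P (v m k) x]. The sum over [n] telescopes with step [m]: the [m]
    initial terms are at most [m * C], the [m] final ones at least [- (m * C)] since at most [m]
    steps separate them from time [N], where all moduli are nonnegative. The last [m] summands, not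
    covered by this, cost [m * U]. *)
Let birkhoff_v_lower N m k x U : (m <= N)%N -> (forall j, 0 <= v N j x) ->
  (forall y, `|v m k y| <= U) ->
  - (2 * m%:R ^+ 2 * C + m%:R * U) <= \sum_(n < N) iter n P (v m k) x.
Proof.
move=> mN vN vU.
have lb n j : (n <= N)%N -> - ((N - n)%:R * C) <= v n j x.
  move=> nN; have h : 0 <= v n j x + iter n P (v (N - n) 0) x.
    by apply: v_subadditive => i; rewrite subnKC.
  by have := iter_v_le n (N - n) 0 x; lra.
pose a n := inf (range (fun j => v n j x)).
have hlb n : (n <= N)%N -> has_lbound (range (fun j => v n j x)).
  by move=> nN; exists (- ((N - n)%:R * C)) => _ [j _ <-]; exact: lb.
have a_le n j : (n <= N)%N -> a n <= v n j x.
  by move=> nN; apply: ge_inf; [exact: hlb|exists j].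
have a_ge n c : (forall j, c <= v n j x) -> c <= a n.
  move=> h; apply: lb_le_inf; first by exists (v n 0%N x), 0%N.
  by move=> _ [j _ <-].
pose p n := iter n P (v m k) x.
have ap n : (n + m <= N)%N -> a (n + m)%N - a n <= p n.
  move=> nmN; rewrite lerBlDr -lerBlDl.
  apply: a_ge => j; rewrite lerBlDl addrC.
  by apply: v_subadditive => i; exact: a_le.
pose M := (N - m)%N.
have NM : N = (M + m)%N by rewrite subnK.
have s1 : \sum_(n < M) (a (n + m)%N - a n) <= \sum_(n < M) p n.
  by apply: ler_sum => n _; apply: ap; rewrite NM leq_add2r ltnW.
rewrite sum_shift_sub in s1.
have mC (i : nat) : (i <= m)%N -> i%:R * C <= m%:R * C.
  by move=> im; rewrite ler_wpM2r// ler_nat.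
have sumc (c : R) : \sum_(i < m) c = m%:R * c.
  by rewrite sumr_const card_ord mulr_natl.
have s2 : \sum_(i < m) a i <= m%:R * (m%:R * C).
  rewrite -[leRHS]sumc.
  apply: ler_sum => i _; have im : (i <= m)%N by exact: ltnW.
  apply: (le_trans (a_le _ 0%N (leq_trans im mN))).
  by apply: (le_trans (v_le _ _ _)); exact: mC.
have s3 : - (m%:R * (m%:R * C)) <= \sum_(i < m) a (M + i)%N.
  rewrite -mulrN -[leLHS]sumc.
  apply: ler_sum => i _; apply: a_ge => j.
  have MiN : (M + i <= N)%N by rewrite NM leq_add2l ltnW.
  apply: le_trans (lb _ j MiN); rewrite lerN2 mC//.
  by rewrite NM subnDl leq_subr.
have s4 : - (m%:R * U) <= \sum_(i < m) p (M + i)%N.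
  rewrite -mulrN -[leLHS]sumc.
  apply: ler_sum => i _.
  have := iter_koopman_bound a1_gt0 a1_beta (M + i) (v_holder m k) vU x.
  by rewrite ler_norml => /andP[].
have -> : \sum_(n < N) iter n P (v m k) x =
    \sum_(n < M) p n + \sum_(i < m) p (M + i)%N by rewrite NM big_split_ord.
have -> : - (2 * m%:R ^+ 2 * C + m%:R * U) =
    - (m%:R * (m%:R * C)) - m%:R * (m%:R * C) + - (m%:R * U) by ring.
by apply: lerD s4; exact: le_trans (lerB s3 s2) s1.
Qed.

(* Otherwise, for each [n] there is a point [xs n] at which the averaged moduli
   of [f^n] are nonnegative at all scales [k]; by subadditivity a stationary limit
   of the empirical averages along these points has a nonnegative exponent. *)
Lemma average_contraction : exists n k (c : R),
  [/\ (0 < n)%N, 0 < c &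
   forall x, \int[Pr]_w log_modulus cX k (fiter f n w) x <= - c].
Proof.
apply: contrapT => no.
have H n k (c : R) : (0 < n)%N -> 0 < c -> exists x, - c < v n k x.
  move=> n0 c0; apply: contrapT => /forallNP h; apply: no; exists n, k, c.
  by split => // x; rewrite leNgt; apply/negP; exact: h.
have /choice[xs xsP] : forall n, exists x, (0 < n)%N -> forall k, 0 <= v n k x.
  move=> [|n]; first by exists point.
  have /choice[y yP] : forall j : nat, exists y, - j.+1%:R^-1 < v n.+1 j y.
    by move=> j; apply: H => //; rewrite invr_gt0.
  (* The point [y j] is almost bad at scale [j], hence at each coarser scale [k <= j]; a limit of
     these points is therefore bad at all scales at once. *)
  have [x _ yx] := compact_natU cX (fun j => I : [set: X] (y j)).
  exists x => _ k.
  have cv : v n.+1 k (y j) @[j --> natU] --> v n.+1 k x.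
    apply: continuous_cvg => //; exact: (lipschitz_continuous (v_lip n.+1 k)).
  have ch : - (j.+1%:R^-1 : R) @[j --> natU] --> (0 : R).
    by rewrite -oppr0; apply: cvgN; apply: cvg_natU; exact: cvg_harmonic.
  apply: (ler_cvg_to ch cv); near=> j.
  rewrite (le_trans (ltW (yP j)))//; apply: v_noninc; near: j; exact: natU_ge.
have [mu [st muP]] := krylov_bogoliubov a1_gt0 a1_beta a1_le1 xs.
have pos m k : (0 < m)%N -> 0 <= \int[mu]_x v m k x.
  move=> m0; have [U vU] := holder_class_bounded cX a1_gt0 (v_holder m k).
  pose K := 2 * m%:R ^+ 2 * C + m%:R * U.
  have cN : - (N%:R^-1 * K) @[N --> natU] --> (0 : R).
    rewrite -oppr0; apply: cvgN; rewrite -[X in _ --> X](mul0r K).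
    apply: cvgMl; apply: cvg_natU.
    by rewrite -(cvg_shiftS (fun N => N%:R^-1 : R)); exact: cvg_harmonic.
  apply: (ler_cvg_to cN (muP _ (v_holder m k))); near=> N.
  have mN : (m <= N)%N by near: N; exact: natU_ge.
  rewrite /birkhoff -mulrN ler_wpM2l ?invr_ge0//.
  by apply: birkhoff_v_lower => // j; apply: xsP; exact: leq_trans mN.
have := f_lyapunov st; apply/negP; rewrite -leNgt /lyapunov.
set u := (fun n : nat => _).
have u0 n : (0 <= u n)%E.
  rewrite /u; case: n => [|n]; first by rewrite invr0 mul0e.
  rewrite mule_ge0 ?lee_fin ?invr_ge0//.
  by apply: integral_local_Lip_ge0 => k; exact: pos.
(* If the averages do not converge, [limn] is the default value 0, which contradicts negativity just
   as well. *)
have [cu|/dvgP ->] := pselect (cvg (u n @[n --> \oo])); last by rewrite lexx.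
by apply: lime_ge => //; exact: nearW.
Unshelve. all: by end_near. Qed.

(** Used with [y = a * V]: the linear term carries the negative mean, and the remainder is of order
    [a ^+ 2] with a factor controlled by the moment. *)
Let expR_le_quadratic (y : R) : expR y <= 1 + y + y ^+ 2 * Num.max 1 (expR y).
Proof.
have h : expR y <= 1 + y * expR y.
  have := expR_ge1Dx (- y); rewrite expRN -[X in X <= _](@mulfK _ (expR y)) ?gt_eqF ?expR_gt0//.
  by rewrite -[leRHS]mul1r ler_pM2r ?invr_gt0 ?expR_gt0//; lra.
have h1 := expR_ge1Dx y; have e0 := expR_ge0 y.
have m1 : 1 <= Num.max 1 (expR y) by rewrite le_max lexx.
have m2 : expR y <= Num.max 1 (expR y) by rewrite le_max lexx orbT.
move: m1 m2 h h1 e0; set M := Num.max _ _; set t := expR y => m1 m2 h h1 e0.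
have [y0|y0] := leP 0 y.
  have : y * (t - 1) <= y * (y * M).
    by rewrite ler_wpM2l// (le_trans _ (ler_wpM2l y0 m2))//; lra.
  by rewrite expr2; lra.
have : y * (t - 1) <= y * y by rewrite ler_wnM2l ?(ltW y0)//; lra.
have : y * y <= y * y * M by rewrite ler_peMr// -expr2 sqr_ge0.
by rewrite expr2; lra.
Qed.

Let W n w : R := \sum_(i < n) Lw (iter i Defs.shift w) `^ beta.

(** Each of the [n] factors is at most [W n w] to the power [1 / beta], so the product is at most
    its power [n / beta]. Lowering the exponent to [beta / n] turns the product into a sum, whose
    integrability follows from shift invariance. *)
Let lip_prod_le_W n w : (0 < n)%N -> lip_prod n w `^ (beta / n%:R) <= W n w.
Proof.
move=> n0.
have h (i : 'I_n) : Lw (iter i Defs.shift w) <= W n w `^ beta^-1.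
  rewrite -[leLHS](powRr1 (le_trans ler01 (Lw_ge1 _))) -(mulfV (lt0r_neq0 beta_gt0)).
  rewrite powRrM ge0_ler_powR ?invr_ge0 ?(ltW beta_gt0) ?nnegrE ?powR_ge0//.
    by rewrite sumr_ge0// => j _; exact: powR_ge0.
  by rewrite /W (bigD1 i)//= lerDl sumr_ge0// => j _; exact: powR_ge0.
have W0 : 0 <= W n w by rewrite sumr_ge0// => j _; exact: powR_ge0.
have hp : lip_prod n w <= (W n w `^ beta^-1) ^+ n.
  rewrite -[X in _ ^+ X](card_ord n) -prodr_const /lip_prod; apply: ler_prod => i _.
  by rewrite h (le_trans ler01).
have b0 : 0 <= beta / n%:R by rewrite divr_ge0// ltW.
apply: (le_trans (ge0_ler_powR b0 _ _ hp)).
- by rewrite nnegrE ltW.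
- by rewrite nnegrE exprn_ge0// powR_ge0.
rewrite -powR_mulrn ?powR_ge0// -!powRrM mulrA mulrAC mulrA mulVf ?gt_eqF// mul1r.
by rewrite mulVf ?pnatr_eq0 -?lt0n// powRr1.
Qed.

Let W_integrable n : Pr.-integrable setT (EFin \o W n).
Proof.
rewrite (_ : EFin \o W n = (fun w => \sum_(i < n) (Lw (iter i Defs.shift w) `^ beta)%:E)%E).
  apply: (@integrable_sum _ _ _ _ _ measurableT) => i _.
  have mLb : measurable_fun setT (fun w => Lw w `^ beta).
    exact: (measurableT_comp (measurable_powR beta) mLw).
  exact: (integral_iter_shift i mLb (fun w => powR_ge0 _ _) Lw_beta_integrable).1.
by apply/funext => w; rewrite /= sumEFin.
Qed.

(* The constant [4 / b], [b = beta / n], comes from [ln L <= (4 / b) * L `^ (b / 4)]. *)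
Let expR_V_le n k (a : R) w x : (0 < n)%N -> 0 < a -> a <= beta / n%:R / 2 ->
  expR (a * V n k w x) <=
  1 + a * V n k w x + a ^+ 2 * ((k%:R ^+ 2 + (4 / (beta / n%:R)) ^+ 2) * W n w).
Proof.
move=> n0 a0; set b := beta / n%:R => ab.
have b0 : 0 < b by rewrite divr_gt0// ltr0n.
set t := V n k w x; set L := lip_prod n w.
have L1 : 1 <= L := lip_prod_ge1 n w.
have lL : 0 <= ln L by exact: ln_ge0.
have LW : L `^ b <= W n w by exact: lip_prod_le_W.
apply: (le_trans (expR_le_quadratic _)); rewrite lerD2l exprMn -mulrA ler_wpM2l ?sqr_ge0//.
have b20 : 0 <= b / 2 by rewrite divr_ge0// ltW.
have Lb : 1 <= L `^ (b / 2) by rewrite -[leLHS](powRr0 L) ler_powR.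
(* The integrable weight with exponent [b] is shared: one half bounds the exponential, the other
   half the square. *)
have e1 : Num.max 1 (expR (a * t)) <= L `^ (b / 2).
  rewrite ge_max Lb/=.
  rewrite /powR gt_eqF ?(lt_le_trans ltr01)// ler_expR.
  apply: (@le_trans _ _ (a * ln L)); first by rewrite ler_wpM2l ?(ltW a0)// V_le.
  by rewrite ler_wpM2r.
have e2 : t ^+ 2 <= (k%:R ^+ 2 + (4 / b) ^+ 2) * L `^ (b / 2).
  have h1 : t ^+ 2 <= k%:R ^+ 2 + ln L ^+ 2.
    have h1 : - k%:R <= t := V_ge n k w x; have h2 : t <= ln L := V_le n k w x.
    have k0 : (0 : R) <= k%:R by [].
    have [t0|t0] := leP 0 t.
      have : t ^+ 2 <= ln L ^+ 2 by rewrite ler_sqr ?nnegrE.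
      by have := sqr_ge0 (k%:R : R); lra.
    have : (- t) ^+ 2 <= k%:R ^+ 2 by rewrite ler_sqr ?nnegrE; lra.
    by rewrite sqrrN; have := sqr_ge0 (ln L); lra.
  apply: (le_trans h1); rewrite mulrDl lerD//.
    by rewrite ler_peMr// sqr_ge0.
  have L4 : 0 <= L `^ (b / 4) by exact: powR_ge0.
  have -> : b / 2 = b / 4 * 2%:R by lra.
  rewrite powRrM powR_mulrn// -exprMn ler_sqr ?nnegrE//; last first.
    by rewrite mulr_ge0// divr_ge0// ltW.
  have b40 : 0 < b / 4 by rewrite divr_gt0.
  rewrite -(invf_div b) ler_pdivlMl// -ln_powR ltW// ln_sublinear// powR_gt0//.
  exact: lt_le_trans L1.
apply: (@le_trans _ _ ((k%:R ^+ 2 + (4 / b) ^+ 2) * L `^ (b / 2) * L `^ (b / 2))).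
  by rewrite ler_pM// ?sqr_ge0// le_max ler01.
rewrite -mulrA ler_wpM2l ?addr_ge0 ?sqr_ge0// -powRD; last first.
  by apply/implyP => _; rewrite gt_eqF// (lt_le_trans ltr01).
by rewrite -splitr.
Qed.

Lemma fiter_mdist_integrable n (a : R) y z : 0 < a ->
  Pr.-integrable setT (EFin \o (fun w => mdist (fiter f n w y) (fiter f n w z) `^ a)).
Proof.
move=> a0; have [D D0 dD] := compact_mdist_bounded cX.
apply: (@bounded_integrable _ _ _ _ _ (D `^ a)) => [|w].
  apply: (measurableT_comp (measurable_powR a)).
  by apply: measurable_mdist => //; exact: measurable_fiter1.
by rewrite ger0_norm ?powR_ge0// ge0_ler_powR ?nnegrE ?mdist_ge0 ?(ltW a0)// ltW.
Qed.

Lemma contraction : exists n (a r q : R),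
  [/\ (0 < n)%N, 0 < a <= beta & a <= 1] /\ [/\ 0 < r, 0 < q < 1 &
   forall y z, mdist y z < r ->
   \int[Pr]_w (mdist (fiter f n w y) (fiter f n w z) `^ a) <= q * mdist y z `^ a].
Proof.
have [n [k [c [n0 c0 Vc]]]] := average_contraction.
pose b := beta / n%:R; have b0 : 0 < b by rewrite divr_gt0// ltr0n.
pose C3 := k%:R ^+ 2 + (4 / b) ^+ 2.
have C30 : 0 < C3 by rewrite ltr_wpDl ?sqr_ge0// exprn_gt0// divr_gt0.
pose E := \int[Pr]_w W n w.
have E0 : 0 <= E by apply: Rintegral_ge0 => w _; rewrite sumr_ge0// => j _; exact: powR_ge0.
pose a := Num.min (Num.min (b / 2) (c / (2 * C3 * (E + 1)))) a1.
have E1 : 0 < E + 1 by rewrite ltr_wpDl.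
have a0 : 0 < a.
  rewrite /a lt_min; apply/andP; split; last exact: a1_gt0.
  by rewrite lt_min (divr_gt0 b0)//= divr_gt0// mulr_gt0// mulr_gt0.
have aa1 : a <= a1 by rewrite ge_min lexx orbT.
have ab : a <= b / 2 by rewrite !ge_min lexx.
have ac : a <= c / (2 * C3 * (E + 1)) by rewrite !ge_min lexx orbT.
pose r : R := c / (4 * k.+1%:R).
exists n, a, r, (expR (- (a * c / 4))).
split; first by rewrite n0 a0 !(le_trans aa1).
split; first by rewrite divr_gt0// mulr_gt0.
  by rewrite expR_gt0 expR_lt1 oppr_lt0 divr_gt0// mulr_gt0.
move=> y z yzr; set D := mdist y z.
have D0 : 0 <= D := mdist_ge0 y z.
pose U w := 1 + a * V n k w y + a ^+ 2 * (C3 * W n w).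
have iU1 : Pr.-integrable setT (EFin \o (fun w => 1 + a * V n k w y)).
  apply: integrable_addr; first exact: probability_integrable_cst.
  exact: integrable_mulrl.
have iU2 : Pr.-integrable setT (EFin \o (fun w => a ^+ 2 * (C3 * W n w))).
  by apply: integrable_mulrl; exact: integrable_mulrl.
have iU : Pr.-integrable setT (EFin \o U) by exact: integrable_addr.
have EU : \int[Pr]_w U w = 1 + a * v n k y + a ^+ 2 * (C3 * E).
  rewrite RintegralD// RintegralD//.
  - rewrite Rintegral_probability_cst RintegralZl// RintegralZl ?RintegralZl//.
    exact: integrable_mulrl.
  - exact: probability_integrable_cst.
  - exact: integrable_mulrl.
have Uc : \int[Pr]_w U w <= expR (- (a * c / 2)).
  rewrite EU; apply: (le_trans _ (expR_ge1Dx _)).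
  have h1 : a * v n k y <= a * (- c) by rewrite ler_wpM2l ?(ltW a0)//; exact: Vc.
  have h2 : a * (C3 * E) <= c / 2.
    have -> : c / 2 = c / (2 * C3 * (E + 1)) * (C3 * (E + 1)).
      by field; rewrite !gt_eqF.
    by apply: ler_pM => //; rewrite ?(ltW a0) ?mulr_ge0 ?(ltW C30)// ler_wpM2l ?(ltW C30)// lerDl.
  have h3 : a ^+ 2 * (C3 * E) <= a * (c / 2) by rewrite expr2 -mulrA ler_wpM2l// ltW.
  lra.
pose K := D `^ a * expR (a * c / 4).
have K0 : 0 <= K by rewrite mulr_ge0 ?powR_ge0 ?expR_ge0.
apply: (@le_trans _ _ (\int[Pr]_w (K * U w))).
  apply: le_Rintegral => //.
  - exact: fiter_mdist_integrable.
  - exact: integrable_mulrl.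
  move=> w _.
  have := log_modulusP cX k y y z (lip_prod_ge1 n w) (@fiter_lip n w).
  rewrite mdistxx add0r -/(V n k w y) -/D => h.
  apply: (le_trans (ge0_ler_powR (ltW a0) _ _ h)); rewrite ?nnegrE ?mdist_ge0//.
    by rewrite mulr_ge0// expR_ge0.
  rewrite powRM ?expR_ge0// -expRM /K -mulrA ler_wpM2l ?powR_ge0//.
  apply: le_trans (ler_wpM2l (expR_ge0 _) (expR_V_le k w y n0 a0 ab)).
  rewrite -expRD ler_expR mulrDl (mulrC _ a) addrC lerD2r -mulrA.
  have : k%:R * D <= c / 4.
    have h4 : k.+1%:R * D <= c / 4.
      have := ltW yzr; rewrite ler_pdivlMr ?mulr_gt0// ler_pdivlMr// => hr.
      by rewrite mulrAC mulrC (mulrC _ 4).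
    by apply: le_trans h4; rewrite ler_wpM2r// ler_nat.
  by move=> /(ler_wpM2l (ltW a0)); lra.
rewrite RintegralZl//; apply: (le_trans (ler_wpM2l K0 Uc)).
rewrite /K -(mulrA (D `^ a)) -expRD mulrC ler_wpM2r ?powR_ge0// ler_expR; lra.
Qed.

End negative_exponents.

(** A concave power lies below its tangent at 1. With [t = expR x], two instances of
    [1 + y <= expR y] are added with weights [s] and [1 - s], which cancel the linear terms. *)
Lemma powR_le_interpolation (s t : R) : 0 < s <= 1 -> 0 <= t ->
  t `^ s <= 1 - s + s * t.
Proof.
move=> /andP[s0 s1]; rewrite le_eqVlt => /predU1P[<-|t0].
  by rewrite powR0 ?gt_eqF// mulr0 addr0 subr_ge0.
set x := ln t.
have -> : t `^ s = expR (s * x) by rewrite /powR gt_eqF.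
have {1}-> : t = expR x by rewrite lnK.
have h1 := expR_ge1Dx (x - s * x); have h2 := expR_ge1Dx (- (s * x)).
have e0 := expR_gt0 (s * x).
have k1 : 1 <= s * expR (x - s * x) + (1 - s) * expR (- (s * x)).
  have : s * (1 + (x - s * x)) <= s * expR (x - s * x) by rewrite ler_wpM2l// ltW.
  have : (1 - s) * (1 - s * x) <= (1 - s) * expR (- (s * x)).
    by rewrite ler_wpM2l// subr_ge0.
  lra.
have := ler_wpM2l (ltW e0) k1.
rewrite mulr1 mulrDr mulrCA (mulrCA _ (1 - s)) -!expRD subrr expR0 mulr1.
by rewrite [s * x + _]addrC subrK addrC.
Qed.

(** Jensen's inequality for the concave power [b / a], through its tangent at 1 after dividing by
    the bound [q * D^a] on the mean. It extends the result to all smaller exponents with the same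
    [n] and [r]. *)
Lemma contraction_le_exponent n (a b r q : R) : 0 < b <= a -> 0 < q ->
  (forall y z, mdist y z < r ->
   \int[Pr]_w (mdist (fiter f n w y) (fiter f n w z) `^ a) <= q * mdist y z `^ a) ->
  forall y z, mdist y z < r ->
   \int[Pr]_w (mdist (fiter f n w y) (fiter f n w z) `^ b) <=
   q `^ (b / a) * mdist y z `^ b.
Proof.
move=> /andP[b0 ba] q0 h y z /h; have a0 : 0 < a := lt_le_trans b0 ba.
pose s := b / a.
have s01 : 0 < s <= 1 by rewrite divr_gt0//= ler_pdivrMr// mul1r.
have bE : b = a * s by rewrite mulrC divfK// gt_eqF.
rewrite -/s; set D := mdist y z.
have [D0|Dn0] := eqVneq D 0.
  move=> _; rewrite D0 powR0 ?gt_eqF// mulr0; apply: Rintegral_le_cst.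
    exact: fiter_mdist_integrable.
  move=> w; have := @fiter_lip n w y z; rewrite -/D D0 mulr0 => h0.
  have -> : mdist (fiter f n w y) (fiter f n w z) = 0.
    by apply/eqP; rewrite eq_le h0 mdist_ge0.
  by rewrite powR0// gt_eqF.
have D0 : 0 < D by rewrite lt_def Dn0 mdist_ge0.
have c0 : 0 < q * D `^ a by rewrite mulr_gt0// powR_gt0.
move=> hle; have iT b' := @fiter_mdist_integrable n b' y z.
pose t w := (q * D `^ a)^-1 * mdist (fiter f n w y) (fiter f n w z) `^ a.
have it : Pr.-integrable setT (EFin \o t) by apply: integrable_mulrl; exact: iT.
have t0 w : 0 <= t w by rewrite mulr_ge0 ?invr_ge0 ?powR_ge0// ltW.
have Et : \int[Pr]_w t w <= 1.
  by rewrite RintegralZl//; [rewrite ler_pdivrMl// mulr1|exact: iT].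
have -> : q `^ s * D `^ b = (q * D `^ a) `^ s.
  by rewrite powRM ?powR_ge0 ?(ltW q0)// -powRrM -bE.
set c := q * D `^ a in c0 *.
have ti w : mdist (fiter f n w y) (fiter f n w z) `^ b = c `^ s * t w `^ s.
  rewrite -powRM ?t0 ?(ltW c0)// /t mulrA mulfV ?gt_eqF// mul1r.
  by rewrite -powRrM -bE.
have ie : Pr.-integrable setT (EFin \o (fun w => 1 - s + s * t w)).
  apply: integrable_addr; first exact: probability_integrable_cst.
  exact: integrable_mulrl.
apply: (@le_trans _ _ (\int[Pr]_w (c `^ s * (1 - s + s * t w)))).
  apply: le_Rintegral => //; [exact: iT|exact: integrable_mulrl|].
  by move=> w _; rewrite ti ler_wpM2l ?powR_ge0// powR_le_interpolation.
rewrite RintegralZl// -[leRHS]mulr1 ler_wpM2l ?powR_ge0//.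
rewrite RintegralD//; last 2 first.
- exact: probability_integrable_cst.
- exact: integrable_mulrl.
rewrite Rintegral_probability_cst RintegralZl//.
have : s * \int[Pr]_w t w <= s * 1 by rewrite ler_wpM2l//; case/andP: s01 => /ltW.
by lra.
Qed.

(** * Lasota-Yorke inequality and quasi-compactness *)

Section contracting.
Variables (n : nat) (a r q : R).
Hypotheses (n_gt0 : (0 < n)%N) (a_gt0 : 0 < a) (a_beta : a <= beta) (a_le1 : a <= 1).
Hypotheses (r_gt0 : 0 < r) (q_gt0 : 0 < q) (q_lt1 : q < 1).
Hypothesis contract : forall y z, mdist y z < r ->
  \int[Pr]_w (mdist (fiter f n w y) (fiter f n w z) `^ a) <= q * mdist y z `^ a.

Let powR_r_gt0 : 0 < r `^ a. Proof. exact: powR_gt0. Qed.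

Lemma holder_far C M (u : X -> R) y z : (forall x, `|u x| <= M) -> r <= mdist y z ->
  2 * M / r `^ a <= C -> `|u y - u z| <= C * mdist y z `^ a.
Proof.
move=> uM ryz MC; have M0 : 0 <= M := le_trans (normr_ge0 _) (uM y).
apply: (@le_trans _ _ (2 * M)).
  rewrite (le_trans (ler_normB _ _))//; have := uM y; have := uM z; lra.
rewrite ler_pdivrMr// in MC; apply: (le_trans MC); rewrite ler_wpM2l//.
  have : 0 <= C * r `^ a by apply: le_trans MC; rewrite mulr_ge0.
  by rewrite pmulr_lge0.
by rewrite ge0_ler_powR ?nnegrE ?mdist_ge0 ?(ltW a_gt0) ?(ltW r_gt0).
Qed.

(** Close pairs are contracted on average, distant ones are handled by the uniform bound. Since each
    pair falls under one case, a maximum appears instead of a sum, and iteration does not accumulate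
    the second term. *)
Lemma lasota_yorke C M (u : X -> R) : 0 <= C -> holder a C u -> (forall x, `|u x| <= M) ->
  holder a (Num.max (q * C) (2 * M / r `^ a)) (iter n P u).
Proof.
move=> C0 hu uM y z; have Hu : holder_class a u by exists C.
have PM := iter_koopman_bound a_gt0 a_beta n Hu uM.
have [yzr|ryz] := ltP (mdist y z) r; last first.
  by apply: holder_far PM ryz _; rewrite le_max lexx orbT.
rewrite !(iter_koopmanE a_gt0)// -RintegralB//; try exact: (koopman_integrable a_gt0).
have iB : Pr.-integrable setT
    (EFin \o (fun w => u (fiter f n w y) - u (fiter f n w z))).
  by apply: integrable_subr; exact: (koopman_integrable a_gt0).
apply: (le_trans (le_normr_Rintegral _ iB)) => //.
have iD : Pr.-integrable setT
    (EFin \o (fun w => mdist (fiter f n w y) (fiter f n w z) `^ a)).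
  exact: fiter_mdist_integrable.
apply: (@le_trans _ _ (\int[Pr]_w (C * mdist (fiter f n w y) (fiter f n w z) `^ a))).
  apply: le_Rintegral => //; first exact: integrable_normr.
  exact: integrable_mulrl.
rewrite RintegralZl//; apply: (le_trans (ler_wpM2l C0 (contract yzr))).
by rewrite mulrCA mulrA ler_wpM2r ?powR_ge0// le_max lexx.
Qed.

Lemma lasota_yorke_iter k C M (u : X -> R) : 0 <= C -> holder a C u -> (forall x, `|u x| <= M) ->
  holder a (Num.max (q ^+ k * C) (2 * M / r `^ a)) (iter (k * n) P u).
Proof.
move=> C0 hu uM; elim: k => [|k ih].
  by apply: holder_le hu; rewrite mul1r le_max lexx.
have M0 : 0 <= M := le_trans (normr_ge0 _) (uM point).
have Hu : holder_class a u by exists C.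
have D0 : 0 <= 2 * M / r `^ a by rewrite divr_ge0 ?mulr_ge0// ltW.
have qC0 : 0 <= q ^+ k * C by rewrite mulr_ge0// exprn_ge0// ltW.
rewrite mulSn iterD.
have := lasota_yorke _ ih (iter_koopman_bound a_gt0 a_beta (k * n) Hu uM).
rewrite le_max qC0 => /(_ isT); apply: holder_le.
by apply: max_geometric_step; rewrite // !ltW.
Qed.

(** Divide [j] by [n]: the remaining [j %% n] steps cost a factor [lip_moment a] each, and the
    blocks of [n] steps never increase the maximum. *)
Lemma equi_holder j C M (u : X -> R) : 0 <= C -> holder a C u -> (forall x, `|u x| <= M) ->
  holder a (Num.max (lip_moment a ^+ n * C) (2 * M / r `^ a)) (iter j P u).
Proof.
move=> C0 hu uM; have Hu : holder_class a u by exists C.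
have B1 : 1 <= lip_moment a := lip_moment_ge1 a_gt0 a_beta.
have hi i : holder a (C * lip_moment a ^+ i) (iter i P u).
  elim: i => [|i ih]; first by rewrite mulr1.
  rewrite exprSr mulrA; apply: holder_koopman => //.
  by rewrite mulr_ge0// exprn_ge0// (le_trans ler01).
have Ci0 i : 0 <= C * lip_moment a ^+ i.
  by rewrite mulr_ge0// exprn_ge0// (le_trans ler01).
rewrite (divn_eq j n) iterD.
have := lasota_yorke_iter (j %/ n)%N (Ci0 (j %% n)%N) (hi _)
  (iter_koopman_bound a_gt0 a_beta (j %% n)%N Hu uM).
apply: holder_le; rewrite ge_max !le_max lexx orbT andbT; apply/orP; left.
apply: (@le_trans _ _ (C * lip_moment a ^+ (j %% n))).
  by rewrite ler_piMl// exprn_ile1// ltW.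
rewrite mulrC ler_wpM2r//; apply: ler_weXn2l => //.
by rewrite ltnW// ltn_pmod.
Qed.

Let PnD m u v : holder_class a u -> holder_class a v ->
  iter m P (fun x => u x + v x) = (fun x => iter m P u x + iter m P v x).
Proof. exact: iter_koopmanD. Qed.

Let PnZ m c u : holder_class a u ->
  iter m P (fun x => c * u x) = (fun x => c * iter m P u x).
Proof. exact: iter_koopmanZ. Qed.

Let Pn_class m u : holder_class a u -> holder_class a (iter m P u).
Proof. exact: holder_class_iter_koopman. Qed.

Let Pn_bound m u M : holder_class a u -> (forall x, `|u x| <= M) ->
  forall x, `|iter m P u x| <= M.
Proof. exact: iter_koopman_bound. Qed.

(** An Arzela-Ascoli argument: a sequence of points where the difference exceeds [e] has a limit
    [x], and the common Hoelder constant carries the discrepancy over to [x]. *)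
Lemma natU_uniform (u : nat -> X -> R) (v : X -> R) (C : R) : 0 <= C ->
  (forall N, holder a C (u N)) -> holder a C v ->
  (forall x, u N x @[N --> natU] --> v x) ->
  forall e : R, 0 < e -> \forall N \near natU, forall x, `|u N x - v x| <= e.
Proof.
move=> C0 uC vC uv e e0.
apply: contrapT => h.
have h' : \forall N \near natU, exists x, e < `|u N x - v x|.
  have [//|nA] := in_ultra_setVsetC [set N | forall x, `|u N x - v x| <= e] natU_ultra.
  apply: filterS nA => N /existsNP[x] /negP; rewrite -ltNge => xe; exists x.
  exact: xe.
have /choice[xs xsP] : forall N, exists x, (exists x, e < `|u N x - v x|) ->
    e < `|u N x - v x|.
  move=> N; have [[x xe]|nx] := pselect (exists x, e < `|u N x - v x|).
    by exists x.
  by exists point => /nx.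
have [x _ xsx] := compact_natU cX (fun N => I : [set: X] (xs N)).
have C1 : 0 < C + 1 by rewrite ltr_wpDl.
have e3 : 0 < e / 3 / (C + 1) by rewrite !divr_gt0.
have near0 : \forall N \near natU, C * mdist x (xs N) `^ a <= e / 3.
  have d0 : 0 < (e / 3 / (C + 1)) `^ a^-1 by rewrite powR_gt0.
  have /mdist_cvgP/(_ _ d0) := xsx; apply: filterS => N Nd.
  have Nd' : mdist x (xs N) `^ a <= e / 3 / (C + 1).
    have := ge0_ler_powR (ltW a_gt0) _ _ (ltW Nd).
    rewrite !nnegrE mdist_ge0 powR_ge0 => /(_ isT isT).
    by rewrite -powRrM mulVf ?gt_eqF// powRr1// ltW.
  apply: (@le_trans _ _ ((C + 1) * (e / 3 / (C + 1)))).
    by rewrite ler_pM ?powR_ge0// lerDl.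
  by rewrite mulrC divfK// gt_eqF.
have nearx : \forall N \near natU, `|v x - u N x| < e / 3.
  by move/cvgrPdist_lt : (uv x) => /(_ _ (divr_gt0 e0 _)); apply.
have : \forall N \near natU, False.
  near=> N.
  have e1 : e < `|u N (xs N) - v (xs N)| by apply: xsP; near: N.
  have e2 : `|v x - u N x| < e / 3 by near: N.
  have e4 : C * mdist x (xs N) `^ a <= e / 3 by near: N.
  have e5 := uC N x (xs N); have e6 := vC x (xs N).
  have : `|u N (xs N) - v (xs N)| <=
      `|u N x - u N (xs N)| + `|v x - u N x| + `|v x - v (xs N)|.
    have -> : u N (xs N) - v (xs N) =
      - (u N x - u N (xs N)) - (v x - u N x) + (v x - v (xs N)) by ring.
    by rewrite (le_trans (ler_normD _ _))// lerD2r (le_trans (ler_normB _ _))// normrN.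
  lra.
by case/filter_ex.
Unshelve. all: by end_near. Qed.

(** By [equi_holder] the averages are uniformly Hoelder, so their pointwise limit is Hoelder and
    uniform. Uniformity lets [iter m P] pass to the limit, where the telescoped difference of at
    most [2 * M / N] disappears. *)
Lemma birkhoff_fixed_point m C M (u : X -> R) : 0 <= C -> holder a C u ->
  (forall x, `|u x| <= M) ->
  exists v : X -> R,
    [/\ holder_class a v, iter m P v = v,
        (forall x, N%:R^-1 * \sum_(j < N) iter (m * j) P u x @[N --> natU] --> v x) &
        (forall e : R, 0 < e -> \forall N \near natU, forall x,
          `|N%:R^-1 * \sum_(j < N) iter (m * j) P u x - v x| <= e)].
Proof.
move=> C0 hu uM; have Hu : holder_class a u by exists C.
have M0 : 0 <= M := le_trans (normr_ge0 _) (uM point).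
set D := Num.max (lip_moment a ^+ n * C) (2 * M / r `^ a).
have D0 : 0 <= D by rewrite le_max divr_ge0 ?orbT ?mulr_ge0// ltW.
pose A N x := N%:R^-1 * \sum_(j < N) iter (m * j) P u x.
have sumD N (F : 'I_N -> R) B : 0 <= B -> (forall j, `|F j| <= B) ->
    `|N%:R^-1 * \sum_(j < N) F j| <= B.
  move=> B0 FB; case: N F FB => [|N] F FB; first by rewrite big_ord0 mulr0 normr0.
  rewrite normrM ger0_norm ?invr_ge0// ler_pdivrMl//.
  apply: (le_trans (ler_norm_sum _ _ _)).
  apply: (le_trans (ler_sum _ (fun j _ => FB j))).
  by rewrite sumr_const card_ord mulr_natl.
have AD N : holder a D (A N).
  move=> x y; rewrite /A -mulrBr -sumrB; apply: sumD.
    by rewrite mulr_ge0// powR_ge0.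
  by move=> j; exact: equi_holder.
have AM N x : `|A N x| <= M.
  by apply: sumD => // j; exact: Pn_bound Hu uM x.
have /choice[v vP] : forall x, exists l : R, A N x @[N --> natU] --> l.
  by move=> x; have := bounded_natU (fun N => AM N x); exists (lim (A N x @[N --> natU])).
have vD : holder a D v.
  move=> x y; apply: (@ler_cvg_to _ natU _ _ (fun N => `|A N x - A N y|)
    (fun=> D * mdist x y `^ a)).
  - by apply: cvg_norm; apply: cvgB; exact: vP.
  - exact: cvg_cst.
  - by apply: nearW => N; exact: AD.
have vU := natU_uniform D0 AD vD vP.
have Hv : holder_class a v by exists D.
exists v; split => //; apply/funext => x.
apply/eqP; rewrite -subr_eq0 -normr_le0; apply/ler_addgt0Pr => e e0; rewrite add0r.
have e3 : 0 < e / 3 by rewrite divr_gt0.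
have near_small : \forall N \near natU, N%:R^-1 * (M + M) <= e / 3.
  apply: natU_oo; near=> N; rewrite ler_pdivrMl ?ltr0n; last by near: N; exact: nbhs_infty_gt.
  by rewrite -ler_pdivrMr// ltW//; near: N; exact: nbhs_infty_gtr.
have : \forall N \near natU, `|iter m P v x - v x| <= e.
  near=> N.
  have N1 : (0 < N)%N by near: N; exact: natU_ge.
  have hA : forall y, `|A N y - v y| <= e / 3 by near: N; exact: vU.
  have HA : holder_class a (A N) by exists D.
  have h1 : `|iter m P (A N) x - iter m P v x| <= e / 3.
    have HvN : holder_class a (fun y => -1 * v y) by exact: holder_classZ.
    have HAv : holder_class a (fun y => A N y + -1 * v y) by exact: holder_classD.
    have -> : iter m P (A N) x - iter m P v x = iter m P (fun y => A N y + -1 * v y) x.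
      by rewrite (PnD m HA HvN) (PnZ m (-1) Hv) mulN1r.
    by apply: Pn_bound => // y; rewrite mulN1r.
  have PA : iter m P (A N) x = N%:R^-1 * \sum_(j < N) iter (m * j.+1) P u x.
    rewrite /A PnZ; last by apply: holder_class_sum => j; exact: Pn_class.
    rewrite (iter_koopman_sum a_gt0)//; last by move=> j; exact: Pn_class.
    by congr (_ * _); apply: eq_bigr => j _; rewrite -iterD mulnS.
  have h2 : `|iter m P (A N) x - A N x| <= e / 3.
    have -> : iter m P (A N) x - A N x = N%:R^-1 * (iter (m * N) P u x - u x).
      rewrite PA /A -mulrBr -sumrB; congr (_ * _).
      rewrite -(big_mkord xpredT (fun j => iter (m * j.+1) P u x - iter (m * j) P u x)).
      by rewrite (telescope_sumr (fun j => iter (m * j) P u x))// muln0.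
    rewrite normrM ger0_norm ?invr_ge0//.
    apply: (@le_trans _ _ (N%:R^-1 * (M + M))).
      rewrite ler_wpM2l ?invr_ge0// (le_trans (ler_normB _ _))// lerD//.
      exact: Pn_bound.
    by near: N; exact: near_small.
  have h3 := hA x.
  have -> : iter m P v x - v x = - (iter m P (A N) x - iter m P v x) +
    (iter m P (A N) x - A N x) + (A N x - v x) by ring.
  apply: (le_trans (ler_normD _ _)); have := ler_normD (- (iter m P (A N) x - iter m P v x))
    (iter m P (A N) x - A N x); rewrite normrN; lra.
by case/filter_ex.
Unshelve. all: by end_near. Qed.

Lemma koopman_linear : exists Q : {linear hoelder_space X a -> hoelder_space X a},
  forall u, hoelder_fun (Q u) = P (hoelder_fun u).
Proof.
pose Q (u : hoelder_space X a) : hoelder_space X a :=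
  hoelder_of cX a_gt0
    (holder_class_koopman a_gt0 a_beta (hoelder_space_class cX a_gt0 u)).
have Q_linear : linear Q.
  move=> c u v; apply/val_inj; rewrite /=.
  have hu := hoelder_space_class cX a_gt0 u.
  have hv := hoelder_space_class cX a_gt0 v.
  rewrite -[LHS]/(iter 1 P (fun x => c * u x + v x)) PnD//; last exact: holder_classZ.
  by rewrite PnZ.
by exists (linear_map_of Q_linear).
Qed.

Lemma iter_koopman_linear (Q : {linear hoelder_space X a -> hoelder_space X a}) N :
  (forall u, hoelder_fun (Q u) = P (hoelder_fun u)) ->
  exists QN : {linear hoelder_space X a -> hoelder_space X a},
    (forall u, QN u = iter N Q u) /\
    forall u, hoelder_fun (QN u) = iter N P (hoelder_fun u).
Proof.
move=> QP; elim: N => [|N [QN [h1 h2]]]; first by exists idfun.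
exists (Q \o QN); split => u /=; first by rewrite h1.
by rewrite QP h2.
Qed.

Lemma operator_norm_le (g : hoelder_space X a -> hoelder_space X a) (c : R) :
  (forall u, `|u| <= 1 -> `|g u| <= c) -> (operator_norm g <= c%:E)%E.
Proof. by move=> gc; apply: ge_ereal_sup => _ [u /= u1 <-]; rewrite lee_fin gc. Qed.

(** The compact operator is [iter (k * n) P] after the interpolation [proj] on a net. The order of
    choices matters: [e] makes [u - proj u] uniformly small, the partition then fixes its possibly
    large Hoelder bound [1 + c0], and only then is [k] chosen so that [q ^+ k] absorbs that bound.
    Each part of the norm is at most [1 / 4]. *)
Lemma koopman_quasi_compact : quasi_compact (@hoelder_fun R X a) P.
Proof.
have [Q QP] := koopman_linear.
have classE u := hoelder_space_class cX a_gt0 u.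
have bnd (u : hoelder_space X a) : `|u| <= 1 ->
    holder a 1 u /\ forall x, `|u x| <= 1.
  move=> u1; have [_ h1 h2] := hoelder_norm_bounds cX a_gt0 (classE u).
  split; first by apply: holder_le h2; exact: u1.
  by move=> x; apply: le_trans (h1 x) u1.
have norm_le (u : hoelder_space X a) C M : 0 <= C -> holder a C u ->
    (forall x, `|u x| <= M) -> `|u| <= M + C.
  exact: hoelder_norm_le.
have [e e0 esmall] : exists2 e : R, 0 < e & e `^ a * (1 + 2 / r `^ a) <= 4^-1.
  pose t : R := 4^-1 / (1 + 2 / r `^ a).
  have t0 : 0 < t by rewrite divr_gt0// ltr_pwDl// divr_ge0// ltW.
  exists (t `^ a^-1); first exact: powR_gt0.
  rewrite -powRrM mulVf ?gt_eqF// powRr1 ?(ltW t0)// divfK// gt_eqF//.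
  by rewrite ltr_pwDl// divr_ge0// ltW.
have [m [D [chi [chi_class chi_ge0 chi_sum chi_supp]]]] :=
  holder_partition cX a_gt0 a_le1 e0.
pose chiE i : hoelder_space X a := hoelder_of cX a_gt0 (chi_class i).
pose c0 : R := \sum_(i < m) `|chiE i|.
have c00 : 0 <= c0 by apply: sumr_ge0.
have [k kP] : exists k, q ^+ k * (1 + c0) <= 4^-1.
  apply: geometric_le; last by rewrite invr_gt0.
    by rewrite addr_ge0.
  by rewrite (ltW q_gt0).
have [QN [QNE QNP]] := iter_koopman_linear (k * n) QP.
pose proj (u : hoelder_space X a) : hoelder_space X a := \sum_(i < m) u (D i) *: chiE i.
pose K u := QN (proj u).
have K_linear : linear K.
  move=> c u v; rewrite /K -linearP; congr (QN _).
  rewrite /proj scaler_sumr -big_split/=; apply: eq_bigr => i _.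
  by rewrite scalerDl scalerA.
have projE u x : proj u x = \sum_(i < m) u (D i) * chi i x.
  rewrite /proj; elim/big_rec2 : _ => // i y1 y2 _ <-.
  by [].
exists Q; split => //.
  apply: (@le_lt_trans _ _ (1 + 1 * lip_moment a)%:E); last exact: ltry.
  apply: operator_norm_le => u /bnd[h1 h2].
  have B1 : 0 <= lip_moment a by apply: le_trans (lip_moment_ge1 a_gt0 a_beta).
  apply: norm_le; first by rewrite mul1r.
    by rewrite QP; exact: holder_koopman.
  by move=> x; rewrite QP; exact: (Pn_bound 1).
exists (linear_map_of K_linear), (k * n)%N; split.
  pose s := [seq QN (chiE i) | i <- iota 0 m].
  apply: precompact_subset (precompact_bounded_combinations s 1).
  move=> _ [u /= /bnd[_ u1] <-]; exists (fun i => u (D i)) => //.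
  rewrite /linear_map_of /K /proj linear_sum size_map size_iota.
  apply: eq_bigr => i _; rewrite linearZ/=; congr (_ *: _).
  by rewrite (nth_map 0%N) ?size_iota// nth_iota.
apply: (@le_lt_trans _ _ (2^-1)%:E); last by rewrite lte_fin invf_lt1// ltr1n.
apply: operator_norm_le => u /bnd[u1 u2].
pose v : hoelder_space X a := u - proj u.
have -> : iter (k * n) Q u - linear_map_of K_linear u = QN v.
  by rewrite -QNE /v linearB.
have vE x : v x = \sum_(i < m) (u x - u (D i)) * chi i x.
  rewrite -[LHS]/(u x - proj u x) projE.
  rewrite -[X in X - _]mulr1 -(chi_sum x) mulr_sumr -sumrB.
  by apply: eq_bigr => i _; rewrite mulrBl.
have ve x : `|v x| <= e `^ a.
  rewrite vE; apply: (le_trans (ler_norm_sum _ _ _)).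
  rewrite -[leRHS]mulr1 -(chi_sum x) mulr_sumr; apply: ler_sum => i _.
  rewrite normrM (ger0_norm (chi_ge0 _ _)).
  have [->|ci] := eqVneq (chi i x) 0; first by rewrite !mulr0.
  rewrite ler_wpM2r//; apply: (le_trans (u1 _ _)); rewrite mul1r.
  by rewrite ge0_ler_powR ?nnegrE ?mdist_ge0 ?(ltW a_gt0) ?(ltW e0)// chi_supp.
have vh : holder a (1 + c0) v.
  have hp : holder a c0 (proj u).
    have : `|proj u| <= c0.
      apply: (le_trans (ler_norm_sum _ _ _)); apply: ler_sum => i _.
      by rewrite normrZ -[leRHS]mul1r ler_wpM2r.
    by have [_ _ h2] := hoelder_norm_bounds cX a_gt0 (classE (proj u)) => h;
      apply: holder_le h2.
  move=> x y; rewrite mulrDl; apply: le_trans (lerD (u1 x y) (hp x y)).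
  rewrite -[v x]/(u x - proj u x) -[v y]/(u y - proj u y).
  have -> : u x - proj u x - (u y - proj u y) = (u x - u y) - (proj u x - proj u y).
    by ring.
  exact: ler_normB.
have c10 : 0 <= 1 + c0 by rewrite addr_ge0.
have LY := lasota_yorke_iter k c10 vh ve.
have ea0 : 0 <= e `^ a by exact: powR_ge0.
have e4 : e `^ a + 2 * e `^ a / r `^ a <= 4^-1.
  by apply: le_trans esmall; rewrite mulrDr mulr1 (mulrC 2) -mulrA.
have er0 : 0 <= 2 * e `^ a / r `^ a by rewrite divr_ge0 ?mulr_ge0// ltW.
apply: (@le_trans _ _ (e `^ a + Num.max (q ^+ k * (1 + c0)) (2 * e `^ a / r `^ a))).
  apply: norm_le.
  - by rewrite le_max er0 orbT.
  - by rewrite QNP.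
  - by move=> x; rewrite QNP; exact: Pn_bound.
have : Num.max (q ^+ k * (1 + c0)) (2 * e `^ a / r `^ a) <= 4^-1.
  by rewrite ge_max kP/=; lra.
lra.
Qed.

(** * Peripheral spectrum *)

Local Open Scope complex_scope.

Local Notation cRe := (@complex.Re R).
Local Notation cIm := (@complex.Im R).

Definition holder_complex (phi : X -> R[i]) : Prop :=
  holder_class a (cRe \o phi) /\ holder_class a (cIm \o phi).

Lemma complexified_spaceP (phi : X -> R[i]) :
  complexified_space (@hoelder_fun R X a) phi <-> holder_complex phi.
Proof.
split=> [[u [v uv]]|[hu hv]].
  split; [rewrite (_ : _ \o _ = u); first exact: (hoelder_space_class cX a_gt0)|
          rewrite (_ : _ \o _ = v); first exact: (hoelder_space_class cX a_gt0)];
  by apply/funext => x /=; rewrite uv.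
exists (hoelder_of cX a_gt0 hu), (hoelder_of cX a_gt0 hv) => x /=.
by case: (phi x).
Qed.

Lemma holder_complex_real u : holder_class a u -> holder_complex (fun x => (u x)%:C).
Proof. by move=> hu; split => //; exact: holder_class_cst. Qed.

Lemma holder_complexD (phi psi : X -> R[i]) : holder_complex phi ->
  holder_complex psi -> holder_complex (fun x => phi x + psi x).
Proof.
move=> [h1 h2] [h3 h4]; split.
  rewrite (_ : _ \o _ = (fun x => cRe (phi x) + cRe (psi x))); first exact: holder_classD.
  by apply/funext => x /=; case: (phi x) => ? ?; case: (psi x).
rewrite (_ : _ \o _ = (fun x => cIm (phi x) + cIm (psi x))); first exact: holder_classD.
by apply/funext => x /=; case: (phi x) => ? ?; case: (psi x).
Qed.

Let cReM (c z : R[i]) : cRe (c * z) = cRe c * cRe z + - cIm c * cIm z.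
Proof. by case: c => ? ?; case: z => ? ? /=; ring. Qed.

Let cImM (c z : R[i]) : cIm (c * z) = cRe c * cIm z + cIm c * cRe z.
Proof. by case: c => ? ?; case: z => ? ? /=; ring. Qed.

Lemma holder_complexZ (c : R[i]) (phi : X -> R[i]) : holder_complex phi ->
  holder_complex (fun x => c * phi x).
Proof.
move=> [h1 h2]; split.
  rewrite (_ : _ \o _ = (fun x => cRe c * cRe (phi x) + - cIm c * cIm (phi x))).
    by apply: holder_classD; exact: holder_classZ.
  by apply/funext => x /=; rewrite cReM.
rewrite (_ : _ \o _ = (fun x => cRe c * cIm (phi x) + cIm c * cRe (phi x))).
  by apply: holder_classD; exact: holder_classZ.
by apply/funext => x /=; rewrite cImM.
Qed.

Local Notation Pc := (complexified P).

Lemma holder_complex_complexified (phi : X -> R[i]) : holder_complex phi ->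
  holder_complex (Pc phi).
Proof.
by move=> [h1 h2]; split; exact: (holder_class_koopman a_gt0 a_beta).
Qed.

Lemma complexifiedD (phi psi : X -> R[i]) : holder_complex phi ->
  holder_complex psi -> Pc (fun x => phi x + psi x) = (fun x => Pc phi x + Pc psi x).
Proof.
move=> [h1 h2] [h3 h4]; apply/funext => x; rewrite /complexified.
rewrite (_ : (fun y => cRe (phi y + psi y)) = (fun y => cRe (phi y) + cRe (psi y))).
  rewrite (_ : (fun y => cIm (phi y + psi y)) = (fun y => cIm (phi y) + cIm (psi y))).
    apply/eqP; rewrite eq_complex; apply/andP; split; apply/eqP.
      exact: (congr1 (@^~ x) (PnD 1 h1 h3)).
    exact: (congr1 (@^~ x) (PnD 1 h2 h4)).
  by apply/funext => y; case: (phi y) => ? ?; case: (psi y).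
by apply/funext => y; case: (phi y) => ? ?; case: (psi y).
Qed.

Lemma complexifiedZ (c : R[i]) (phi : X -> R[i]) : holder_complex phi ->
  Pc (fun x => c * phi x) = (fun x => c * Pc phi x).
Proof.
move=> [h1 h2]; apply/funext => x; rewrite /complexified.
rewrite (_ : (fun y => cRe (c * phi y)) =
    (fun y => cRe c * cRe (phi y) + - cIm c * cIm (phi y))); last first.
  by apply/funext => y; rewrite cReM.
rewrite (_ : (fun y => cIm (c * phi y)) =
    (fun y => cRe c * cIm (phi y) + cIm c * cRe (phi y))); last first.
  by apply/funext => y; rewrite cImM.
have lin (t1 t2 : R) (u v : X -> R) (hu : holder_class a u) (hv : holder_class a v) :
    P (fun y => t1 * u y + t2 * v y) x = t1 * P u x + t2 * P v x.
  have hu' := holder_classZ t1 hu; have hv' := holder_classZ t2 hv.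
  etransitivity; first exact: (congr1 (@^~ x) (PnD 1 hu' hv')).
  by congr (_ + _); [exact: (congr1 (@^~ x) (PnZ 1 t1 hu))|
    exact: (congr1 (@^~ x) (PnZ 1 t2 hv))].
apply/eqP; rewrite eq_complex cReM cImM; apply/andP; split; apply/eqP.
  exact: lin h1 h2.
exact: lin h2 h1.
Qed.

Lemma complexified_real u : Pc (fun x => (u x)%:C) = (fun x => (P u x)%:C).
Proof.
apply/funext => x; rewrite /complexified.
by congr (_ +i* _); exact: (congr1 (@^~ x) (koopman_cst 0)).
Qed.

Lemma iter_koopman_eigen (lambda : R[i]) (phi : X -> R[i]) k : holder_complex phi ->
  (forall x, Pc phi x = lambda * phi x) ->
  (forall x, iter k P (cRe \o phi) x = cRe (lambda ^+ k * phi x)) /\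
  (forall x, iter k P (cIm \o phi) x = cIm (lambda ^+ k * phi x)).
Proof.
move=> hphi eig; elim: k => [|k [ih1 ih2]]; first by split=> x; rewrite mul1r.
have E x : P (iter k P (cRe \o phi)) x +i* P (iter k P (cIm \o phi)) x =
    lambda ^+ k.+1 * phi x.
  have -> : iter k P (cRe \o phi) = (fun x => cRe (lambda ^+ k * phi x)).
    exact/funext.
  have -> : iter k P (cIm \o phi) = (fun x => cIm (lambda ^+ k * phi x)).
    exact/funext.
  rewrite -[LHS]/(Pc (fun x => lambda ^+ k * phi x) x) complexifiedZ//.
  by rewrite eig exprSr mulrA.
by split=> x; rewrite /= -E.
Qed.

Lemma koopman_eq0_ae k (u : X -> R) x : holder_class a u -> (forall y, 0 <= u y) ->
  iter k P u x = 0 -> {ae Pr, forall w, u (fiter f k w x) = 0}.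
Proof.
move=> hu u0; rewrite (iter_koopmanE a_gt0)// => E.
have iu := koopman_integrable a_gt0 k x hu.
have mu : measurable_fun setT (EFin \o (fun w => u (fiter f k w x))).
  by case/integrableP: iu.
have := (ae_eq_integral_abs Pr measurableT mu).1.
under eq_integral do rewrite /= ger0_norm//.
rewrite EFin_Rintegral// E => /(_ erefl); apply: filterS => w /(_ I) /=.
by case.
Qed.

(** Moduli are compared through their squares, which are Hoelder functions whenever [phi] is. *)
Definition maximum_modulus (phi : X -> R[i]) : set X :=
  [set x | forall y, cRe (phi y) ^+ 2 + cIm (phi y) ^+ 2 <=
    cRe (phi x) ^+ 2 + cIm (phi x) ^+ 2].

Lemma maximum_modulus_nonempty phi : holder_complex phi -> maximum_modulus phi !=set0.
Proof.
move=> [h1 h2]; apply: compact_maximum cX _.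
apply: (holder_class_continuous a_gt0).
by apply: holder_classD; rewrite /=; under [X in holder_class _ X]funext do rewrite expr2;
  exact: (holder_classM cX a_gt0).
Qed.

(* Equality case of the triangle inequality for the mean [lambda ^+ k * phi x] of
   [phi (fiter f k w x)], whose values have modulus at most that of the mean. *)
Lemma maximum_modulus_ae (lambda : R[i]) (phi : X -> R[i]) k : holder_complex phi ->
  (forall x, Pc phi x = lambda * phi x) -> `|lambda| = 1 ->
  {ae Pr, forall w, forall x, maximum_modulus phi x ->
    phi (fiter f k w x) = lambda ^+ k * phi x}.
Proof.
move=> hphi eig l1; have [h1 h2] := hphi.
pose A := maximum_modulus phi.
have A0 : A !=set0 := maximum_modulus_nonempty hphi.
have [D [AD dD]] := compact_dense_seq cX A0.
have lk1 : ComplexField.Normc.normc (lambda ^+ k) = 1.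
  by rewrite normcX norm_eq1_normc// expr1n.
have [E1 E2] := iter_koopman_eigen k hphi eig.
have pt x : A x -> {ae Pr, forall w, phi (fiter f k w x) = lambda ^+ k * phi x}.
  move=> Ax; set c := lambda ^+ k * phi x.
  set m := cRe (phi x) ^+ 2 + cIm (phi x) ^+ 2.
  have cm : cRe c ^+ 2 + cIm c ^+ 2 = m.
    by rewrite -normc_sqr ComplexField.Normc.normcM lk1 mul1r normc_sqr.
  (* Being affine in [phi], [g] has a mean given by the eigenvalue equation, namely 0 at [x]. It
     dominates the squared distance from [phi] to [c], because both have squared modulus at most
     [m]. *)
  pose g y : R := 2 * m + (- (2 * cRe c) * cRe (phi y) + - (2 * cIm c) * cIm (phi y)).
  have hg1 : holder_class a (fun y => - (2 * cRe c) * cRe (phi y)) by exact: holder_classZ.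
  have hg2 : holder_class a (fun y => - (2 * cIm c) * cIm (phi y)) by exact: holder_classZ.
  have hg3 : holder_class a (fun y => - (2 * cRe c) * cRe (phi y) + - (2 * cIm c) * cIm (phi y)).
    exact: holder_classD.
  have hg : holder_class a g by apply: holder_classD => //; exact: holder_class_cst.
  have gE y : (cRe (phi y) - cRe c) ^+ 2 + (cIm (phi y) - cIm c) ^+ 2 <= g y.
    by have := Ax y; rewrite -/m /g; move: cm => <-; rewrite !sqrrB; lra.
  have g0 y : 0 <= g y by apply: le_trans (gE y); rewrite addr_ge0// sqr_ge0.
  have Pg : iter k P g x = 0.
    rewrite (PnD k (holder_class_cst a (2 * m)) hg3) (PnD k hg1 hg2).
    rewrite (PnZ k _ h1) (PnZ k _ h2) iter_koopman_cst E1 E2 -/c.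
    by rewrite -cm; ring.
  have := koopman_eq0_ae hg g0 Pg; apply: filterS => w gw.
  have := gE (fiter f k w x); rewrite gw => le0.
  have s1 := sqr_ge0 (cRe (phi (fiter f k w x)) - cRe c).
  have s2 := sqr_ge0 (cIm (phi (fiter f k w x)) - cIm c).
  apply/eqP; rewrite eq_complex -subr_eq0 -sqrf_eq0 -(subr_eq0 (cIm _)).
  rewrite -(sqrf_eq0 (_ - cIm _)) !eq_le s1 s2 !andbT.
  by apply/andP; split; lra.
(* A dense sequence in [A] and the continuity of [phi] and of the iterates make the null set
   independent of the point. *)
have := ae_foralln (fun i => pt (D i) (AD i)); apply: filterS => w wD x Ax.
have Lk0 : 0 <= lip_prod k w by apply: le_trans (lip_prod_ge1 k w).
have hd1 : holder_class a (fun y => cRe (phi (fiter f k w y)) +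
    -1 * cRe (lambda ^+ k * phi y)).
  apply: holder_classD; first exact: (holder_class_comp a_gt0 Lk0 (@fiter_lip k w) h1).
  by apply: holder_classZ; exact: (holder_complexZ _ hphi).1.
have hd2 : holder_class a (fun y => cIm (phi (fiter f k w y)) +
    -1 * cIm (lambda ^+ k * phi y)).
  apply: holder_classD; first exact: (holder_class_comp a_gt0 Lk0 (@fiter_lip k w) h2).
  by apply: holder_classZ; exact: (holder_complexZ _ hphi).2.
have z1 := holder_class_dense0 a_gt0 hd1 _ (dD x Ax).
have z2 := holder_class_dense0 a_gt0 hd2 _ (dD x Ax).
have e1 : cRe (phi (fiter f k w x)) = cRe (lambda ^+ k * phi x).
  apply/eqP; rewrite -subr_eq0 -mulN1r z1// => i.
  by rewrite wD mulN1r subrr.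
have e2 : cIm (phi (fiter f k w x)) = cIm (lambda ^+ k * phi x).
  apply/eqP; rewrite -subr_eq0 -mulN1r z2// => i.
  by rewrite wD mulN1r subrr.
by apply/eqP; rewrite eq_complex e1 e2 !eqxx.
Qed.

Lemma maximum_modulus_closed phi : holder_complex phi -> closed (maximum_modulus phi).
Proof.
move=> [h1 h2].
have hm : holder_class a (fun x => cRe (phi x) ^+ 2 + cIm (phi x) ^+ 2).
  by apply: holder_classD; rewrite /=; under [X in holder_class _ X]funext do rewrite expr2;
    exact: (holder_classM cX a_gt0).
have cm := holder_class_continuous a_gt0 hm.
rewrite (_ : maximum_modulus phi = \bigcap_y
  [set x | cRe (phi y) ^+ 2 + cIm (phi y) ^+ 2 <= cRe (phi x) ^+ 2 + cIm (phi x) ^+ 2]).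
  apply: closed_bigI => y _.
  exact: (closed_comp (fun x _ => cm x) (@closed_ge _ _)).
by apply/seteqP; split => x /= h y; [move=> _; exact: h|exact: h].
Qed.

Section peripheral.
Variables (lambda : R[i]) (phi : X -> R[i]).
Hypothesis hphi : holder_complex phi.
Hypothesis eig : forall x, Pc phi x = lambda * phi x.
Hypothesis lambda1 : `|lambda| = 1.
Hypothesis phi_neq0 : exists x, phi x != 0.
Let A := maximum_modulus phi.
Local Notation normc := ComplexField.Normc.normc.

Let lambdaX k : normc (lambda ^+ k) = 1.
Proof. by rewrite normcX norm_eq1_normc// expr1n. Qed.

Let normc_phi x y : A x -> A y -> normc (phi x) = normc (phi y).
Proof.
move=> Ax Ay; apply/eqP; rewrite -(@eqrXn2 _ 2)// ?normc_ge0//.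
by rewrite !normc_sqr eq_le Ax Ay.
Qed.

Lemma maximum_modulus_neq0 x : A x -> phi x != 0.
Proof.
move=> Ax; have [y y0] := phi_neq0; apply: contra_neq y0 => x0.
apply: ComplexField.Normc.eq0_normc; apply/eqP; rewrite -sqrf_eq0 eq_le sqr_ge0 andbT.
by rewrite normc_sqr (le_trans (Ax y))// x0 /= expr0n/= addr0.
Qed.

Let A_of_modulus x y : A x -> normc (phi y) = normc (phi x) -> A y.
Proof. by move=> Ax xy z; rewrite -!normc_sqr xy !normc_sqr; exact: Ax. Qed.

Lemma peripheral_ae k : {ae Pr, forall w, forall x, A x ->
  A (fiter f k w x) /\ phi (fiter f k w x) = lambda ^+ k * phi x}.
Proof.
have := maximum_modulus_ae k hphi eig lambda1; apply: filterS => w h x Ax.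
have hx := h x Ax; split=> //; apply: (A_of_modulus Ax).
by rewrite hx ComplexField.Normc.normcM lambdaX mul1r.
Qed.

(* On [A] all the powers of [phi], normalised to modulus 1, satisfy the equivariance
   of [phi] and hence, by contraction, the same Hoelder bound; nearby values of
   [phi] thus have a quotient whose powers all remain close to 1. *)
Lemma peripheral_locally_constant : exists2 e : R, 0 < e &
  forall x y, A x -> A y -> mdist x y < e -> phi x = phi y.
Proof.
have [x0 Ax0] : A !=set0 := maximum_modulus_nonempty hphi.
pose g x := phi x / phi x0.
have g1 k x : A x -> normc (g x ^+ k) = 1.
  move=> Ax; rewrite normcX ComplexField.Normc.normcM ComplexField.Normc.normcV.
  rewrite (normc_phi Ax Ax0) mulfV ?expr1n//.
  by apply: contra_neq (maximum_modulus_neq0 Ax0) => /ComplexField.Normc.eq0_normc.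
have [K K0 gK] : exists2 K : R, 0 <= K & forall x y, normc (g x - g y) <= K * mdist x y `^ a.
  case: hphi => -[C1 C10 h1] [C2 C20 h2].
  exists (normc (phi x0)^-1 * (C1 + C2)).
    by rewrite mulr_ge0 ?normc_ge0// addr_ge0.
  move=> x y; rewrite /g -mulrBl mulrC ComplexField.Normc.normcM -mulrA.
  rewrite ler_wpM2l ?normc_ge0// mulrDl (le_trans (normc_le_ReIm _))//.
  apply: lerD.
    have -> : cRe (phi x - phi y) = cRe (phi x) - cRe (phi y).
      by case: (phi x) => ? ?; case: (phi y).
    exact: h1.
  have -> : cIm (phi x - phi y) = cIm (phi x) - cIm (phi y).
    by case: (phi x) => ? ?; case: (phi y).
  exact: h2.
pose bound k (C : R) := forall x y, A x -> A y ->
  normc (g x ^+ k - g y ^+ k) <= C * mdist x y `^ a.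
(* This bound grows with [k]; it only has to be finite, as a start for the iteration of [step]. *)
have gX k : exists2 C : R, 0 <= C & bound k C.
  elim: k => [|k [C C0 ih]].
    by exists 0 => // x y _ _; rewrite subrr ComplexField.Normc.normc0 mul0r.
  exists (C + K); first exact: addr_ge0.
  move=> x y Ax Ay; have -> : g x ^+ k.+1 - g y ^+ k.+1 =
      g x * (g x ^+ k - g y ^+ k) + (g x - g y) * g y ^+ k by rewrite !exprS; ring.
  rewrite [leRHS]mulrDl; apply: (le_trans (le_normcD _ _)); rewrite (ComplexField.Normc.normcM (g x)).
  have gx1 : normc (g x) = 1 by rewrite -[g x]expr1; exact: g1.
  by rewrite (ComplexField.Normc.normcM (g x - g y)) gx1 (g1 k y Ay) mul1r mulr1 lerD// ih.
pose B : R := 2 / r `^ a.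
have B0 : 0 < B by rewrite divr_gt0.
(* Distant pairs use that the powers have modulus 1, whence the numerator 2 of [B]. For close pairs
   the orbit multiplies the difference by a number of modulus 1, so the contraction improves [C] to
   [q * C]. *)
have step k C : 0 <= C -> bound k C -> bound k (Num.max (q * C) B).
  move=> C0 hC x y Ax Ay; have [xyr|rxy] := ltP (mdist x y) r; last first.
    apply: (@le_trans _ _ 2).
      apply: (le_trans (le_normcD _ _)); rewrite normcN !g1//.
    apply: (@le_trans _ _ (B * r `^ a)); first by rewrite divfK// gt_eqF.
    rewrite ler_pM ?(ltW B0) ?powR_ge0// ?le_max ?lexx ?orbT//.
    by rewrite ge0_ler_powR ?nnegrE ?mdist_ge0 ?(ltW a_gt0) ?(ltW r_gt0).
  set c := normc _.
  have iD : Pr.-integrable setT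
      (EFin \o (fun w => C * mdist (fiter f n w x) (fiter f n w y) `^ a)).
    by apply: integrable_mulrl; exact: fiter_mdist_integrable.
  have cD : c <= \int[Pr]_w (C * mdist (fiter f n w x) (fiter f n w y) `^ a).
    rewrite -lee_fin -EFin_Rintegral// -[leLHS](integral_probability_cst Pr).
    apply: ae_ge0_le_integral => //.
    - by move=> w _; rewrite lee_fin normc_ge0.
    - by move=> w _; rewrite lee_fin mulr_ge0// powR_ge0.
    - by case/integrableP: iD.
    have := peripheral_ae n; apply: filterS => w h _; rewrite lee_fin.
    have [Ax' ex] := h x Ax; have [Ay' ey] := h y Ay.
    apply: le_trans (hC _ _ Ax' Ay').
    have -> : g (fiter f n w x) ^+ k - g (fiter f n w y) ^+ k =
        (lambda ^+ n) ^+ k * (g x ^+ k - g y ^+ k).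
      by rewrite mulrBr /g ex ey -!exprMn !mulrA.
    by rewrite ComplexField.Normc.normcM normcX lambdaX expr1n mul1r.
  apply: (le_trans cD); rewrite RintegralZl//; last exact: fiter_mdist_integrable.
  apply: (le_trans (ler_wpM2l C0 (contract xyr))).
  by rewrite mulrA (mulrC C) ler_wpM2r ?powR_ge0// le_max lexx.
have gB k : bound k B.
  have [C C0 hC] := gX k.
  have hj j : bound k (Num.max (q ^+ j * C) B).
    elim: j => [|j ih] x y Ax Ay.
      by apply: (le_trans (hC x y Ax Ay)); rewrite mul1r ler_wpM2r ?powR_ge0// le_max lexx.
    have m0 : 0 <= Num.max (q ^+ j * C) B by rewrite le_max (ltW B0) orbT.
    apply: (le_trans (step _ _ m0 ih x y Ax Ay)); rewrite ler_wpM2r ?powR_ge0//.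
    by apply: max_geometric_step; rewrite // !ltW.
  have q01 : 0 <= q < 1 by rewrite ltW.
  have [j jB] := geometric_le C0 q01 B0.
  by have := hj j; rewrite (max_idPr jB).
(* At distance less than [e] the common bound is [1 / 2], the threshold of [powers_close_to1]. *)
pose e : R := (2^-1 / B) `^ a^-1.
have t0 : 0 < 2^-1 / B by rewrite divr_gt0// invr_gt0.
exists e; first exact: powR_gt0.
move=> x y Ax Ay xye.
have ea : B * mdist x y `^ a <= 2^-1.
  rewrite mulrC -ler_pdivlMr//.
  have := ge0_ler_powR (ltW a_gt0) _ _ (ltW xye).
  rewrite !nnegrE mdist_ge0 powR_ge0 => /(_ isT isT).
  by rewrite -powRrM mulVf ?gt_eqF// powRr1// ltW.
have gx0 z : A z -> g z != 0 by move=> Az; rewrite mulf_neq0 ?invr_eq0 ?maximum_modulus_neq0.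
have : g x / g y = 1.
  apply: powers_close_to1 => k.
  have -> : (g x / g y) ^+ k - 1 = (g x ^+ k - g y ^+ k) / g y ^+ k.
    by rewrite expr_div_n mulrBl divff// expf_neq0// gx0.
  rewrite ComplexField.Normc.normcM ComplexField.Normc.normcV g1// invr1 mulr1.
  exact: le_trans (gB k x y Ax Ay) ea.
move=> /(congr1 (fun z => z * g y)); rewrite divfK ?gx0// mul1r /g.
by move=> /(congr1 (fun z => z * phi x0)); rewrite !divfK ?maximum_modulus_neq0.
Qed.

Lemma peripheral_orbit j x : A x -> exists y, A y /\ phi y = lambda ^+ j * phi x.
Proof.
move=> Ax; have [w h] := probability_ae_ex (peripheral_ae j).
by exists (fiter f j w x); exact: h.
Qed.

(** Pigeonhole: the values [lambda ^+ j * phi x0] are taken at points of the compact set of maxima;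
    two of them lie within [e] of each other, where [phi] is constant, so two powers of [lambda]
    coincide. *)
Lemma peripheral_root_of_unity : exists2 p, (0 < p)%N & lambda ^+ p = 1.
Proof.
have [e e0 he] := peripheral_locally_constant.
have [x0 Ax0] : A !=set0 := maximum_modulus_nonempty hphi.
have /choice[xs xsP] : forall j, exists x, A x /\ phi x = lambda ^+ j * phi x0.
  move=> j; exact: peripheral_orbit.
have e2 : 0 < e / 2 by rewrite divr_gt0.
have [m [D Dnet]] := compact_net cX e2.
have /choice[idx idxP] : forall j, exists i : 'I_m, mdist (xs j) (D i) < e / 2.
  by move=> j; have [i im h] := Dnet (xs j); exists (Ordinal im).
have : ~~ injectiveb (fun j : 'I_m.+1 => idx j).
  apply/negP => /injectiveP inj; have := leq_card _ inj.
  by rewrite !card_ord ltnn.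
move=> /injectivePn[j [l jl ijl]].
wlog lt_jl : j l jl ijl / (j < l)%N.
  move=> wl; have := jl; rewrite neq_ltn => /orP[|]; first exact: wl.
  by apply: wl; [rewrite eq_sym|].
have : phi (xs j) = phi (xs l).
  apply: he; [exact: (xsP j).1|exact: (xsP l).1|].
  have h1 := idxP j; have := idxP l; rewrite -ijl => h2.
  have := metric_triangle (xs j) (D (idx j)) (xs l).
  rewrite (metric_sym (D (idx j)) (xs l)); lra.
rewrite (xsP j).2 (xsP l).2 => /(mulIf (maximum_modulus_neq0 Ax0)) E.
exists (l - j)%N; first by rewrite subn_gt0.
have lj0 : lambda ^+ j != 0.
  apply/eqP => l0; have := lambdaX j.
  by rewrite l0 ComplexField.Normc.normc0 => /eqP; rewrite eq_sym oner_eq0.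
by apply: (mulfI lj0); rewrite mulr1 -exprD subnKC// ltnW.
Qed.

End peripheral.

(** * Spectral characterizations *)

Lemma Rintegral_fiter_ae k (u v : X -> R) x :
  {ae Pr, forall w, u (fiter f k w x) = v x} -> holder_class a u ->
  iter k P u x = v x.
Proof.
move=> uv hu; rewrite (iter_koopmanE a_gt0)//.
rewrite (ae_eq_Rintegral_nomeas uv); exact: Rintegral_probability_cst.
Qed.

(** Averages started at the fixed point of departure [x] equal [u x] when [P u = u], so some
    stationary measure integrates [u] to [u x]; uniqueness makes this value independent of [x]. *)
Lemma fixed_point_cst : uniquely_ergodic Pr f -> forall u, holder_class a u ->
  P u = u -> forall x y, u x = u y.
Proof.
move=> [_ ue] u hu Pu.
have KB x : exists mu : probability (borel X) R,
    stationary Pr f mu /\ \int[mu]_y u y = u x.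
  have [mu [st muP]] := krylov_bogoliubov a_gt0 a_beta a_le1 (fun=> x).
  exists mu; split=> //; apply: (cvg_unique _ (muP u hu)) => //.
  have iu j : iter j P u = u by elim: j => // j ih; rewrite iterS ih.
  apply: (@cvg_near_cst _ _ _ _ natU); near=> N.
  rewrite /birkhoff; under eq_bigr do rewrite iu.
  rewrite sumr_const card_ord -[u x *+ N]mulr_natl mulrA mulVf ?mul1r//.
  by rewrite pnatr_eq0 -lt0n; near: N; exact: natU_ge.
move=> x y; have [mu [smu <-]] := KB x; have [nu [snu <-]] := KB y.
congr fine; apply: eq_measure_integral => A mA _; exact: ue.
Unshelve. all: by end_near. Qed.

(** Integration against a stationary measure excludes a Jordan block above the constants. *)
Lemma koopman_addC_eq0 (u : X -> R) c : holder_class a u ->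
  (forall x, P u x = u x + c) -> c = 0.
Proof.
move=> hu Pu.
have [mu [st _]] := krylov_bogoliubov a_gt0 a_beta a_le1 (fun=> point).
have := (stationaryP a_gt0 a_beta a_le1 mu).1 st u hu.
have -> : P u = (fun x => u x + c) by exact/funext.
rewrite RintegralD//; [|exact: (holder_integrable a_gt0)|exact: probability_integrable_cst].
by rewrite Rintegral_probability_cst => /eqP; rewrite -subr_eq0 addrAC subrr add0r => /eqP.
Qed.

Lemma eigenfunction1 : eigenfunction (@hoelder_fun R X a) P 1 (fun=> 1).
Proof.
split.
- apply/complexified_spaceP.
  exact: (holder_complex_real (holder_class_cst a 1)).
- by exists point; rewrite oner_neq0.
move=> x; rewrite mul1r -[LHS]/(Pc (fun=> (1 : R)%:C) x).
by rewrite (complexified_real (fun=> 1)) koopman_cst.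
Qed.

(** If 1 is simple, Cesaro means of [u] tend uniformly to a fixed, hence constant, function, and
    this constant is the integral of [u] for every stationary measure. Conversely, by induction on
    the order of a generalised eigenfunction [psi], [P psi - psi] is constant, hence 0, and [psi] is
    itself fixed. *)
Lemma simple_eigenvalueP :
  simple_eigenvalue (@hoelder_fun R X a) P 1 <-> uniquely_ergodic Pr f.
Proof.
split=> [[phi [_ [x0 phix0] _] simple]|ue].
  split.
    by have [mu [st _]] := krylov_bogoliubov a_gt0 a_beta a_le1 (fun=> point); exists mu.
  have fixed_cst (v : X -> R) : holder_class a v -> P v = v -> forall x y, v x = v y.
    have cphi (u : X -> R) : holder_class a u -> P u = u ->
        exists c : R[i], forall x, (u x)%:C = c * phi x.
      move=> hu Pu; apply: (simple _ 1%N).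
        by apply/complexified_spaceP; exact: holder_complex_real.
      by move=> x /=; rewrite complexified_real Pu mul1r subrr.
    move=> hv Pv x y; have [c cv] := cphi v hv Pv.
    (* The constant 1 is also a multiple of [phi], which forces [phi] to be constant. *)
    have [c1 c1P] := cphi _ (holder_class_cst a 1) (koopman_cst 1).
    apply: complexI; rewrite !cv; congr (_ * _).
    have c10 : c1 != 0.
      apply: contraNneq (oner_neq0 R) => c10.
      by have := c1P x; rewrite c10 mul0r => -[->].
    by apply: (mulfI c10); rewrite -!c1P.
  move=> mu nu smu snu.
  have int_eq (u : X -> R) : holder_class a u ->
      \int[mu]_x u x = \int[nu]_x u x.
    move=> hu; have [C C0 hC] := hu; have [M uM] := holder_class_bounded cX a_gt0 hu.
    have [v [hv Pv _ vU]] := birkhoff_fixed_point 1 C0 hC uM.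
    suff int_v (m : probability (borel X) R) : stationary Pr f m ->
        \int[m]_x u x = v point by rewrite !int_v.
    move=> sm; have sP := (stationaryP a_gt0 a_beta a_le1 m).1 sm.
    have iP j : \int[m]_x iter j P u x = \int[m]_x u x.
      by elim: j => // j <-; rewrite iterS; apply: sP; exact: Pn_class.
    apply/eqP; rewrite -subr_eq0 -normr_le0; apply/ler_addgt0Pr => e e0; rewrite add0r.
    have : \forall N \near natU, `|\int[m]_x u x - v point| <= e.
      near=> N.
      have N0 : N%:R != 0 :> R by rewrite pnatr_eq0 -lt0n; near: N; exact: natU_ge.
      have hN : forall x, `|N%:R^-1 * \sum_(j < N) iter (1 * j) P u x - v x| <= e.
        by near: N; exact: vU.
      have iA : m.-integrable setT
          (EFin \o (fun x => N%:R^-1 * \sum_(j < N) iter (1 * j) P u x)).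
        apply: (holder_integrable a_gt0); apply: holder_classZ.
        by apply: holder_class_sum => j; exact: Pn_class.
      have <- : \int[m]_x (N%:R^-1 * \sum_(j < N) iter (1 * j) P u x) = \int[m]_x u x.
        rewrite RintegralZl//; last first.
          apply: (holder_integrable a_gt0).
          by apply: holder_class_sum => j; exact: Pn_class.
        rewrite Rintegral_sum; last first.
          by move=> j; apply: (holder_integrable a_gt0); exact: Pn_class.
        under eq_bigr do rewrite iP.
        by rewrite sumr_const card_ord -[(\int[m]_x u x) *+ N]mulr_natl mulrA mulVf// mul1r.
      rewrite ler_norml; apply/andP; split.
        rewrite lerBrDl; apply: Rintegral_ge_cst => // x.
        have := hN x; rewrite (fixed_cst v hv Pv x point) ler_norml => /andP[+ _]; lra.
      rewrite lerBlDl; apply: Rintegral_le_cst => // x.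
      have := hN x; rewrite (fixed_cst v hv Pv x point) ler_norml => /andP[_]; lra.
    by case/filter_ex.
  apply: borel_measure_unique.
    by apply: (@le_lt_trans _ _ 1%E); [exact: probability_le1|exact: ltry].
  move=> u k uk _; have hu : holder_class a u by apply: (lipschitz_holder cX _ uk); rewrite a_gt0.
  rewrite EFin_Rintegral; last exact: (holder_integrable a_gt0).
  rewrite EFin_Rintegral; last exact: (holder_integrable a_gt0).
  by rewrite int_eq.
exists (fun=> 1); first exact: eigenfunction1.
move=> psi k hpsi; elim: k psi hpsi => [|k ih] psi hpsi.
  by move=> psi0; exists 0 => x; rewrite mul0r; exact: psi0.
rewrite iterSr => iter0.
have [h1 h2] := (complexified_spaceP psi).1 hpsi.
have [c cP] : exists c : R[i], forall x, Pc psi x - 1 * psi x = c * 1.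
  apply: ih iter0; apply/complexified_spaceP.
  rewrite (_ : (fun y => _) = (fun y => Pc psi y + -1 * psi y)).
    apply: holder_complexD; first exact: holder_complex_complexified.
    by apply: holder_complexZ; split.
  by apply/funext => y; rewrite mul1r mulN1r.
have PcE x : Pc psi x = psi x + c.
  by have := cP x; rewrite mul1r mulr1 => <-; rewrite addrC subrK.
have e1 x : P (cRe \o psi) x = cRe (psi x) + cRe c.
  by have := congr1 cRe (PcE x); case: (psi x) => ? ?; case: (c).
have e2 x : P (cIm \o psi) x = cIm (psi x) + cIm c.
  by have := congr1 cIm (PcE x); case: (psi x) => ? ?; case: (c).
have c1 : cRe c = 0 := koopman_addC_eq0 h1 e1.
have c2 : cIm c = 0 := koopman_addC_eq0 h2 e2.
exists (psi point) => x; rewrite mulr1; apply/eqP; rewrite eq_complex.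
apply/andP; split; apply/eqP.
  apply: (fixed_point_cst ue h1); apply/funext => y.
  by rewrite e1 c1 addr0.
apply: (fixed_point_cst ue h2); apply/funext => y.
by rewrite e2 c2 addr0.
Unshelve. all: by end_near. Qed.

(* [1 + X + ... + X^(k-1)], evaluated at [P], kills [P v - v]; it is a product of
   factors [X - z] with [|z| = 1] and [z != 1], for which [P - z] is injective. *)
Lemma fixed_of_periodic k (v : X -> R) : (0 < k)%N -> holder_class a v ->
  iter k P v = v ->
  (forall lambda, eigenvalue_of (@hoelder_fun R X a) P lambda /\ `|lambda| = 1 ->
    lambda = 1) ->
  P v = v.
Proof.
move=> k0 hv Pkv ev.
pose Tc (chi : X -> R[i]) i := iter i Pc chi.
have hT chi i : holder_complex chi -> holder_complex (Tc chi i).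
  by move=> h; elim: i => // i ih; exact: holder_complex_complexified.
have hsum chi (c : nat -> R[i]) N : holder_complex chi ->
    holder_complex (fun x => \sum_(i < N) c i * Tc chi i x).
  move=> h; elim: N => [|N ih].
    rewrite (_ : (fun x => _) = fun=> (0 : R)%:C); last first.
      by apply/funext => x; rewrite big_ord0.
    exact: (holder_complex_real (holder_class_cst a 0)).
  rewrite (_ : (fun x => _) = fun x => \sum_(i < N) c i * Tc chi i x + c N * Tc chi N x).
    by apply: holder_complexD => //; apply: holder_complexZ; exact: hT.
  by apply/funext => x; rewrite big_ord_recr.
have Tsum chi (c : nat -> R[i]) N : holder_complex chi ->
    Pc (fun x => \sum_(i < N) c i * Tc chi i x) =
    (fun x => \sum_(i < N) c i * Tc chi i.+1 x).
  move=> h; elim: N => [|N ih].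
    rewrite (_ : (fun x => _) = fun=> (0 : R)%:C); last first.
      by apply/funext => x; rewrite big_ord0.
    rewrite (complexified_real (fun=> 0)) koopman_cst.
    by apply/funext => x; rewrite big_ord0.
  rewrite (_ : (fun x => _) = fun x => \sum_(i < N) c i * Tc chi i x + c N * Tc chi N x).
    rewrite complexifiedD; [|exact: hsum|by apply: holder_complexZ; exact: hT].
    rewrite ih complexifiedZ; last exact: hT.
    by apply/funext => x; rewrite big_ord_recr.
  by apply/funext => x; rewrite big_ord_recr.
(* Removing one factor: if the remaining product did not kill [chi], the resulting [chi'] would be
   an eigenfunction for [z], a peripheral value other than 1. *)
have elim_factors (rs : seq R[i]) : (forall z, z \in rs -> `|z| = 1 /\ z != 1) ->
    forall chi, holder_complex chi ->
    (forall x, \sum_(i < (size rs).+1) (\prod_(z <- rs) ('X - z%:P))`_i * Tc chi i x = 0) ->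
    forall x, chi x = 0.
  elim: rs => [|z rs ih] hrs chi hchi.
    by move=> h x; have := h x; rewrite big_nil big_ord_recl big_ord0 coef1 mul1r addr0.
  set p := \prod_(z <- rs) ('X - z%:P).
  have sp : size p = (size rs).+1 by rewrite size_prod_XsubC.
  move=> h; apply: (ih _ chi hchi) => [y yrs|]; first by apply: hrs; rewrite in_cons yrs orbT.
  rewrite -/p; set chi' := (fun x => \sum_(i < (size rs).+1) p`_i * Tc chi i x).
  have hchi' : holder_complex chi' by exact: hsum.
  have eig x : Pc chi' x = z * chi' x.
    apply/eqP; rewrite -subr_eq0; apply/eqP.
    rewrite Tsum//= -[RHS](h x) big_cons -/p.
    have pN : p`_(size rs).+1 = 0 by rewrite nth_default// sp.
    have -> : \sum_(i < (size (z :: rs)).+1) (('X - z%:P) * p)`_i * Tc chi i x =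
      \sum_(i < (size rs).+2) ('X * p)`_i * Tc chi i x -
      \sum_(i < (size rs).+2) z * (p`_i * Tc chi i x).
      rewrite -sumrB; apply: eq_bigr => i _.
      by rewrite mulrBl coefB coefCM mulrBl mulrA.
    congr (_ - _).
      rewrite [RHS]big_ord_recl coefXM mul0r add0r.
      by apply: eq_bigr => i _; rewrite coefXM.
    by rewrite [RHS]big_ord_recr/= pN mul0r mulr0 addr0 mulr_sumr.
  have [z1 /eqP zn1] := hrs z (mem_head _ _).
  apply: contrapT => nz; apply: zn1; apply: ev; split => //.
  exists chi'; split => //; first exact/complexified_spaceP.
  by apply: contrapT => nx; apply: nz => x; apply: contrapT => /eqP ?; apply: nx; exists x.
pose Q : {poly R[i]} := \poly_(i < k) 1.
have [rs Qrs] := closed_field_poly_normal Q.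
have lQ : lead_coef Q = 1 by rewrite lead_coef_poly ?oner_neq0.
rewrite lQ scale1r in Qrs.
have srs : (size rs).+1 = k.
  have sQ : size Q = k by rewrite size_poly_eq ?oner_neq0.
  by rewrite -sQ Qrs size_prod_XsubC.
(* The roots are [k]-th roots of unity; 1 is not among them since [Q] takes the value [k] there. *)
have rsP z : z \in rs -> `|z| = 1 /\ z != 1.
  move=> zrs; have : root Q z by rewrite Qrs root_prod_XsubC.
  rewrite rootE horner_poly => /eqP.
  rewrite (eq_bigr (fun i : 'I_k => z ^+ i)); last by move=> i _; rewrite mul1r.
  move=> s0; have zk : z ^+ k = 1.
    by apply/eqP; rewrite -subr_eq0 subrX1 s0 mulr0.
  split.
    by apply/eqP; rewrite -(@pexpr_eq1 _ _ k)// -normrX zk normr1.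
  apply/eqP => z1; move: s0; rewrite z1.
  under eq_bigr do rewrite expr1n.
  by rewrite sumr_const card_ord => /eqP; rewrite pnatr_eq0 eqn0Ngt k0.
have hPv : holder_class a (P v) by exact: (Pn_class 1).
pose w x := P v x + -1 * v x.
have hw : holder_class a w by apply: holder_classD => //; exact: holder_classZ.
have iw i : Tc (fun x => (w x)%:C) i = (fun x => (iter i.+1 P v x - iter i P v x)%:C).
  elim: i => [|i ih]; first by apply/funext => x; rewrite /Tc /w /= mulN1r.
  rewrite /Tc iterS -/(Tc _ i) ih complexified_real; apply/funext => x; congr (_%:C).
  have hi := Pn_class i hv; have hi1 := Pn_class i.+1 hv.
  have -> : (fun x => iter i.+1 P v x - iter i P v x) =
      (fun x => iter i.+1 P v x + -1 * iter i P v x).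
    by apply/funext => y; rewrite mulN1r.
  have e1 := congr1 (@^~ x) (PnD 1 hi1 (holder_classZ (-1) hi)).
  have e2 := congr1 (@^~ x) (PnZ 1 (-1) hi).
  by move: e1 e2 => /= -> ->; rewrite mulN1r.
have w0 : forall x, (w x)%:C = 0.
  apply: (elim_factors rs rsP) => [|x]; first exact: holder_complex_real.
  rewrite -Qrs srs.
  rewrite (eq_bigr (fun i : 'I_k => (iter i.+1 P v x)%:C - (iter i P v x)%:C)); last first.
    by move=> i _; rewrite coef_poly ltn_ord mul1r iw rmorphB.
  rewrite -(big_mkord xpredT (fun i => (iter i.+1 P v x)%:C - (iter i P v x)%:C)).
  by rewrite (telescope_sumr (fun i => (iter i P v x)%:C))// Pkv subrr.
apply/funext => x; apply/eqP; rewrite -subr_eq0 -mulN1r.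
by have [/eqP] := w0 x.
Qed.

(** The set [F i] is where [phi] equals [lambda ^+ i * phi x0] on its maximum modulus set. Taking
    for [p] the exact order of [lambda] makes the first [p] sets disjoint; indexing by all naturals
    turns [k] steps of the dynamics into a translation by [k]. *)
Lemma cyclic_sets (lambda : R[i]) (phi : X -> R[i]) :
  eigenfunction (@hoelder_fun R X a) P lambda phi -> `|lambda| = 1 -> lambda != 1 ->
  exists (p : nat) (F : nat -> set X),
  [/\ (2 <= p)%N /\ forall i, F (i + p)%N = F i,
     forall i, closed (F i) /\ F i !=set0,
     forall i j, (i < j < p)%N -> F i `&` F j = set0 &
     forall k, {ae Pr, forall w, forall i, fiter f k w @` F i `<=` F (i + k)%N}].
Proof.
move=> [/complexified_spaceP hphi phi0 eq_phi] lambda1 ln1.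
pose A := maximum_modulus phi.
have [x0 Ax0] : A !=set0 := maximum_modulus_nonempty hphi.
have [p0 p0_gt0 lp0] := peripheral_root_of_unity hphi eq_phi lambda1 phi0.
have ex_p : exists p, (0 < p)%N && (lambda ^+ p == 1).
  by exists p0; rewrite p0_gt0 lp0 eqxx.
pose p := ex_minn ex_p.
have [p_gt0 lp pmin] : [/\ (0 < p)%N, lambda ^+ p = 1 &
    forall j, (0 < j)%N -> lambda ^+ j = 1 -> (p <= j)%N].
  rewrite /p; case: ex_minnP => m /andP[m0 /eqP lm] min; split => // j j0 lj.
  by apply: min; rewrite j0 lj eqxx.
have p2 : (2 <= p)%N.
  by move: p_gt0 lp; case: (p) => [//|[|//]] _; rewrite expr1 => /eqP; rewrite (negbTE ln1).
have phix0 : phi x0 != 0 := maximum_modulus_neq0 phi0 Ax0.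
have l0 : lambda != 0.
  by apply: contra_eq_neq lambda1 => ->; rewrite normr0 eq_sym oner_neq0.
exists p, (fun i => A `&` [set x | phi x = lambda ^+ i * phi x0]); split.
- by split => // i; rewrite exprD lp mulr1.
- move=> i; split.
    apply: closedI; first exact: maximum_modulus_closed.
    have [h1 h2] := hphi; pose c := lambda ^+ i * phi x0.
    rewrite (_ : [set x | _] = [set x | cRe (phi x) = cRe c] `&` [set x | cIm (phi x) = cIm c]).
      apply: closedI.
        exact: (closed_comp (fun x _ => holder_class_continuous a_gt0 h1 (x := x)) (@closed_eq _ _)).
      exact: (closed_comp (fun x _ => holder_class_continuous a_gt0 h2 (x := x)) (@closed_eq _ _)).
    apply/seteqP; split => x /=; first by move=> ->.
    by move=> [e1 e2]; apply/eqP; rewrite eq_complex e1 e2 !eqxx.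
  have [y [Ay yE]] := peripheral_orbit hphi eq_phi lambda1 i Ax0.
  by exists y.
- move=> i j /andP[ij jp]; apply/seteqP; split => // x [[_ /= ->] [_ /= E]].
  have := pmin (j - i)%N; rewrite subn_gt0 ij => /(_ isT).
  have -> : lambda ^+ (j - i) = 1.
    have li0 : lambda ^+ i != 0 by rewrite expf_neq0.
    apply: (mulfI li0); rewrite -exprD subnKC ?(ltnW ij)// mulr1.
    exact/esym/(mulIf phix0).
  move=> /(_ erefl); rewrite leqNgt (leq_ltn_trans (leq_subr i j))//.
- move=> k; have := peripheral_ae hphi eq_phi lambda1 k.
  apply: filterS => w h i _ [x [Ax /= xE] <-]; have [Ay yE] := h x Ax.
  by split => //=; rewrite yE xE mulrA -exprD addnC.
Qed.

(** Adding a bound [M] makes [u] nonnegative, so that its maxima are points of maximum modulus for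
    the eigenvalue 1. *)
Lemma max_invariant (u : X -> R) : holder_class a u -> P u = u ->
  [/\ closed [set x | forall y, u y <= u x], [set x | forall y, u y <= u x] !=set0 &
    invariant_set Pr f 1 [set x | forall y, u y <= u x]].
Proof.
move=> hu Pu; have [M uM] := holder_class_bounded cX a_gt0 hu.
pose phi x : R[i] := (u x + M)%:C.
have hphi : holder_complex phi.
  apply: holder_complex_real; apply: holder_classD => //; exact: holder_class_cst.
have uM0 x : 0 <= u x + M by have := uM x; rewrite ler_norml => /andP[+ _]; lra.
have AE : maximum_modulus phi = [set x | forall y, u y <= u x].
  apply/seteqP; split => x /= h y; have := h y;
    by rewrite /= expr0n/= !addr0 ler_sqr ?nnegrE// lerD2r.
have eig x : Pc phi x = 1 * phi x.
  rewrite mul1r /phi complexified_real; congr (_%:C).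
  have := congr1 (@^~ x) (PnD 1 hu (holder_class_cst a M)).
  by move=> /= ->; rewrite Pu koopman_cst.
rewrite -AE; split; [exact: maximum_modulus_closed|exact: maximum_modulus_nonempty|].
have := peripheral_ae hphi eig (normr1 _) 1.
by apply: filterS => w h _ [x Ax <-]; exact: (h x Ax).1.
Qed.

(** The maxima and the minima of [u] form two closed invariant sets; they must meet, and then [u] is
    constant. *)
Lemma mingled_fixed_cst : mingled Pr f -> forall u, holder_class a u -> P u = u ->
  forall x y, u x = u y.
Proof.
move=> ming u hu Pu.
have hNu : holder_class a (fun x => -1 * u x) by exact: holder_classZ.
have PNu : P (fun x => -1 * u x) = (fun x => -1 * u x).
  by etransitivity; [exact: (PnZ 1 (-1) hu)|rewrite /= Pu].
have [c1 n1 i1] := max_invariant hu Pu; have [c2 n2 i2] := max_invariant hNu PNu.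
have [z [hz1 hz2]] : [set x | forall y, u y <= u x] `&`
    [set x | forall y, -1 * u y <= -1 * u x] !=set0.
  apply/set0P/eqP => AB0; apply: (ming 1%N isT).
  by exists [set x | forall y, u y <= u x], [set x | forall y, -1 * u y <= -1 * u x].
have uz x : u x = u z.
  by apply/eqP; rewrite eq_le hz1/=; have := hz2 x; rewrite !mulN1r lerN2.
by move=> x y; rewrite !uz.
Qed.

Lemma invariant_set_koopman k (Y : set X) c (u : X -> R) : invariant_set Pr f k Y ->
  holder_class a u -> (forall x, Y x -> u x = c) ->
  forall x, Y x -> iter k P u x = c.
Proof.
move=> inv hu uc x Yx; apply: (Rintegral_fiter_ae (v := fun=> c)) => //.
by rewrite /invariant_set in inv; apply: filterS inv => w h; apply: uc; apply: h; exists x.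
Qed.

(** Disjoint sets invariant under [k] steps give, from a Urysohn function, a fixed function of
    [iter k P] separating them. The gap makes it a fixed function of [P] and thus constant, a
    contradiction. Conversely, a peripheral value other than 1 has order [p >= 2], and [F 0] and
    [F 1] are disjoint and invariant under [p] steps. *)
Lemma spectral_gapP : spectral_gap (@hoelder_fun R X a) P <-> mingled Pr f.
Proof.
split=> [[_ gap] k k0 [Y [Z [[cY [y0 Yy0] iY] [cZ [z0 Zz0] iZ] YZ]]]|ming].
  have [K [u [uK uY uZ]]] := lipschitz_urysohn cX cY cZ YZ.
  have hu : holder_class a u by apply: (lipschitz_holder cX _ uK); rewrite a_gt0.
  have [C C0 hC] := hu; have [M uM] := holder_class_bounded cX a_gt0 hu.
  have [v [hv Pkv vlim _]] := birkhoff_fixed_point k C0 hC uM.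
  have Pv : P v = v.
    apply: (fixed_of_periodic k0 hv Pkv) => lambda [[phi eig] l1].
    by have [] := gap lambda phi l1 eig.
  have v_on (W : set X) c x : invariant_set Pr f k W ->
      (forall x, W x -> u x = c) -> W x -> v x = c.
    move=> iW uW Wx.
    have ic j : forall x, W x -> iter (k * j) P u x = c.
      elim: j => [|j ih]; first by rewrite muln0.
      by rewrite mulnS iterD; apply: invariant_set_koopman => //; exact: Pn_class.
    apply: (cvg_unique _ (vlim x)) => //.
    apply: (@cvg_near_cst _ _ _ _ natU); near=> N.
    rewrite (eq_bigr (fun=> c)); last by move=> j _; exact: ic.
    rewrite sumr_const card_ord -[c *+ N]mulr_natl mulrA mulVf ?mul1r//.
    by rewrite pnatr_eq0 -lt0n; near: N; exact: natU_ge.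
  have vy : v y0 = 1 by exact: v_on iY uY Yy0.
  have vz : v z0 = 0 by exact: v_on iZ uZ Zz0.
  have eig : eigenfunction (@hoelder_fun R X a) P 1 (fun x => (v x)%:C).
    split.
    - by apply/complexified_spaceP; exact: holder_complex_real.
    - by exists y0; rewrite vy oner_neq0.
    - by move=> x; rewrite complexified_real Pv mul1r.
  have [_ [c cP]] := gap 1 _ (normr1 _) eig.
  have := cP y0; rewrite -(cP z0) vy vz => -[] /eqP.
  by rewrite oner_eq0.
split; first exact: koopman_quasi_compact.
move=> lambda phi l1 eig.
have l_eq1 : lambda = 1.
  apply: contrapT => /eqP ln1.
  have [p [F [[p2 Fp] FP disj inv]]] := cyclic_sets eig l1 ln1.
  have invp i : invariant_set Pr f p (F i).
    by apply: filterS (inv p) => w h; have := h i; rewrite Fp.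
  apply: (ming p (ltnW p2)); exists (F 0%N), (F 1%N); split.
  - by have [? ?] := FP 0%N; split.
  - by have [? ?] := FP 1%N; split.
  - by apply: disj; rewrite p2.
split => //; have [/complexified_spaceP[h1 h2] _ eq_phi] := eig.
exists (phi point) => x; apply/eqP; rewrite eq_complex; apply/andP; split; apply/eqP.
  apply: (mingled_fixed_cst ming h1); apply/funext => y.
  by have := congr1 cRe (eq_phi y); rewrite l_eq1 mul1r.
apply: (mingled_fixed_cst ming h2); apply/funext => y.
by have := congr1 cIm (eq_phi y); rewrite l_eq1 mul1r.
Unshelve. all: by end_near. Qed.

(** For a cycle of sets, averaging [iter p P] on a Urysohn function gives [v] equal to 1 on one set
    and 0 on the others. If 1 is the only peripheral eigenvalue then [P v = v], although [P] moves
    these values one step around the cycle. *)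
Lemma unique_peripheral_eigenvalueP :
  (forall lambda : R[i],
     eigenvalue_of (@hoelder_fun R X a) P lambda /\ `|lambda| = 1 <-> lambda = 1) <->
  aperiodic Pr f.
Proof.
split=> [ev [p [F [p2 FP disj inv]]]|aper lambda].
  case: p p2 F FP disj inv => [//|p] p2 F FP disj inv.
  pose i0 : 'I_p.+1 := ord0; pose i1 : 'I_p.+1 := ordS i0.
  have i10 : i1 != i0.
    by rewrite /i1 -val_eqE/= modn_small.
  pose Z := \bigcup_(i in [set i | i != i0]) F i.
  have cZ : closed Z.
    by apply: closed_bigcup => [|i _]; [exact: finite_finset|exact: (FP i).1].
  have YZ : F i0 `&` Z = set0.
    apply/seteqP; split => // x [F0x [i /= ii0 Fix]].
    by have : (F i `&` F i0) x by []; rewrite disj.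
  have [K [u [uK uY uZ]]] := lipschitz_urysohn cX (FP i0).1 cZ YZ.
  have hu : holder_class a u by apply: (lipschitz_holder cX _ uK); rewrite a_gt0.
  have uF i x : F i x -> u x = (i == i0)%:R.
    move=> Fix; have [ii0|ii0] := eqVneq i i0; first by apply: uY; rewrite -ii0.
    by apply: uZ; exists i.
  have [C C0 hC] := hu; have [M uM] := holder_class_bounded cX a_gt0 hu.
  have [v [hv Pkv vlim _]] := birkhoff_fixed_point p.+1 C0 hC uM.
  have stepF (g : X -> R) (e : 'I_p.+1 -> R) : holder_class a g ->
      (forall i x, F i x -> g x = e i) -> forall i x, F i x -> P g x = e (ordS i).
    move=> hg ge i x Fix; apply: (@Rintegral_fiter_ae 1 g (fun=> e (ordS i)) x) => //.
    by apply: filterS inv => w h; apply: ge; apply: h; exists x.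
  have iterF (g : X -> R) (e : 'I_p.+1 -> R) j : holder_class a g ->
      (forall i x, F i x -> g x = e i) ->
      forall i x, F i x -> iter j P g x = e (iter j (@ordS p.+1) i).
    move=> hg ge; elim: j => [|j ih] //= i x Fix.
    have -> : ordS (iter j (@ordS p.+1) i) = iter j (@ordS p.+1) (ordS i).
      by rewrite -iterS iterSr.
    exact: (stepF _ (fun i => e (iter j (@ordS p.+1) i)) (Pn_class j hg) ih).
  have ordSp i j : iter (p.+1 * j) (@ordS p.+1) i = i.
    have h m : val (iter m (@ordS p.+1) i) = ((i + m) %% p.+1)%N.
      elim: m => [|m ih] /=; first by rewrite addn0 modn_small.
      by rewrite ih -addn1 modnDml addn1 addnS.
    by apply: val_inj; rewrite h addnC mulnC modnMDl modn_small.
  have vF i x : F i x -> v x = (i == i0)%:R.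
    move=> Fix; apply: (cvg_unique _ (vlim x)) => //.
    apply: (@cvg_near_cst _ _ _ _ natU); near=> N.
    rewrite (eq_bigr (fun=> (i == i0)%:R)); last first.
      by move=> j _; rewrite (iterF _ _ _ hu uF i x Fix) ordSp.
    rewrite sumr_const card_ord -[_%:R *+ N]mulr_natl mulrA mulVf ?mul1r//.
    by rewrite pnatr_eq0 -lt0n; near: N; exact: natU_ge.
  have Pv : P v = v.
    by apply: (fixed_of_periodic _ hv Pkv) => // lambda /ev.
  have [x F0x] := (FP i0).2.
  have := stepF _ _ hv vF i0 x F0x; rewrite Pv (vF _ _ F0x) eqxx (negbTE i10).
  by move=> /eqP; rewrite oner_eq0.
split=> [[[phi eig] l1]|->]; last by split; [exists (fun=> 1); exact: eigenfunction1|exact: normr1].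
apply: contrapT => /eqP ln1; apply: aper.
have [p [F [[p2 Fp] FP disj inv]]] := cyclic_sets eig l1 ln1.
exists p, (fun i : 'I_p => F i); split => //.
  move=> i j; rewrite -val_eqE neq_ltn => /orP[ij|ji]; first by apply: disj; rewrite ij/=.
  by rewrite setIC; apply: disj; rewrite ji/=.
apply: filterS (inv 1%N) => w h i; have := h i; rewrite addn1 => hi.
have -> : F (ordS i) = F i.+1.
  rewrite /=; have [->|ip] := eqVneq i.+1 p; first by rewrite modnn -(Fp 0%N).
  by rewrite modn_small// ltn_neqAle ip ltn_ord.
exact: hi.
Unshelve. all: by end_near. Qed.

End contracting.

Lemma spectral_characterization :
  (forall mu : probability (borel X) R,
    stationary Pr f mu -> (lyapunov Pr f mu < 0)%E) ->
  exists2 alpha0 : R, 0 < alpha0 &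
    forall alpha : R, 0 < alpha <= alpha0 ->
      let iota := @hoelder_fun R X alpha in
      [/\ quasi_compact iota P,
          simple_eigenvalue iota P 1 <-> uniquely_ergodic Pr f,
          (forall lambda : R[i],
             eigenvalue_of iota P lambda /\ `|lambda| = 1 <-> lambda = 1) <->
            aperiodic Pr f &
          spectral_gap iota P <-> mingled Pr f].
Proof.
move=> f_lyapunov.
have [n [a [r [q [[n0 /andP[a0 abeta] a1] [r0 /andP[q0 q1] hq]]]]]] :=
  contraction f_lyapunov.
exists a => // b /andP[b0 ba].
have bb : b <= beta := le_trans ba abeta.
have b1 : b <= 1 := le_trans ba a1.
have qb0 : 0 < q `^ (b / a) by exact: powR_gt0.
have qb1 : q `^ (b / a) < 1.
  have s0 : 0 < b / a by rewrite divr_gt0.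
  have p1 : 1 `^ (b / a) = 1 :> R by rewrite powR1.
  by rewrite -[ltRHS]p1 gt0_ltr_powR// nnegrE ?ltW.
have b0a : 0 < b <= a by rewrite b0.
have hqb := contraction_le_exponent b0a q0 hq.
split.
- exact: (koopman_quasi_compact b0 bb b1 r0 qb0 qb1 hqb).
- exact: (simple_eigenvalueP n0 b0 bb b1 r0 qb0 qb1 hqb).
- exact: (unique_peripheral_eigenvalueP n0 b0 bb b1 r0 qb0 qb1 hqb).
- exact: (spectral_gapP n0 b0 bb b1 r0 qb0 qb1 hqb).
Qed.

End lipschitz_random_map.

(** * Reduction to everywhere Lipschitz maps *)

Section almost_everywhere_equal_maps.
Context {R : realType} {X : pmetricType R} {d : measure_display}
  {T : measurableType d}.
Local Notation S := (bernoulli_space T).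
Variables (p : probability T R) (Pr : probability S R).
Hypothesis bern : bernoulli_product p Pr.

Lemma ae_shift (Q : S -> Prop) : {ae Pr, forall w, Q w} ->
  {ae Pr, forall w, Q (Defs.shift w)}.
Proof.
move=> [N [mN N0 QN]]; have mshift := @measurable_shift d T.
have mN' : measurable (Defs.shift @^-1` N : set S).
  by rewrite -[X in measurable X]setTI; exact: mshift.
exists (Defs.shift @^-1` N); split => //; last by move=> w /= /QN.
have <- : (\int[Pr]_w (\1_(Defs.shift @^-1` N) w)%:E = Pr (Defs.shift @^-1` N))%E.
  by rewrite integral_indic// setIT.
rewrite -[RHS]N0 -[in RHS](setIT N) -(integral_indic Pr measurableT mN).
apply: (ge0_integral_shift bern (F := fun w => (\1_N w)%:E)).
  by apply/measurable_EFinP; exact: measurable_indic.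
by move=> w; rewrite lee_fin.
Qed.

Lemma ae_iter_shift k (Q : S -> Prop) : {ae Pr, forall w, Q w} ->
  {ae Pr, forall w, Q (iter k Defs.shift w)}.
Proof.
move=> QP; elim: k => [//|k ih].
have := ae_shift ih; apply: filterS => w.
by rewrite iterSr.
Qed.

Lemma ae_fst d' (Y : measurableType d') (mu : probability Y R) (Q : S -> Prop) :
  {ae Pr, forall w, Q w} -> {ae (Pr \x mu)%E, forall z, Q z.1}.
Proof.
move=> [N [mN N0 QN]]; exists (N `*` setT); split.
- exact: measurableX.
- transitivity (Pr N * mu setT)%E; first exact: (product_measure1E Pr mu mN measurableT).
  by rewrite N0 mul0e.
- by move=> z /= /QN.
Qed.

Variables f g : S -> X -> X.
Hypothesis fg : {ae Pr, forall w, f w = g w}.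

Lemma ae_fiter k : {ae Pr, forall w, fiter f k w = fiter g k w}.
Proof.
have := ae_foralln (fun i => ae_iter_shift i fg); apply: filterS => w h.
by elim: k => // k ih; rewrite /= h ih.
Qed.

Lemma ae_koopman : koopman Pr f = koopman Pr g.
Proof.
apply/funext => u; apply/funext => x; apply: ae_eq_Rintegral_nomeas.
by apply: filterS fg => w ->.
Qed.

Lemma ae_invariant_set : invariant_set Pr f = invariant_set Pr g.
Proof.
apply/funext => k; apply/funext => Y; apply/propext; rewrite /invariant_set.
have h := ae_fiter k.
by split => inv; move: inv h; apply: filterS2 => w /= + E; rewrite E.
Qed.

Lemma ae_mingled : mingled Pr f <-> mingled Pr g.
Proof. by rewrite /mingled ae_invariant_set. Qed.

Lemma ae_aperiodic : aperiodic Pr f <-> aperiodic Pr g.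
Proof.
have h n (F : 'I_n -> set X) :
    {ae Pr, forall w, forall i, f w @` F i `<=` F (ordS i)} <->
    {ae Pr, forall w, forall i, g w @` F i `<=` F (ordS i)}.
  by split => inv; move: inv fg; apply: filterS2 => w /= + E; rewrite E.
by split=> nex [n [F [n2 FP disj inv]]]; apply: nex; exists n, F; split => //; apply/h.
Qed.

Lemma ae_lyapunov mu : lyapunov Pr f mu = lyapunov Pr g mu.
Proof.
have E n : (\int[(Pr \x mu)%E]_z lne (local_Lip (fiter f n z.1) z.2) =
    \int[(Pr \x mu)%E]_z lne (local_Lip (fiter g n z.1) z.2))%E.
  apply: ae_eq_integral_nomeas; have := ae_fst mu (ae_fiter n).
  by apply: filterS => z ->.
rewrite /lyapunov; apply: (congr1 (fun u : nat -> \bar R => limn u)).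
by apply/funext => n; rewrite E.
Qed.

Hypothesis mf : measurable_fun setT (fun z : S * borel X => (f z.1 z.2 : borel X)).
Hypothesis mg : measurable_fun setT (fun z : S * borel X => (g z.1 z.2 : borel X)).

Lemma ae_stationary : stationary Pr f = stationary Pr g.
Proof.
apply/funext => mu; apply/propext.
have mskew (h : S -> X -> X) :
    measurable_fun setT (fun z : S * borel X => (h z.1 z.2 : borel X)) ->
    forall A : set (S * borel X), measurable A -> measurable (Defs.skew h @^-1` A).
  move=> mh A mA; rewrite -[X in measurable X]setTI.
  apply: measurable_fun_pair measurableT A mA => //.
  exact: (measurableT_comp (@measurable_shift d T) measurable_fst).
have E A : measurable A ->
    (Pr \x mu)%E (Defs.skew f @^-1` A) = (Pr \x mu)%E (Defs.skew g @^-1` A).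
  move=> mA; have mfA := mskew f mf A mA; have mgA := mskew g mg A mA.
  have I (B : set (S * borel X)) : measurable B ->
      (\int[(Pr \x mu)%E]_z (\1_B z)%:E = (Pr \x mu)%E B)%E.
    by move=> mB; rewrite integral_indic// setIT.
  rewrite -(I _ mfA) -(I _ mgA); apply: ae_eq_integral_nomeas.
  have := ae_fst mu fg; apply: filterS => z fgz.
  rewrite !indicE (_ : (z \in Defs.skew f @^-1` A) = (z \in Defs.skew g @^-1` A))//.
  by apply/idP/idP; rewrite !inE /preimage/= /Defs.skew fgz.
by split=> st A mA; [rewrite -E// st|rewrite E// st].
Qed.

Lemma ae_uniquely_ergodic : uniquely_ergodic Pr f <-> uniquely_ergodic Pr g.
Proof. by rewrite /uniquely_ergodic ae_stationary. Qed.

End almost_everywhere_equal_maps.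

Section lipschitz_representative.
Context {R : realType} {X : pmetricType R} {d : measure_display}
  {T : measurableType d}.
Local Notation S := (bernoulli_space T).
Variables (Pr : probability S R) (f : S -> X -> X).
Hypothesis mf : measurable_fun setT (fun z : S * borel X => (f z.1 z.2 : borel X)).

Lemma Lip_lipschitz_map (g : X -> X) : (Lip g < +oo)%E ->
  exists2 L : R, 1 <= L & lipschitz_map L g.
Proof.
move=> gfin; have [_ [L [L0 gL] <-] _] := ereal_inf_lt gfin.
exists (Num.max 1 L); first by rewrite le_max lexx.
move=> x y; apply: (le_trans (gL x y I I)).
by rewrite ler_wpM2r ?mdist_ge0// le_max lexx orbT.
Qed.

Hypothesis f_lip : {ae Pr, forall w, (Lip (f w) < +oo)%E}.

Lemma lipschitz_representative : exists g : S -> X -> X,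
  [/\ measurable_fun setT (fun z : S * borel X => (g z.1 z.2 : borel X)),
      {ae Pr, forall w, f w = g w} &
      forall w, g w = id \/ g w = f w /\ (Lip (f w) < +oo)%E].
Proof.
have [N [mN N0 fN]] := f_lip.
exists (fun w => if w \in N then id else f w); split.
- rewrite (_ : (fun z => _) = (fun z : S * borel X =>
      if z.1 \in N then z.2 else (f z.1 z.2 : borel X))); last first.
    by apply/funext => z; case: ifP.
  apply: measurable_fun_ifT => //.
    apply: (measurable_fun_bool true).
    rewrite (_ : _ `&` _ = N `*` setT); first exact: measurableX.
    apply/seteqP; split => [z [_ /= /set_mem Nz]|z [Nz _]]; first by [].
    by split => //=; exact: mem_set.
- exists N; split => // w /=; apply: contra_notP => Nw.
  by rewrite memNset.
move=> w; case: ifPn => [_|]; first by left.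
by rewrite notin_setE => Nw; right; split => //; apply: contrapT => h; exact/Nw/fN.
Qed.

End lipschitz_representative.

Theorem theorem2 (R : realType) (X : pmetricType R)
    (d : measure_display) (T : measurableType d)
    (p : probability T R) (Pr : probability (bernoulli_space T) R)
    (f : bernoulli_space T -> X -> X) :
  compact [set: X] ->
  bernoulli_product p Pr ->
  random_map Pr f ->
  mostly_contracting Pr f ->
  (exists2 beta : R, 0 < beta & (\int[Pr]_w (Lip (f w) `^ beta) < +oo)%E) ->
  exists2 alpha0 : R, 0 < alpha0 &
    forall alpha : R, 0 < alpha <= alpha0 ->
      let iota := @hoelder_fun R X alpha in
      let P := koopman Pr f in
      [/\ quasi_compact iota P,
          simple_eigenvalue iota P 1 <-> uniquely_ergodic Pr f,
          (forall lambda : R[i],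
             eigenvalue_of iota P lambda /\ `|lambda| = 1 <-> lambda = 1) <->
            aperiodic Pr f &
          spectral_gap iota P <-> mingled Pr f].
Proof.
move=> cX bern [mf [h fh]] [f_lip _ f_lyap] [beta beta0 f_beta].
have [g [mg fg gP]] := lipschitz_representative mf f_lip.
have gh : {ae Pr, forall w, g w = h (w 0%N)}.
  by move: fg fh; apply: filterS2 => w <-.
have gL w : exists2 L : R, 1 <= L & lipschitz_map L (g w).
  have [->|[-> fin]] := gP w; last exact: Lip_lipschitz_map.
  by exists 1 => // x y; rewrite mul1r.
(* At scale 0 there is no penalty and the floor is 1, so this is the larger of 1 and the global
   Lipschitz constant, in a form that is measurable in [w]. *)
pose Lw w : R := expR (log_modulus cX 0 (g w) point).
have mLw : measurable_fun setT Lw.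
  apply: (measurableT_comp (@measurable_expR R)).
  apply: (measurable_log_modulus cX 0 (G := g) (xi := fun=> point)) => //.
  by move=> y; exact: (measurableT_comp mg (pair2_measurable (y : borel X))).
have Lw_le w L : 1 <= L -> lipschitz_map L (g w) -> Lw w <= L.
  move=> L1 wL; rewrite -[leRHS]lnK ?posrE ?(lt_le_trans ltr01)// ler_expR.
  exact: log_modulus_le_ln L1 wL.
have Lw_ge1 w : 1 <= Lw w.
  have [L L1 wL] := gL w; rewrite -expR0 ler_expR.
  by have := log_modulus_ge cX 0 point L1 wL; rewrite oppr0.
have Lw_lip w x y : mdist (g w x) (g w y) <= Lw w * mdist x y.
  have [L L1 wL] := gL w; have := log_modulusP cX 0 point x y L1 wL.
  by rewrite mul0r addr0 mulrC.
have mLb : measurable_fun setT (fun w => Lw w `^ beta).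
  exact: (measurableT_comp (measurable_powR beta) mLw).
have Lwb1 w : 1 <= Lw w `^ beta.
  by rewrite -[leLHS](powRr0 (Lw w)) ler_powR// ltW.
have Lw_beta : (\int[Pr]_w (Lw w `^ beta)%:E < +oo)%E.
  (* Subtracting 1 makes the comparison hold for every word: where [Lw w] is 1, because of the floor
     or of the substituted identity, the left integrand is 0. *)
  have le1 : (\int[Pr]_w (Lw w `^ beta - 1)%:E <= \int[Pr]_w (Lip (f w) `^ beta))%E.
    apply: ge0_le_integral_nomeas => w; first by rewrite lee_fin subr_ge0.
    have [gid|[gf fin]] := gP w.
      have Lw1 : Lw w = 1.
        apply/eqP; rewrite eq_le Lw_ge1 andbT Lw_le// => x y.
        by rewrite gid mul1r.
      by rewrite Lw1 powR1 subrr poweR_ge0.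
    have [Lw1|Lw1] := leP (Lw w) 1.
      have -> : Lw w = 1 by apply/eqP; rewrite eq_le Lw1 Lw_ge1.
      by rewrite powR1 subrr poweR_ge0.
    have LwLip : ((Lw w)%:E <= Lip (f w))%E.
      apply: le_ereal_inf_tmp => _ [L [L0 fL] <-]; rewrite lee_fin.
      have : Lw w <= Num.max 1 L.
        apply: Lw_le; first by rewrite le_max lexx.
        move=> x y; rewrite gf (le_trans (fL x y I I))//.
        by rewrite ler_wpM2r ?mdist_ge0// le_max lexx orbT.
      by rewrite le_max leNgt Lw1.
    case: (Lip (f w)) LwLip fin => [l| |]//; rewrite lee_fin => Lwl _.
    rewrite poweR_EFin lee_fin lerBlDr (@le_trans _ _ (l `^ beta))// ?lerDl//.
    rewrite ge0_ler_powR ?nnegrE ?(ltW beta0)//; first by rewrite (le_trans ler01).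
    by rewrite (le_trans _ Lwl)// (le_trans ler01).
  have -> : (fun w => (Lw w `^ beta)%:E) = (fun w => (Lw w `^ beta - 1)%:E + 1%:E)%E.
    by apply/funext => w; rewrite -EFinD subrK.
  rewrite ge0_integralD//.
  - by rewrite lte_add_pinfty// ?(le_lt_trans le1)// integral_probability_cst ltry.
  - by move=> w _; rewrite lee_fin subr_ge0.
  - by apply/measurable_EFinP; exact: measurable_funB.
have g_lyap mu : stationary Pr g mu -> (lyapunov Pr g mu < 0)%E.
  rewrite -(ae_stationary fg mf mg) -(ae_lyapunov bern fg) => st.
  by apply: le_lt_trans f_lyap; apply: ereal_sup_ubound; exists mu.
have [a0 a00 ha0] := spectral_characterization cX mg (markov bern mg gh)
  mLw Lw_ge1 Lw_lip beta0 Lw_beta g_lyap.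
exists a0 => // a aa0; have := ha0 a aa0.
rewrite /= -(ae_koopman fg) => -[qc simple unique gap]; split => //.
- exact: (iff_trans simple (iff_sym (ae_uniquely_ergodic fg mf mg))).
- exact: (iff_trans unique (iff_sym (ae_aperiodic fg))).
- exact: (iff_trans gap (iff_sym (ae_mingled bern fg))).
Qed.
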